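(* Let $d\ge 3$, let $I\subset\mathbb{R}$ be a compact interval, let $\gamma:I\to\mathbb{R}^d$ be a $C^\infty$ curve and let $\chi\in C^\infty$ be supported in the interior of $I$. Suppose that for all $t\in I$ the vectors $\gamma'(t)$ and $\gamma''(t)$ are linearly independent. Then, for $R\ge 2$: (i) $$G_q(R)\lesssim \begin{cases} R^{-1/2}(\log R)^{1/2-1/q} & \text{if } 2\le q\le 4,\\ R^{-2/q}(\log R)^{1/q} & \text{if } 4\le q\le\infty.\end{cases}$$ (ii) Suppose in addition that there is $N\in\mathbb{N}$ such that for every $\omega\in S^{d-1}$ the function $s\mapsto\langle\omega,\gamma''(s)\rangle$ changes sign at most $N$ times on $I$. Then $$G_q(R)\lesssim R^{-1/2}\quad\text{if } 2\le q<4,\qquad\text{and}\qquad G_q(R)\lesssim R^{-2/q}\quad\text{if } 4<q\le\infty.$$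
   Context: For $\gamma$ and $\chi$ as in the claim, let $\mu=\mu_{\gamma,\chi}$ be the measure given by $\langle\mu,f\rangle=\int f(\gamma(t))\chi(t)\,dt$, with Fourier transform $\widehat\mu(\xi)=\int e^{-i\langle\xi,\gamma(t)\rangle}\chi(t)\,dt$. For $R>0$ put $$G_q(R)=G_q(R;\gamma,\chi)=\Big(\int_{S^{d-1}}|\widehat\mu(R\omega)|^q\,d\omega\Big)^{1/q},$$ where $d\omega$ is the rotation invariant measure on $S^{d-1}$ induced by Lebesgue measure in $\mathbb{R}^d$, and $G_\infty(R)=\max_{\omega\in S^{d-1}}|\widehat\mu(R\omega)|$. The notation $a\lesssim b$ means $a\le Cb$ with a nonnegative constant $C$ independent of $R$ (it may depend on $\gamma,\chi,q$, and in (ii) on $N$). Exponents $1/q$, $2/q$ are read as $0$ for $q=\infty$. *)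

(* Defs.v *)
From HB Require Import structures.
From mathcomp Require Import all_boot all_order all_algebra.
From mathcomp Require Import all_classical all_reals all_analysis.
From mathcomp Require Import measurable_realfun.
From mathcomp Require Export complex.

Set Implicit Arguments.
Unset Strict Implicit.
Unset Printing Implicit Defensive.
Import Order.TTheory GRing.Theory Num.Def Num.Theory.
Import numFieldNormedType.Exports.

Local Open Scope classical_set_scope.
Local Open Scope ring_scope.

(* Row vectors carry the sigma-algebra generated by the coordinates, as tuples
   do in the library; over the reals this is the Borel sigma-algebra. *)
Definition rV_display : measure_display -> measure_display.
Proof. exact. Qed.

Section measurable_rV.
Context {d} {T : sigmaRingType d}.
Variable n : nat.

Let coors : 'I_n -> 'rV[T]_n -> T := fun i v => v ord0 i.

Let rV_set0 : g_sigma_preimage coors set0.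
Proof. exact: sigma_algebra0. Qed.

Let rV_setC A : g_sigma_preimage coors A -> g_sigma_preimage coors (~` A).
Proof. exact: sigma_algebraC. Qed.

Let rV_bigcup (F : _^nat) : (forall i, g_sigma_preimage coors (F i)) ->
  g_sigma_preimage coors (\bigcup_i (F i)).
Proof. exact: sigma_algebra_bigcup. Qed.

HB.instance Definition _ := @isMeasurable.Build (rV_display d)
  'rV[T]_n (g_sigma_preimage coors) rV_set0 rV_setC rV_bigcup.

End measurable_rV.

Lemma measurable_coord d (T : sigmaRingType d) n (i : 'I_n) :
  measurable_fun [set: 'rV[T]_n] (fun v => v ord0 i).
Proof.
move=> _ Y mY; rewrite setTI; apply: sub_sigma_algebra => /=.
rewrite -bigcup_seq/=; exists i => /=; first by rewrite mem_index_enum.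
by exists Y => //; rewrite setTI.
Qed.

Lemma measurable_fun_coordP d1 d2 (T1 : measurableType d1)
    (T2 : measurableType d2) n (f : T1 -> 'rV[T2]_n) :
  (forall i, measurable_fun [set: T1] (fun x => f x ord0 i)) ->
  measurable_fun [set: T1] f.
Proof.
move=> mf _ A; rewrite setTI.
suff : g_sigma_preimage (fun i x => f x ord0 i) `<=` measurable.
  move=> + mA; apply.
  rewrite (g_sigma_preimage_comp (fun i (v : 'rV[T2]_n) => v ord0 i) f).
  by exists A => //; rewrite setTI.
apply: smallest_sub; first exact: sigma_algebra_measurable.
case: n => [|n] in f mf A *; first by rewrite big_ord0.
rewrite -bigcup_mkord_ord; apply: bigcup_sub => i Ii.
by move=> B [C mC <-]; exact: mf.
Qed.

Section lebesgue_rV.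
Context {R : realType}.

Section cons.
Context (n : nat).

Definition rV_cons (p : R * 'rV[R]_n) : 'rV[R]_n.+1 :=
  row_mx (p.1)%:M p.2 : 'rV[R]_(1 + n).

Lemma rV_consE p i :
  rV_cons p ord0 i = if unlift ord0 i is Some j then p.2 ord0 j else p.1.
Proof.
rewrite /rV_cons; case: unliftP => [j ->|->].
  by rewrite -rshift1 (@row_mxEr _ 1 1 n).
have -> : ord0 = lshift n ord0 :> 'I_(1 + n) by exact: val_inj.
by rewrite (@row_mxEl _ 1 1 n) mxE eqxx mulr1n.
Qed.

Lemma measurable_rV_cons : measurable_fun [set: R * 'rV[R]_n] rV_cons.
Proof.
apply: measurable_fun_coordP => i.
under eq_fun do rewrite rV_consE.
case: unliftP => [j _|_]; last exact: measurable_fst.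
apply: (measurableT_comp (measurable_coord j)).
exact: measurable_snd.
Qed.

Definition rV_uncons (v : 'rV[R]_n.+1) : R * 'rV[R]_n :=
  (v ord0 ord0, \row_j v ord0 (lift ord0 j)).

Lemma rV_consK : cancel rV_cons rV_uncons.
Proof.
move=> [x v]; rewrite /rV_uncons; congr pair.
  by rewrite rV_consE unlift_none.
by apply/rowP => j; rewrite mxE rV_consE liftK.
Qed.

Lemma measurable_rV_uncons : measurable_fun [set: 'rV[R]_n.+1] rV_uncons.
Proof.
apply: measurable_fun_pair; first exact: measurable_coord.
apply: measurable_fun_coordP => i.
by under eq_fun do rewrite mxE; exact: measurable_coord.
Qed.

Context (m : {sigma_finite_measure set 'rV[R]_n -> \bar R}).

Definition lebesgue_cons : set 'rV[R]_n.+1 -> \bar R :=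
  pushforward (@lebesgue_measure R \x m)%E rV_cons.

Let pm : {measure set 'rV[R]_n.+1 -> \bar R} :=
  measure_function_pushforward__canonical__measure_function_Measure
    (@lebesgue_measure R \x m)%E measurable_rV_cons.

HB.instance Definition _ := isMeasure.Build _ _ _ lebesgue_cons
  (measure0 pm) (measure_ge0 pm) (@measure_semi_sigma_additive _ _ _ pm).

Let lebesgue_cons_sigma_finite : sigma_finite setT lebesgue_cons.
Proof.
have /sigma_finiteP[F [FT ndF Foo]] := sigma_finiteT (@lebesgue_measure R).
have /sigma_finiteP[H [HT ndH Hoo]] := sigma_finiteT m.
exists (fun i => rV_uncons @^-1` (F i `*` H i)) => [|i].
  apply/esym/seteqP; split=> // v _.
  have [k _ Fk] : (\bigcup_i F i) (rV_uncons v).1 by rewrite -FT.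
  have [l _ Hl] : (\bigcup_i H i) (rV_uncons v).2 by rewrite -HT.
  exists (maxn k l) => //; split.
    by move: Fk; apply/subsetPset/ndF/leq_maxl.
  by move: Hl; apply/subsetPset/ndH/leq_maxr.
have [mF Fi] := Foo i; have [mH Hi] := Hoo i; split.
  rewrite -[X in measurable X]setTI; apply: measurable_rV_uncons => //.
  exact: measurableX.
rewrite /lebesgue_cons /pushforward -comp_preimage.
rewrite (_ : rV_uncons \o rV_cons = id); last exact/funext/rV_consK.
by rewrite preimage_id product_measure1E// lte_mul_pinfty// ge0_fin_numE.
Qed.

HB.instance Definition _ := Measure_isSigmaFinite.Build _ _ _ lebesgue_cons
  lebesgue_cons_sigma_finite.

End cons.

(* Lebesgue measure on R^n as an iterated product measure. *)
Fixpoint lebesgue_rV n : {sigma_finite_measure set 'rV[R]_n -> \bar R} :=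
  if n is n'.+1 then lebesgue_cons (lebesgue_rV n') else dirac (0 : 'rV[R]_0).

End lebesgue_rV.
Arguments lebesgue_rV : clear implicits.

Section euclidean.
Context {R : realType} {n : nat}.
Implicit Types (u v x : 'rV[R]_n) (A : set 'rV[R]_n).

Definition dotp u v : R := \sum_i u ord0 i * v ord0 i.

(* The library's norm [`|u|] on row vectors is the sup norm. *)
Definition enorm u : R := Num.sqrt (dotp u u).

Definition sphere : set 'rV[R]_n := [set w | enorm w = 1].

Lemma dotp_ge0 u : 0 <= dotp u u.
Proof. by apply: sumr_ge0 => i _; rewrite -expr2 sqr_ge0. Qed.

Lemma measurable_enorm : measurable_fun [set: 'rV[R]_n] enorm.
Proof.
rewrite (_ : enorm = fun u => dotp u u `^ 2^-1); last first.
  by apply/funext => u; rewrite powR12_sqrt ?dotp_ge0.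
apply: (measurableT_comp (measurable_powR 2^-1)).
apply: measurable_sum => i.
by apply: measurable_funM; exact: measurable_coord.
Qed.

Let normalize x := (enorm x)^-1 *: x.

Let punctured_ball : set 'rV[R]_n := [set x | 0 < enorm x <= 1].

Definition cone A : set 'rV[R]_n :=
  [set x | 0 < enorm x <= 1 /\ A ((enorm x)^-1 *: x)].

(* The surface measure of [S^(n-1)], extended by 0 to the ambient space.  In
   polar coordinates the Lebesgue measure of [cone A] is
   [sigma A * \int_0^1 r^(n-1) dr = sigma A / n]. *)
Definition surface_measure A : \bar R :=
  (n%:R%:E * lebesgue_rV R n (cone A))%E.

Let measurable_normalize : measurable_fun [set: 'rV[R]_n] normalize.
Proof.
apply: measurable_fun_coordP => i; under eq_fun do rewrite mxE.
apply: measurable_funM; last exact: measurable_coord.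
under eq_fun do rewrite -powR_inv1 ?sqrtr_ge0//.
exact: (measurableT_comp (measurable_powR (-1)) measurable_enorm).
Qed.

Let measurable_punctured_ball : measurable punctured_ball.
Proof.
rewrite (_ : punctured_ball = enorm @^-1` `]0, 1]).
  rewrite -[X in measurable X]setTI; exact: measurable_enorm.
by apply/seteqP; split=> x /=; rewrite in_itv.
Qed.

Let restr : {measure set 'rV[R]_n -> \bar R} :=
  mrestr (lebesgue_rV R n) measurable_punctured_ball.

Let pm : {measure set 'rV[R]_n -> \bar R} := mscale n%:R%:nng
  (measure_function_pushforward__canonical__measure_function_Measure
     restr measurable_normalize).

Let surface_measureE : surface_measure = pm.
Proof.
apply/funext => A.
rewrite /surface_measure /= /mscale /= /pushforward /restr /= /mrestr.
by congr (_ * lebesgue_rV R n _)%E; rewrite setIC.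
Qed.

Let surface_measure0 : surface_measure set0 = 0%E.
Proof. by rewrite surface_measureE measure0. Qed.

Let surface_measure_ge0 A : (0 <= surface_measure A)%E.
Proof. by rewrite surface_measureE measure_ge0. Qed.

Let surface_measure_sigma_additive : semi_sigma_additive surface_measure.
Proof. by rewrite surface_measureE; exact: measure_semi_sigma_additive. Qed.

HB.instance Definition _ := isMeasure.Build _ _ _ surface_measure
  surface_measure0 surface_measure_ge0 surface_measure_sigma_additive.

End euclidean.

Section smooth.
Context {R : realType} {V : normedModType R}.

(* Derivatives relative to [I]: one-sided at the endpoints of an interval, and
   independent of the values of [f] outside [I]. *)
Definition diff_quotient_on (I : set R) (f : R -> V) (t : R) : set_system V :=
  (s - t)^-1 *: (f s - f t) @[s --> within (I `\ t) (nbhs t)].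

Definition derive1_on (I : set R) (f : R -> V) (t : R) : V :=
  lim (diff_quotient_on I f t).

Definition derive1n_on (I : set R) (k : nat) (f : R -> V) : R -> V :=
  iter k (derive1_on I) f.

Definition smooth_on (I : set R) (f : R -> V) :=
  forall k t, I t -> cvg (diff_quotient_on I (derive1n_on I k f) t).

End smooth.

Section curve.
Context {R : realType} {d : nat}.
Local Open Scope complex_scope.

Definition expi (x : R) : R[i] := cos x +i* sin x.

Definition csmooth (chi : R -> R[i]) :=
  forall k t, derivable (derive1n k (fun s => complex.Re (chi s))) t 1 /\
              derivable (derive1n k (fun s => complex.Im (chi s))) t 1.

Definition cintegral (I : set R) (f : R -> R[i]) : R[i] :=
  Rintegral lebesgue_measure I (fun t => complex.Re (f t)) +i*
  Rintegral lebesgue_measure I (fun t => complex.Im (f t)).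

Definition mu_hat (I : set R) (gamma : R -> 'rV[R]_d) (chi : R -> R[i])
    (xi : 'rV[R]_d) : R[i] :=
  cintegral I (fun t => expi (- dotp xi (gamma t)) * chi t).

(* The case [q = +oo] is separate because ['N[_]_+oo] is an essential supremum.
   Here the supremum is a maximum, by continuity of [mu_hat] and compactness. *)
Definition G (I : set R) (gamma : R -> 'rV[R]_d) (chi : R -> R[i])
    (q : \bar R) (r : R) : \bar R :=
  let F w := (Normc.normc (mu_hat I gamma chi (r *: w)))%:E in
  if q == +oo%E then ereal_sup (F @` sphere)
  else ('N[surface_measure]_q [F])%E.

End curve.

Definition lesssim {R : realType} (f : R -> \bar R) (g : R -> R) :=
  exists2 C, 0 <= C & forall r, 2 <= r -> (f r <= (C * g r)%:E)%E.

(* [N.+1] sign changes are witnessed by [N.+2] increasing points at which the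
   values of [f] are nonzero with alternating signs. *)
Definition sign_changes_le {R : realType} (I : set R) (f : R -> R) (N : nat) :=
  forall s : seq R, {in s, forall t, I t} ->
    sorted (fun t u => (t < u) && (f t * f u < 0)) s -> (size s <= N.+1)%N.

(* Main.v *)
(* Only the C^2 bounds of the curve matter.  In directions [w] where [<w, gamma'>]
   or [<w, gamma''>] is not small, integration by parts and van der Corput's lemma
   give the pointwise bound R^(-1/2).  Near the common orthogonal complement of
   V1 = gamma'(t0) and V2 = gamma''(t0) the square of the transform, and the square
   of its square, are averaged: the surface measure is smeared in the
   directions V1 and V2, so that the frequencies gamma(s) - gamma(t),
   respectively gamma(s) + gamma(t) - gamma(s') - gamma(t'), contribute only when they are
   O(1/R).  After discretization (about R^2 sample points) this is a Schur-type sum over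
   pairs, in terms of the midpoint and of the squared half-length of [s, t], and the sum
   over lengths produces the logarithm.  This gives L^2 and L^4 bounds, and the
   other exponents follow by interpolation with the trivial L^oo bound.

   With boundedly many sign changes of <w, gamma''> the curve splits into boundedly many
   arcs with monotone <w, gamma'>; if the transform exceeds lambda, then <w, gamma'> is
   O(1/(R lambda)) on an arc of length >> lambda, hence at two consecutive points of a grid
   of mesh ~ lambda.  For each such pair this confines w to a slab of surface measure
   O(lambda^(-3) R^(-2)), so the transform is in weak L^4 with constant
   O(R^(-1/2)), and summing over dyadic levels gives all q <> 4. *)
Require Import Defs.
From mathcomp Require Import all_boot all_order all_algebra.
From mathcomp Require Import all_classical all_reals all_analysis.
From mathcomp Require Import measurable_realfun ring lra.
Set Implicit Arguments.
Unset Strict Implicit.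
Unset Printing Implicit Defensive.
Import Order.TTheory GRing.Theory Num.Theory.
Import numFieldNormedType.Exports.
Local Open Scope classical_set_scope.
Local Open Scope ring_scope.

(** * Lebesgue measure on row vectors and the surface measure *)

(** The sphere is never parametrised. A surface integral becomes the integral over a solid annulus
    of a function homogeneous of degree zero; there translation invariance allows every point to be
    replaced by an average over a small parallelogram spanned by multiples of V1 and V2. Averaging
    against the weight (1-y^2)^4, which vanishes to fourth order at the ends, admits four
    integrations by parts without boundary terms. Of the four powers of decay so obtained, two serve
    the midpoint variable and two the squared half-length, each enough for a bounded sum. Sampling
    turns the fourth power of an integral into a finite sum over pairs, so that frequencies need
    only be compared pairwise; with about R^2 points the sampling error in the transform is O(1/R),
    since the integrand has derivative O(R). All comparisons are relative: the error in a frequency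
    difference has to be a small multiple of the difference itself, and C^2 closeness to V1 and V2
    on a short arc gives this. Short arcs are glued by a supremum argument, so the local constants
    need not be uniform. *)

Section lebesgue_affine.
Context {R : realType}.
Local Notation mu := (@lebesgue_measure R).
Local Open Scope ereal_scope.

Lemma measurable_affine1 (c z : R) :
  measurable_fun [set: measurableTypeR R]
    (fun x : measurableTypeR R => c * x + z : measurableTypeR R)%R.
Proof. by apply: measurable_funD => //; apply: measurable_funM. Qed.

(** By uniqueness of Lebesgue measure: [c] times the pushforward agrees with it on half-open
    intervals. *)
Lemma lebesgue_measure_affine (c z : R) (A : set R) : (0 < c)%R -> measurable A ->
  pushforward mu (fun x : R => c * x + z : measurableTypeR R)%R A = c^-1%:E * mu A.
Proof.
move=> c0 mA.
have ci0 : (0 <= c^-1)%R by rewrite invr_ge0 ltW.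
have mf := measurable_affine1 c z.
pose m1 : {measure set (measurableTypeR R) -> \bar R} := @mscale _ (measurableTypeR R) R (NngNum (ltW c0))
  (measure_function_pushforward__canonical__measure_function_Measure mu mf).
have : mu A = m1 A.
  apply: lebesgue_measure_unique => // _ [[a b]] _ <-.
  transitivity (c%:E * mu `] ((a - z) / c)%R, ((b - z) / c)%R]); last first.
    congr (_ * mu _); apply/seteqP; split => x /=;
      rewrite !in_itv /= ltr_pdivrMr// ler_pdivlMr// ltrBlDr lerBrDr;
      by rewrite [(x * c)%R]mulrC.
  rewrite !lebesgue_measure_itv /= !lte_fin ltr_pM2r ?invr_gt0// ltrD2r.
  case: ifP => _; last by rewrite mule0.
  by rewrite -EFinM; congr (_%:E); field; apply: lt0r_neq0.
rewrite /m1 /mscale /= => ->.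
by rewrite muleA -EFinM mulVf ?gt_eqF// mul1e.
Qed.

Lemma ge0_integral_affine1 (c z : R) (f : R -> \bar R) : (0 < c)%R ->
  measurable_fun setT f -> (forall x, 0 <= f x) ->
  \int[mu]_x f (c * x + z)%R = c^-1%:E * \int[mu]_x f x.
Proof.
move=> c0 mf f0.
have ci0 : (0 <= c^-1)%R by rewrite invr_ge0 ltW.
have ma := measurable_affine1 c z.
rewrite -[LHS](@ge0_integral_pushforward _ _ _ _ _ _ ma mu setT)//.
rewrite -(ge0_integral_mscale mu measurableT (NngNum ci0))//.
apply: eq_measure_integral => A mA _.
exact: lebesgue_measure_affine.
Qed.

Lemma ge0_integral_rV_cons n (f : 'rV[R]_n.+1 -> \bar R) :
  measurable_fun setT f -> (forall x, 0 <= f x) ->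
  \int[lebesgue_rV R n.+1]_x f x =
  \int[mu]_x \int[lebesgue_rV R n]_v f (rV_cons (x, v)).
Proof.
move=> mf f0.
have mc : @measurable_fun _ _ (measurableTypeR R * 'rV[R]_n)%type _ setT
  (@rV_cons R n) := @measurable_rV_cons R n.
have mfc := measurableT_comp mf mc.
transitivity (\int[mu \x lebesgue_rV R n]_z f (rV_cons z)).
  rewrite -[setT in RHS](preimage_setT (@rV_cons R n)).
  by rewrite -(ge0_integral_pushforward mc).
apply: (fubini_tonelli1 (m1 := mu) (f \o @rV_cons R n)) => //.
by move=> x; exact: f0.
Qed.

Lemma measurable_rV_affine n (c : R) (z : 'rV[R]_n) :
  measurable_fun setT (fun x : 'rV[R]_n => c *: x + z)%R.
Proof.
apply: measurable_fun_coordP => i.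
under eq_fun do rewrite !mxE.
apply: measurable_funD => //; apply: measurable_funM => //.
exact: measurable_coord.
Qed.

(** Induction on the dimension: [ge0_integral_rV_cons] peels off the first coordinate, and each
    coordinate contributes one factor [c^-1]. Two instances matter later: [c = 1] is translation
    invariance, [c = 2] compares a ball with the ball of half the radius. *)
Lemma ge0_integral_affine n (c : R) (z : 'rV[R]_n) (f : 'rV[R]_n -> \bar R) :
  (0 < c)%R -> measurable_fun setT f -> (forall x, 0 <= f x) ->
  \int[lebesgue_rV R n]_x f (c *: x + z)%R = (c ^- n)%:E * \int[lebesgue_rV R n]_x f x.
Proof.
move=> c0; elim: n z f => [|n IH] z f mf f0.
  rewrite expr0 invr1 mul1e; apply: eq_integral => x _.
  by congr f; apply/rowP => -[].
have mfc : measurable_fun [set: measurableTypeR R * 'rV[R]_n] (f \o @rV_cons R n).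
  exact: measurableT_comp mf (@measurable_rV_cons R n).
rewrite !ge0_integral_rV_cons//; last exact: measurableT_comp mf (measurable_rV_affine _ _).
pose z' : 'rV[R]_n := (\row_j z ord0 (lift ord0 j))%R.
have E x v : (c *: rV_cons (x, v) + z = rV_cons (c * x + z ord0 ord0, c *: v + z'))%R.
  apply/rowP => i; rewrite [RHS]rV_consE [LHS]mxE [X in (X + _)%R]mxE rV_consE /=.
  by case: unliftP => [j ->|->] //=; rewrite !mxE.
under eq_integral.
  move=> x _.
  under eq_integral do rewrite E.
  rewrite (IH z' (fun v => f (rV_cons ((c * x + z ord0 ord0)%R, v)))); first last.
  - by move=> v; exact: f0.
  - exact: (measurableT_comp mfc (measurable_pair1 _)).
  over.
pose I (x : R) := \int[lebesgue_rV R n]_v f (rV_cons (x, v)).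
have mI : measurable_fun setT I.
  by apply: (measurable_fun_fubini_tonelli_F (f \o @rV_cons R n)) => // x; exact: f0.
have I0 x : 0 <= I x by apply: integral_ge0.
have cn0 : (0 <= c ^- n)%R by rewrite invr_ge0 exprn_ge0// ltW.
transitivity ((c ^- n)%:E * \int[mu]_x I (c * x + z ord0 ord0)%R).
  have mIa : measurable_fun [set: measurableTypeR R] (fun x : measurableTypeR R => I (c * x + z ord0 ord0)%R).
    exact: (measurableT_comp mI (measurable_affine1 _ _)).
  by rewrite (@ge0_integralZl_EFin _ _ R mu setT measurableT _ (fun x _ => I0 _) mIa _ cn0).
rewrite (ge0_integral_affine1 _ c0 mI I0) muleA -EFinM.
by congr (_%:E * _); rewrite exprSr invfM mulrC.
Qed.

End lebesgue_affine.

(** * Averaging over small translates *)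

Section smear.
Context {R : realType} {n : nat}.
Local Notation mu := (@lebesgue_measure R).
Local Notation leb := (lebesgue_rV R n).
Local Open Scope ereal_scope.

Lemma measurable_shift (E : 'rV[R]_n) :
  measurable_fun [set: 'rV[R]_n * measurableTypeR R]
    (fun p => p.1 + (p.2 : R) *: E)%R.
Proof.
apply: measurable_fun_coordP => i; under eq_fun do rewrite !mxE.
apply: measurable_funD.
  exact: (measurableT_comp (measurable_coord i)).
by apply: measurable_funM => //; exact: measurable_snd.
Qed.

Local Notation unit_itv := (`[(- 2^-1)%R, (2^-1)%R]%classic : set R).

Lemma mu_unit_itv : mu unit_itv = 1.
Proof.
rewrite lebesgue_measure_itv /= lte_fin ifT; last by lra.
by rewrite -EFinD; congr (_%:E); lra.
Qed.

Lemma measurable_smear (E : 'rV[R]_n) (f : 'rV[R]_n -> \bar R) :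
  measurable_fun setT f -> (forall x, 0 <= f x) ->
  measurable_fun setT (fun x : 'rV[R]_n => \int[mu]_(y in unit_itv) f (x + y *: E)%R).
Proof.
move=> mf f0.
under eq_fun do rewrite integral_mkcond.
pose g (p : 'rV[R]_n * measurableTypeR R) : \bar R :=
  ((fun p => f (p.1 + p.2 *: E)%R) \_ (setT `*` (unit_itv : set (measurableTypeR R)))) p.
have mg : measurable_fun setT g.
  apply/measurable_restrict => //; first exact: measurableX.
  rewrite setTI; apply: measurable_funTS.
  exact: measurableT_comp mf (measurable_shift _).
have g0 p : 0 <= g p by rewrite /g patchE; case: ifP => // _.
have /= := measurable_fun_fubini_tonelli_F (m2 := mu) g mg g0.
rewrite /fubini_F; congr (measurable_fun setT _).
apply/funext => x; apply: eq_integral => y _; rewrite /g !patchE /=.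
by congr (if _ then _ else _); rewrite in_setX in_setT.
Qed.

(** Tonelli and translation invariance: for each [y] the shifted integral is the original one, and
    the interval of shifts has length one. *)
Lemma smear_integral (E : 'rV[R]_n) (f : 'rV[R]_n -> \bar R) :
  measurable_fun setT f -> (forall x, 0 <= f x) ->
  \int[leb]_x f x = \int[leb]_x \int[mu]_(y in unit_itv) f (x + y *: E)%R.
Proof.
move=> mf f0.
pose g (p : 'rV[R]_n * measurableTypeR R) : \bar R :=
  ((fun p => f (p.1 + p.2 *: E)%R) \_ (setT `*` (unit_itv : set (measurableTypeR R)))) p.
have mg : measurable_fun setT g.
  apply/measurable_restrict => //; first exact: measurableX.
  rewrite setTI; apply: measurable_funTS.
  exact: measurableT_comp mf (measurable_shift _).
have g0 p : 0 <= g p by rewrite /g patchE; case: ifP => // _.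
have gE x y : g (x, y) = ((fun y => f (x + y *: E)%R) \_ unit_itv) y.
  rewrite /g !patchE /=.
  by congr (if _ then _ else _); rewrite in_setX in_setT.
transitivity (\int[leb]_x \int[mu]_y g (x, y)); last first.
  by apply: eq_integral => x _; rewrite [RHS]integral_mkcond; apply: eq_integral => y _.
rewrite (fubini_tonelli (m1 := leb) (m2 := mu) g mg g0).
transitivity (\int[mu]_(y in unit_itv) \int[leb]_x f x).
  transitivity (\int[leb]_x f x * mu unit_itv); last first.
    by apply/esym; apply: (integral_cst mu (measurable_itv `[(- 2^-1)%R, (2^-1)%R])).
  by rewrite mu_unit_itv mule1.
rewrite integral_mkcond; apply: eq_integral => y _.
rewrite patchE; case: ifPn => yI.
  have := ge0_integral_affine (c := 1) (y *: E)%R (f := f) ltr01 mf f0.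
  rewrite expr1n invr1 mul1e => <-; apply: eq_integral => x _.
  by rewrite gE patchE yI scale1r.
rewrite (_ : (fun x => _) = cst 0) ?integral_cst ?mul0e//.
by apply/funext => x; rewrite gE patchE (negbTE yI).
Qed.

(** Only the averages of [h] need to be bounded, not [h] itself. The restriction to [A] serves to
    localise the base point in [A']; it is then dropped, [h] being nonnegative, so that the
    remaining average runs over a full parallelogram and keeps the cancellation that a cut-off would
    destroy. *)
Lemma smear2_le (E1 E2 : 'rV[R]_n) (A A' : set 'rV[R]_n) (h : 'rV[R]_n -> \bar R)
    (C : R) : measurable A -> measurable A' ->
  measurable_fun setT h -> (forall x, 0 <= h x) -> (0 <= C)%R ->
  (forall x (y1 y2 : R), (`|y1| <= 2^-1)%R -> (`|y2| <= 2^-1)%R ->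
     A (x + y2 *: E2 + y1 *: E1)%R -> A' x) ->
  (forall x, A' x -> \int[mu]_(y2 in unit_itv) \int[mu]_(y1 in unit_itv)
     h (x + y2 *: E2 + y1 *: E1)%R <= C%:E) ->
  \int[leb]_(x in A) h x <= C%:E * leb A'.
Proof.
move=> mA mA' mh h0 C0 AA' hC.
have mhA : measurable_fun setT (h \_ A).
  by apply/measurable_restrict => //; rewrite setTI; exact: measurable_funTS.
have hA0 x : 0 <= (h \_ A) x by rewrite patchE; case: ifP.
rewrite integral_mkcond (smear_integral E1)//.
rewrite (smear_integral E2); last 2 first.
- exact: measurable_smear.
- by move=> x; exact: integral_ge0.
rewrite -(integral_cst leb mA') integral_mkcond.
have mL : measurable_fun setT (fun x : 'rV[R]_n => \int[mu]_(y2 in unit_itv) \int[mu]_(y1 in unit_itv)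
     (h \_ A) (x + y2 *: E2 + y1 *: E1)%R).
  apply: (@measurable_smear E2 (fun x : 'rV[R]_n => \int[mu]_(y1 in unit_itv) (h \_ A) (x + y1 *: E1)%R)).
    exact: measurable_smear.
  by move=> x; exact: integral_ge0.
apply: ge0_le_integral => //.
- by move=> x _; apply: integral_ge0 => y _; exact: integral_ge0.
- by apply/measurable_restrict => //; rewrite setTI; exact: measurable_cst.
move=> x _; rewrite [leRHS]patchE.
have [xA'|xA'] := boolP (x \in A').
  apply: le_trans (hC x (set_mem xA')).
  apply: ge0_le_integral => //.
  - by move=> y _; exact: integral_ge0.
  - apply: measurable_funTS.
    apply: (measurableT_comp (f := fun x : 'rV[R]_n => \int[mu]_(y1 in unit_itv) (h \_ A) (x + y1 *: E1)%R)).
      exact: measurable_smear.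
    exact: (measurableT_comp (measurable_shift E2) (measurable_pair1 x)).
  - apply: measurable_funTS.
    apply: (measurableT_comp (f := fun x : 'rV[R]_n => \int[mu]_(y1 in unit_itv) h (x + y1 *: E1)%R)).
      exact: measurable_smear.
    exact: (measurableT_comp (measurable_shift E2) (measurable_pair1 x)).
  move=> y2 _.
  apply: ge0_le_integral => //.
  - apply: measurable_funTS; apply: (measurableT_comp mhA).
    exact: (measurableT_comp (measurable_shift E1) (measurable_pair1 _)).
  - apply: measurable_funTS; apply: (measurableT_comp mh).
    exact: (measurableT_comp (measurable_shift E1) (measurable_pair1 _)).
  by move=> y1 _; rewrite patchE; case: ifP.
rewrite (eq_integral (cst 0)) ?integral_cst ?mul0e//.
move=> y2 /set_mem; rewrite /= in_itv /= -ler_norml => y2I.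
rewrite (eq_integral (cst 0)) ?integral_cst ?mul0e//.
move=> y1 /set_mem; rewrite /= in_itv /= -ler_norml => y1I.
rewrite patchE; case: ifPn => // /set_mem Ax.
by move: xA'; rewrite notin_setE => /(_ (AA' _ _ _ y1I y2I Ax)).
Qed.

End smear.

(** * Polar coordinates and the surface measure *)

Section polar.
Context {R : realType} {n : nat}.
Local Notation leb := (lebesgue_rV R n).
Local Open Scope ereal_scope.

Definition punctured_ball : set 'rV[R]_n := [set x | (0 < enorm x <= 1)%R].

Lemma measurable_enorm_itv (i : interval R) :
  measurable [set x : 'rV[R]_n | enorm x \in i].
Proof.
rewrite (_ : [set x | _] = enorm @^-1` [set` i])//.
by rewrite -[X in measurable X]setTI; apply: measurable_enorm.
Qed.

Lemma measurable_punctured_ball : measurable punctured_ball.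
Proof.
have := measurable_enorm_itv `]0%R, 1%R]; congr measurable.
Qed.

Definition dir (x : 'rV[R]_n) : 'rV[R]_n := ((enorm x)^-1 *: x)%R.

Lemma measurable_dir : measurable_fun setT dir.
Proof.
apply: measurable_fun_coordP => i; under eq_fun do rewrite mxE.
apply: measurable_funM; last exact: measurable_coord.
under eq_fun do rewrite -powR_inv1 ?sqrtr_ge0//.
exact: (measurableT_comp (measurable_powR (-1)) measurable_enorm).
Qed.

Lemma dotpZl (c : R) (u v : 'rV[R]_n) : dotp (c *: u) v = (c * dotp u v)%R.
Proof. by rewrite /dotp mulr_sumr; apply: eq_bigr => i _; rewrite mxE mulrA. Qed.

Lemma dotpC (u v : 'rV[R]_n) : dotp u v = dotp v u.
Proof. by apply: eq_bigr => i _; rewrite mulrC. Qed.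

Lemma dotpZr (c : R) (u v : 'rV[R]_n) : dotp u (c *: v) = (c * dotp u v)%R.
Proof. by rewrite dotpC dotpZl dotpC. Qed.

Lemma enormZ (c : R) (u : 'rV[R]_n) : enorm (c *: u) = (`|c| * enorm u)%R.
Proof.
by rewrite /enorm dotpZl dotpZr mulrA -expr2 sqrtrM ?sqr_ge0// sqrtr_sqr.
Qed.

Lemma enorm_ge0 (u : 'rV[R]_n) : (0 <= enorm u)%R.
Proof. exact: sqrtr_ge0. Qed.

Lemma enorm_dir (x : 'rV[R]_n) : (0 < enorm x)%R -> enorm (dir x) = 1%R.
Proof.
by move=> x0; rewrite enormZ ger0_norm ?invr_ge0 ?ltW// mulVf ?gt_eqF.
Qed.

Lemma dirZ (c : R) (x : 'rV[R]_n) : (0 < c)%R -> dir (c *: x) = dir x.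
Proof.
move=> c0; rewrite /dir enormZ gtr0_norm// scalerA invfM mulrAC mulVf ?mul1r//.
by rewrite gt_eqF.
Qed.

Lemma measurable_sphere : measurable (sphere : set 'rV[R]_n).
Proof.
have := measurable_enorm_itv `[1%R, 1%R]; congr measurable.
apply/seteqP; split => x; rewrite /sphere/= in_itv /=.
  by move=> h; apply/eqP; rewrite eq_le andbC.
by move=> ->; rewrite lexx.
Qed.

Lemma surface_measure_sphereC : surface_measure (~` (sphere : set 'rV[R]_n)) = 0.
Proof.
rewrite /surface_measure (_ : cone _ = set0) ?measure0 ?mule0//.
apply/seteqP; split => x //= -[/andP[x0 _]]; apply.
exact: enorm_dir.
Qed.

(** On the sphere the surface measure is [n] times the image under [dir] of Lebesgue measure on the
    punctured ball, and it gives no mass to the complement. *)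
Lemma ge0_integral_surface (f : 'rV[R]_n -> \bar R) :
  measurable_fun setT f -> (forall x, 0 <= f x) ->
  \int[surface_measure]_w f w =
  n%:R%:E * \int[leb]_(x in punctured_ball) f (dir x).
Proof.
move=> mf f0.
have mS := measurable_sphere.
have mB := measurable_punctured_ball.
rewrite (@ge0_negligible_integral _ _ _ _ setT (~` sphere))//; last 2 first.
- exact: measurableC.
- exact: surface_measure_sphereC.
rewrite setTD setCK.
(* [dir] is extended by 0 outside the punctured ball: as 0 is not on the sphere, the preimage of the
   sphere is exactly the punctured ball. *)
pose psi (x : 'rV[R]_n) := if x \in punctured_ball then dir x else 0%R.
have mpsi : measurable_fun setT psi.
  apply: measurable_fun_if => //; last exact: measurable_funTS measurable_dir.
  apply: (measurable_fun_bool true); rewrite setTI.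
  rewrite (_ : _ @^-1` _ = punctured_ball)//.
  by apply/seteqP; split => x /=; [move/set_mem|move/mem_set].
have psiS : psi @^-1` sphere = punctured_ball.
  apply/seteqP; split => x; rewrite /= /psi; case: ifPn => //.
  - by move=> /set_mem.
  - rewrite /sphere/= /enorm /dotp big1 ?sqrtr0; last by move=> i _; rewrite mxE mul0r.
    by move=> _ /esym/eqP; rewrite oner_eq0.
  - by move=> /set_mem/andP[x0 _] _; exact: enorm_dir.
  - by rewrite notin_setE.
have n0 : (0 <= n%:R :> R)%R by [].
have mf' := measurable_funS measurableT (@subsetT _ sphere) mf.
transitivity (\int[mscale (NngNum n0) (measure_function_pushforward__canonical__measure_function_Measure leb mpsi)]_(w in sphere) f w).
  apply: eq_measure_integral => A mA AS.
  rewrite /surface_measure /mscale /= /pushforward.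
  congr (_ * leb _); apply/seteqP; split => x /=; rewrite /psi.
    by move=> [xB Ax]; rewrite ifT// inE.
  case: ifPn => [/set_mem//|_ A0]; have := AS _ A0.
  rewrite /sphere/= /enorm /dotp big1 ?sqrtr0; last by move=> i _; rewrite mxE mul0r.
  by move=> /esym/eqP; rewrite oner_eq0.
rewrite ge0_integral_mscale//; congr (_ * _).
rewrite ge0_integral_pushforward// psiS.
by apply: eq_integral => x xB; rewrite /= /psi xB.
Qed.

Lemma leb_cube_fin m (K : R) :
  measurable [set x : 'rV[R]_m | forall i, (`|x ord0 i| <= K)%R] /\
  lebesgue_rV R m [set x | forall i, (`|x ord0 i| <= K)%R] < +oo.
Proof.
elim: m => [|m [mIH IH]].
  rewrite (_ : [set x | _] = setT); last by apply/seteqP; split => x //= _ [].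
  split; first exact: measurableT.
  by rewrite /= /dirac; exact: ltry.
have mC : measurable [set x : 'rV[R]_m.+1 | forall i, (`|x ord0 i| <= K)%R].
  rewrite (_ : [set x | _] = \bigcap_(i in [set: 'I_m.+1])
      ((fun x : 'rV[R]_m.+1 => x ord0 i) @^-1` `[(-K)%R, K])); last first.
    apply/seteqP; split => x /= h i; first by move=> _ /=; rewrite in_itv/= -ler_norml.
    by have := h i I; rewrite /= in_itv/= -ler_norml.
  apply: fin_bigcap_measurable => // i _.
  by rewrite -[X in measurable X]setTI; apply: measurable_coord.
split => //.
have E : @rV_cons R m @^-1` [set x : 'rV[R]_m.+1 | forall i, (`|x ord0 i| <= K)%R] =
    (`[(-K)%R, K] : set (measurableTypeR R)) `*`
      [set x : 'rV[R]_m | forall i, (`|x ord0 i| <= K)%R].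
  apply/seteqP; split => -[x v] /=.
    move=> h; split; first by have := h ord0; rewrite rV_consE unlift_none /= in_itv/= -ler_norml.
    by move=> i; have := h (lift ord0 i); rewrite rV_consE liftK.
  move=> [xK vK] i; rewrite rV_consE; case: unliftP => [j _|_] //=.
  by move: xK; rewrite in_itv/= -ler_norml.
have : (@lebesgue_measure R \x lebesgue_rV R m) (@rV_cons R m @^-1`
    [set x : 'rV[R]_m.+1 | forall i, (`|x ord0 i| <= K)%R]) < +oo.
  rewrite E product_measure1E//.
  have fK : @lebesgue_measure R `[(-K)%R, K] \is a fin_num.
    by rewrite lebesgue_measure_itv /=; case: ifP.
  by apply: lte_mul_pinfty => //; exact: fK.
exact.
Qed.

Lemma le_coord_enorm (x : 'rV[R]_n) i : (`|x ord0 i| <= enorm x)%R.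
Proof.
rewrite -sqrtr_sqr ler_wsqrtr// /dotp (bigD1 i)//= -expr2 lerDl.
by apply: sumr_ge0 => j _; rewrite -expr2 sqr_ge0.
Qed.

Lemma leb_bounded (A : set 'rV[R]_n) (K : R) : measurable A ->
  (forall x, A x -> (enorm x <= K)%R) -> leb A < +oo.
Proof.
move=> mA AK; have [mC CK] := leb_cube_fin n K.
apply: le_lt_trans CK; apply: le_measure; rewrite ?inE//.
by move=> x Ax /= i; exact: le_trans (le_coord_enorm _ _) (AK _ Ax).
Qed.

End polar.

Section dotp.
Context {R : realType} {n : nat}.
Implicit Types u v w : 'rV[R]_n.

Lemma dotpDl u v w : dotp (u + v) w = dotp u w + dotp v w.
Proof. by rewrite /dotp -big_split; apply: eq_bigr => i _; rewrite mxE mulrDl. Qed.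

Lemma dotpDr u v w : dotp w (u + v) = dotp w u + dotp w v.
Proof. by rewrite dotpC dotpDl !(dotpC w). Qed.

Lemma dotpBr u v w : dotp w (u - v) = dotp w u - dotp w v.
Proof. by rewrite -scaleN1r dotpDr dotpZr mulN1r. Qed.

Lemma dotpBl u v w : dotp (u - v) w = dotp u w - dotp v w.
Proof. by rewrite dotpC dotpBr !(dotpC w). Qed.

Lemma enorm_sqr u : enorm u ^+ 2 = dotp u u.
Proof. by rewrite sqr_sqrtr// dotp_ge0. Qed.

Lemma dotp_sqr_le u v : dotp u v ^+ 2 <= dotp u u * dotp v v.
Proof.
have uu := dotp_ge0 u; have vv := dotp_ge0 v.
have [v0|v0] := eqVneq (dotp v v) 0.
  have vi i : v ord0 i = 0.
    move/eqP: v0; rewrite /dotp psumr_eq0; last by move=> j _; rewrite -expr2 sqr_ge0.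
    by move/allP/(_ i (mem_index_enum i)); rewrite /= mulf_eq0 orbb => /eqP.
  by rewrite v0 mulr0 /dotp big1 ?expr0n// => i _; rewrite vi mulr0.
have := dotp_ge0 (dotp v v *: u - dotp u v *: v).
rewrite !(dotpBl, dotpBr, dotpZl, dotpZr) (dotpC v u).
have v1 : 0 < dotp v v by rewrite lt_def v0.
rewrite (_ : _ - _ = dotp v v * (dotp u u * dotp v v - dotp u v ^+ 2)); last by ring.
by rewrite pmulr_rge0// subr_ge0.
Qed.

Lemma dotp_le u v : `|dotp u v| <= enorm u * enorm v.
Proof.
rewrite -(ler_pXn2r (n := 2))// ?nnegrE ?mulr_ge0 ?sqrtr_ge0//.
by rewrite real_normK ?num_real// exprMn !enorm_sqr dotp_sqr_le.
Qed.

Lemma enormD u v : enorm (u + v) <= enorm u + enorm v.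
Proof.
rewrite -(ler_pXn2r (n := 2))// ?nnegrE ?addr_ge0 ?sqrtr_ge0//.
rewrite sqrrD !enorm_sqr !(dotpDl, dotpDr) (dotpC v u).
have := dotp_le u v; have := ler_norm (dotp u v); lra.
Qed.

Lemma enormN u : enorm (- u) = enorm u.
Proof. by rewrite -scaleN1r enormZ normrN1 mul1r. Qed.

Lemma enormB u v : enorm (u - v) <= enorm u + enorm v.
Proof. by rewrite -[enorm v]enormN enormD. Qed.

Lemma enormD_ge u v : enorm u - enorm v <= enorm (u + v).
Proof. by rewrite lerBlDr -{1}(addrK v u) enormB. Qed.

Lemma measurable_dotpl w : measurable_fun [set: 'rV[R]_n] (fun x => dotp x w).
Proof.
apply: measurable_sum => i; apply: measurable_funM => //.
exact: measurable_coord.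
Qed.

End dotp.

(** * Reduction to an annulus, and the measure of slabs *)

Section surface_bounds.
Context {R : realType} {n : nat}.
Local Notation leb := (lebesgue_rV R n).
Local Notation mu := (@lebesgue_measure R).
Local Open Scope ereal_scope.
Local Notation unit_itv := (`[(- 2^-1)%R, (2^-1)%R]%classic : set R).

Definition annulus : set 'rV[R]_n := [set x | (2^-1 < enorm x <= 1)%R].

Lemma measurable_annulus : measurable annulus.
Proof. exact: (measurable_enorm_itv `]2^-1%R, 1%R]). Qed.

(** The integrand has degree zero, so by scaling the half-size ball carries the share [2 ^- n], at
    most one half, of the integral over the whole ball; the annulus carries the rest. The bound [K]
    makes the integral finite, so that this share can be subtracted. On the annulus [enorm] stays
    away from 0, as is needed to move points before normalising them. *)
Lemma surface_le_annulus (f : 'rV[R]_n -> \bar R) (K : R) : (0 < n)%N ->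
  measurable_fun setT f -> (forall x, 0 <= f x) ->
  (forall x, enorm x = 1%R -> f x <= K%:E) ->
  \int[surface_measure]_w f w <=
  (2 * n%:R)%R%:E * \int[leb]_(x in annulus) f (dir x).
Proof.
move=> n0 mf f0 fK.
rewrite ge0_integral_surface//.
have mB := @measurable_punctured_ball R n.
have mA := measurable_annulus.
pose HB : set 'rV[R]_n := [set x | (0 < enorm x <= 2^-1)%R].
have mHB : measurable HB := measurable_enorm_itv `]0%R, 2^-1%R].
pose g x := f (dir x).
have mg : measurable_fun setT g by exact: measurableT_comp mf measurable_dir.
have g0 x : 0 <= g x by exact: f0.
have BE : punctured_ball = HB `|` annulus.
  apply/seteqP; split => x; rewrite /punctured_ball /HB /annulus/=.
    by move=> /andP[x0 x1]; case: (lerP (enorm x) 2^-1) => h; [left; rewrite x0|right].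
  by case=> /andP[h1 h2]; apply/andP; split; lra.
have dj : [disjoint HB & annulus].
  apply/disj_setPS => x [/andP[_ h1] /andP[h2 _]].
  by move: (lt_le_trans h2 h1); rewrite ltxx.
have IE : \int[leb]_(x in punctured_ball) g x =
    \int[leb]_(x in HB) g x + \int[leb]_(x in annulus) g x.
  by rewrite BE ge0_integral_setU//; exact: measurable_funTS.
have HE : \int[leb]_(x in HB) g x = (2 ^- n)%:E * \int[leb]_(x in punctured_ball) g x.
  rewrite integral_mkcond [X in _ * X]integral_mkcond.
  have mgB : measurable_fun setT (g \_ punctured_ball).
    by apply/measurable_restrict => //; rewrite setTI; exact: measurable_funTS.
  have gB0 x : 0 <= (g \_ punctured_ball) x by rewrite patchE; case: ifP.
  rewrite -(ge0_integral_affine 0%R _ mgB gB0)//.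
  apply: eq_integral => x _; rewrite addr0 !patchE.
  have -> : (2%:R *: x \in punctured_ball) = (x \in HB)%R.
    have xE : (enorm (2 *: x) = 2 * enorm x)%R by rewrite enormZ ger0_norm.
    by apply/idP/idP => /set_mem; rewrite /punctured_ball /HB /= ?xE => /andP[h1 h2];
      apply/mem_set => /=; rewrite ?xE; apply/andP; split; lra.
  by case: ifP => // _; rewrite /g dirZ.
have Ifin : \int[leb]_(x in punctured_ball) g x < +oo.
  apply: (@le_lt_trans _ _ (\int[leb]_(x in punctured_ball) (cst (`|K|%:E)) x)).
    apply: ge0_le_integral => //.
    - exact: measurable_funTS.
    - by move=> x /andP[x0 _]; apply: le_trans (fK _ (enorm_dir x0)) _; rewrite lee_fin ler_norm.
  rewrite integral_cst//; apply: lte_mul_pinfty => //.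
  by apply: (leb_bounded (K := 1%R)) => // x /andP[].
have I0 : 0 <= \int[leb]_(x in punctured_ball) g x by exact: integral_ge0.
have A0 : 0 <= \int[leb]_(x in annulus) g x by exact: integral_ge0.
move: IE Ifin I0 A0; rewrite HE -/g.
case: (\int[leb]_(x in punctured_ball) g x) => [i||]//=.
case: (\int[leb]_(x in annulus) g x) => [a||]//=.
rewrite -EFinM -EFinD => -[E _]; rewrite !lee_fin => i0 a0.
rewrite -mulrA mulrCA ler_wpM2l//.
have : (2 ^- n * i <= 2^-1 * i)%R.
  rewrite ler_wpM2r// lef_pV2 ?posrE ?exprn_gt0//.
  by rewrite -{1}(expr1 2%:R)%R ler_eXn2l// ltr1n.
lra.
Qed.

Lemma leb_itv_center (c e : R) : (0 <= e)%R ->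
  mu `[(c - e)%R, (c + e)%R] = (2 * e)%:E.
Proof.
move=> e0; rewrite lebesgue_measure_itv /= lte_fin.
case: ltrP => h; first by rewrite -EFinD; congr (_%:E); ring.
by congr (_%:E); lra.
Qed.

(** [U] and [W] are dual to [u] and [w]: a shift along [U] changes only [dotp _ u], at unit speed,
    and likewise for [W] and [w]. The smeared indicator therefore factors into two intervals of
    lengths [2 * e1] and [2 * e2]. The constant depends on [D] and the dimension alone, which makes
    the bound uniform over pairs [u], [w]. *)
Lemma surface_slab_le (D : R) : (0 <= D)%R -> exists2 C : R, (0 <= C)%R &
  forall (u w U W : 'rV[R]_n) (e1 e2 : R),
  dotp U u = 1%R -> dotp U w = 0%R -> dotp W u = 0%R -> dotp W w = 1%R ->
  (enorm U <= D)%R -> (enorm W <= D)%R -> (0 <= e1)%R -> (0 <= e2)%R ->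
  surface_measure [set x | (`|dotp x u| <= e1)%R /\ (`|dotp x w| <= e2)%R]
    <= (C * (e1 * e2))%:E.
Proof.
move=> D0.
(* The unit ball enlarged by two shifts of length at most [D / 2]. *)
pose A' : set 'rV[R]_n := [set x | (enorm x <= 1 + D)%R].
have mA' : measurable A' by exact: (measurable_enorm_itv `]-oo, (1 + D)%R]).
have fA' : leb A' \is a fin_num.
  by rewrite ge0_fin_numE//; apply: (leb_bounded (K := (1 + D)%R)).
exists (4 * n%:R * fine (leb A'))%R; first by rewrite mulr_ge0// fine_ge0.
move=> u w U W e1 e2 Uu Uw Wu Ww UD WD e10 e20.
pose B1 : set 'rV[R]_n := [set x | (`|dotp x u| <= e1)%R].
pose B2 : set 'rV[R]_n := [set x | (`|dotp x w| <= e2)%R].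
have mB1 : measurable B1.
  rewrite (_ : B1 = (fun x => dotp x u) @^-1` `[(- e1)%R, e1]).
    by rewrite -[X in measurable X]setTI; apply: measurable_dotpl.
  by apply/seteqP; split => x; rewrite /B1 /= in_itv/= -ler_norml.
have mB2 : measurable B2.
  rewrite (_ : B2 = (fun x => dotp x w) @^-1` `[(- e2)%R, e2]).
    by rewrite -[X in measurable X]setTI; apply: measurable_dotpl.
  by apply/seteqP; split => x; rewrite /B2 /= in_itv/= -ler_norml.
have mB := @measurable_punctured_ball R n.
pose A := punctured_ball `&` (B1 `&` B2).
have mA : measurable A by apply: measurableI => //; exact: measurableI.
have mcone : measurable (cone [set x | (`|dotp x u| <= e1)%R /\ (`|dotp x w| <= e2)%R]).
  rewrite (_ : cone _ = punctured_ball `&` (dir @^-1` (B1 `&` B2)))//.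
  apply: measurableI => //; rewrite -[X in measurable X]setTI.
  by apply: measurable_dir => //; exact: measurableI.
apply: (@le_trans _ _ (n%:R%:E * leb A)).
  apply: lee_wpmul2l => //; apply: le_measure; rewrite ?inE//.
  move=> x [/andP[x0 x1] [h1 h2]]; split; first by apply/andP.
  have key (v : 'rV[R]_n) e : (0 <= e -> `|dotp ((enorm x)^-1 *: x) v| <= e -> `|dotp x v| <= e)%R.
    move=> e0; rewrite dotpZl normrM normfV (ger0_norm (enorm_ge0 _)) mulrC ler_pdivrMr//.
    by move=> /le_trans; apply; rewrite ler_piMr.
  by split; apply: key.
have : \int[leb]_(x in A) (\1_(B1 `&` B2) x)%:E <= (4 * (e1 * e2))%:E * leb A'.
  have sq : `|2^-1 : R|%R = 2^-1%R by rewrite ger0_norm.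
  apply: (@smear2_le R n U W A A') => //.
  - by apply/measurable_EFinP; apply: measurable_indic; exact: measurableI.
  - by rewrite !mulr_ge0.
  - move=> x y1 y2 hy1 hy2 [/andP[_ h] _]; rewrite /A' /=.
    have -> : x = (x + y2 *: W + y1 *: U - (y2 *: W + y1 *: U))%R by rewrite -(addrA x) addrK.
    apply: (le_trans (enormB _ _)); apply: lerD => //.
    apply: (le_trans (enormD _ _)); rewrite !enormZ.
    have : (`|y2| * enorm W <= 2^-1 * D)%R by apply: ler_pM => //; exact: enorm_ge0.
    have : (`|y1| * enorm U <= 2^-1 * D)%R by apply: ler_pM => //; exact: enorm_ge0.
    lra.
  move=> x _.
  pose I1 : set R := `[(- dotp x u - e1)%R, (- dotp x u + e1)%R]%classic.
  pose I2 : set R := `[(- dotp x w - e2)%R, (- dotp x w + e2)%R]%classic.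
  have E (y1 y2 : R) : (\1_(B1 `&` B2) (x + y2 *: W + y1 *: U) = \1_I1 y1 * \1_I2 y2 :> R)%R.
    rewrite !indicE -natrM mulnb; congr ((nat_of_bool _)%:R).
    have e1E : (dotp (x + y2 *: W + y1 *: U) u = dotp x u + y1)%R.
      by rewrite !dotpDl !dotpZl Wu Uu mulr0 mulr1 addr0.
    have e2E : (dotp (x + y2 *: W + y1 *: U) w = dotp x w + y2)%R.
      by rewrite !dotpDl !dotpZl Ww Uw mulr0 mulr1 addr0.
    apply/idP/andP => [/set_mem[]|[/set_mem h1 /set_mem h2]].
      rewrite /B1 /B2 /= e1E e2E !ler_norml => h1 h2.
      by split; apply/mem_set; rewrite /I1 /I2 /= in_itv /=; lra.
    apply/mem_set; split; rewrite /B1 /B2 /= ?e1E ?e2E !ler_norml.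
      by move: h1; rewrite /I1 /= in_itv /=; lra.
    by move: h2; rewrite /I2 /= in_itv /=; lra.
  have mI1 : measurable (I1 : set (measurableTypeR R)) by exact: measurable_itv.
  have mI2 : measurable (I2 : set (measurableTypeR R)) by exact: measurable_itv.
  have int1 (I : set R) (c : R) : measurable (I : set (measurableTypeR R)) -> (0 <= c)%R ->
     \int[mu]_(y in unit_itv) (\1_I y * c)%:E <= c%:E * mu I.
    move=> mI c0.
    under eq_integral do rewrite mulrC EFinM.
    rewrite ge0_integralZl_EFin//; last first.
      by apply/measurable_EFinP; exact: measurable_indic.
    apply: lee_wpmul2l => //; rewrite integral_indic//.
    by apply: le_measure; rewrite ?inE//; exact: measurableI.
  apply: (@le_trans _ _ (\int[mu]_(y2 in unit_itv) (\1_I2 y2 * (2 * e1))%:E)).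
    apply: ge0_le_integral => //.
    - by move=> y _; apply: integral_ge0.
    - apply: (eq_measurable_fun (fun y2 => (\1_I2 y2)%:E * \int[mu]_(y1 in unit_itv) (\1_I1 y1)%:E)).
        move=> y2 _; rewrite -ge0_integralZl_EFin//.
          by apply: eq_integral => y1 _; rewrite E EFinM muleC.
        by apply/measurable_EFinP; exact: measurable_indic.
      apply: emeasurable_funM => //.
      by apply/measurable_EFinP; exact: measurable_indic.
    - by apply/measurable_EFinP; apply: measurable_funM => //; exact: measurable_indic.
    move=> y2 _.
    under eq_integral do rewrite E.
    apply: le_trans (int1 I1 _ mI1 _) _ => //.
    by rewrite /I1 leb_itv_center// EFinM.
  apply: le_trans (int1 I2 _ mI2 _) _; first by rewrite mulr_ge0.
  by rewrite /I2 leb_itv_center// -EFinM lee_fin; lra.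
rewrite integral_indic//; last exact: measurableI.
rewrite setIidr; last by move=> x [].
move=> h; apply: le_trans (lee_wpmul2l _ h) _ => //.
rewrite -(fineK fA') -!EFinM lee_fin; lra.
Qed.

End surface_bounds.

(** * One-dimensional calculus and oscillatory integrals *)

Section derive_pointwise.
Context {R : realType}.
Implicit Types (f g : R -> R) (x a b : R).

Lemma isder_add f g x a b : is_derive x 1 f a -> is_derive x 1 g b ->
  is_derive x 1 (fun y => f y + g y) (a + b).
Proof. by move=> ? ?; apply: is_deriveD. Qed.

Lemma isder_sub f g x a b : is_derive x 1 f a -> is_derive x 1 g b ->
  is_derive x 1 (fun y => f y - g y) (a - b).
Proof. by move=> ? ?; apply: is_deriveB. Qed.

Lemma isder_mul f g x a b : is_derive x 1 f a -> is_derive x 1 g b ->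
  is_derive x 1 (fun y => f y * g y) (a * g x + f x * b).
Proof.
move=> df dg; apply: (@is_derive_eq _ _ _ (f \* g) _ _ _ _ (is_deriveM df dg)).
by rewrite /GRing.scale /=; ring.
Qed.

Lemma isder_cst x c : is_derive x 1 (fun _ : R => c) (0 : R).
Proof. exact: is_derive_cst. Qed.

Lemma isder_id x : is_derive x 1 (fun y : R => y) (1 : R).
Proof. exact: is_derive_id. Qed.

Lemma isder_comp f g x a b : is_derive (g x) 1 f a -> is_derive x 1 g b ->
  is_derive x 1 (fun y => f (g y)) (a * b).
Proof.
move=> df dg; have := @is_derive1_comp _ f g x a b df dg.
exact.
Qed.

Lemma isder_cont f x a : is_derive x 1 f a -> {for x, continuous f}.
Proof.
move=> df; apply: differentiable_continuous.
by apply/derivable1_diffP; exact: ex_derive.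
Qed.

Lemma isder_inv f x a : is_derive x 1 f a -> f x != 0 ->
  is_derive x 1 (fun y => (f y)^-1) (- a * (f x)^-1 * (f x)^-1).
Proof.
move=> df f0; apply: is_derive_eq (is_deriveV f0 df) _.
by rewrite /GRing.scale /= expr2 invfM; ring.
Qed.

Lemma isder_isqrt f x a : is_derive x 1 f a -> 0 < f x ->
  is_derive x 1 (fun y => (Num.sqrt (f y))^-1)
    (- 2^-1 * a * ((Num.sqrt (f x))^-1 * (Num.sqrt (f x))^-1 * (Num.sqrt (f x))^-1)).
Proof.
move=> df f0; have ds := is_derive1_sqrt f0.
have d1 := isder_comp ds df.
apply: is_derive_eq.
  by apply: (isder_inv d1); rewrite gt_eqF// sqrtr_gt0.
by rewrite invfM; field; rewrite gt_eqF// sqrtr_gt0.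
Qed.

Lemma isder_pow f x a n : is_derive x 1 f a ->
  is_derive x 1 (fun y => f y ^+ n.+1) (n.+1%:R * f x ^+ n * a).
Proof.
move=> df; elim: n => [|n IH].
  apply: is_derive_eq (_ : is_derive x 1 (fun y => f y ^+ 1) a) _.
  by rewrite expr0 !mul1r.
rewrite (_ : (fun y => _) = (fun y => f y * f y ^+ n.+1)); last first.
  by apply/funext => y; rewrite exprS.
apply: is_derive_eq (isder_mul df IH) _.
by rewrite [in RHS]mulrSr exprS; ring.
Qed.

End derive_pointwise.

(** * Integrals of continuous functions on compact intervals *)

Section itv_integral.
Context {R : realType}.
Implicit Types (f g F : R -> R) (a b : R).
Local Notation mu := (@lebesgue_measure R).
Local Notation int a b f := (\int[mu]_(x in `[a, b]) f x)%R.

Definition cont_on a b f := {within `[a, b], continuous f}.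

Lemma cont_on_for a b f : (forall x, a <= x <= b -> {for x, continuous f}) ->
  cont_on a b f.
Proof.
by move=> h; apply: continuous_in_subspaceT => x /set_mem; rewrite /= in_itv/=; exact: h.
Qed.

Lemma cont_onS a b c d f : a <= c -> d <= b -> cont_on a b f -> cont_on c d f.
Proof.
move=> ac db; apply: continuous_subspaceW.
by apply: subset_itv; rewrite bnd_simp.
Qed.

Lemma cont_integrable a b f : cont_on a b f -> mu.-integrable `[a, b] (EFin \o f).
Proof. by move=> cf; apply: continuous_compact_integrable => //; exact: segment_compact. Qed.

Lemma cont_onM a b f g : cont_on a b f -> cont_on a b g ->
  cont_on a b (fun x => f x * g x).
Proof. by move=> cf cg x; apply: cvgM; [exact: cf|exact: cg]. Qed.

Lemma cont_onD a b f g : cont_on a b f -> cont_on a b g ->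
  cont_on a b (fun x => f x + g x).
Proof. by move=> cf cg x; apply: cvgD; [exact: cf|exact: cg]. Qed.

Lemma cont_on_cst a b (c : R) : cont_on a b (fun=> c).
Proof. by move=> x; exact: cvg_cst. Qed.

Lemma cont_on_comp a b f (h : R -> R) : continuous h -> cont_on a b f ->
  cont_on a b (fun x => h (f x)).
Proof.
move=> ch cf x; apply: (@continuous_comp (subspace `[a, b]) R R f h x); first exact: cf.
exact: ch.
Qed.

Lemma int_deriv a b F f : a <= b -> cont_on a b F -> cont_on a b f ->
  (forall x, a < x < b -> is_derive x 1 F (f x)) ->
  int a b f = F b - F a.
Proof.
rewrite le_eqVlt => /predU1P[->|ab] cF cf dF.
  by rewrite set_itv1 Rintegral_set1 subrr.
have /(continuous_within_itvP _ ab)[_ cFa cFb] := cF.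
rewrite /Rintegral (@continuous_FTC2 _ f F a b)//.
- split => //; move=> x; rewrite in_itv/= => /dF xab; exact: ex_derive.
- by move=> x; rewrite in_itv/= => /dF xab; rewrite derive1E derive_val.
Qed.

Lemma int_abs_le a b f (K : R) : a <= b -> cont_on a b f ->
  (forall x, a <= x <= b -> `|f x| <= K) -> `|int a b f| <= K * (b - a).
Proof.
move=> ab cf fK.
have If := cont_integrable cf.
apply: le_trans (le_normr_Rintegral _ If) _ => //.
have muE : mu `[a, b] = (b - a)%:E.
  by have := lebesgue_measure_itv `[a, b] => /= ->; rewrite lte_fin -EFinD;
    case: ltgtP ab => // -> _; rewrite subrr.
rewrite -(_ : int a b (cst K) = K * (b - a)); last by rewrite Rintegral_cst//= muE.
apply: le_Rintegral => //.
- by apply: (cont_integrable (f := fun x => `|f x|)); apply: cont_on_comp => //; exact: norm_continuous.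
- by apply: cont_integrable; exact: cont_on_cst.
Qed.

Lemma int_split a c b f : a <= c -> c <= b -> cont_on a b f ->
  int a b f = int a c f + int c b f.
Proof.
move=> ac cb cf.
have := @Rintegral_itvB R f (BLeft a) (BRight b) c (cont_integrable cf).
rewrite !bnd_simp => /(_ ac cb) /eqP; rewrite subr_eq => /eqP ->.
rewrite Rintegral_itv_obnd_cbnd 1?addrC//.
apply: integrableS (cont_integrable (cont_onS ac (lexx b) cf)) => //.
by apply: subset_itv; rewrite bnd_simp.
Qed.

Lemma intD a b f g : cont_on a b f -> cont_on a b g ->
  int a b (fun x => f x + g x) = int a b f + int a b g.
Proof. by move=> cf cg; apply: RintegralD => //; exact: cont_integrable. Qed.

Lemma intZ a b f (c : R) : cont_on a b f -> int a b (fun x => c * f x) = c * int a b f.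
Proof. by move=> cf; apply: RintegralZl => //; exact: cont_integrable. Qed.

End itv_integral.

(** * Uniform bounds on finitely many derivatives *)

Section bounded_derivatives.
Context {R : realType}.
Implicit Types (f g : R -> R) (C : R) (k : nat).

(** Derivatives enter through witnesses, so that closed formulas can be supplied for them, and
    through one explicit constant, so that the lemmas below can fix the new constant before the
    function: the phases that occur form a family depending on the base point and the frequency. *)
Fixpoint bdd_der k C f : Prop :=
  (forall x : R, -1 <= x <= 1 -> `|f x| <= C) /\
  if k is k'.+1 then exists2 f' : R -> R,
    (forall x : R, -1 <= x <= 1 -> is_derive x 1 f (f' x)) & bdd_der k' C f'
  else forall x : R, -1 <= x <= 1 -> {for x, continuous f}.

Lemma bdd_der_le k C f : bdd_der k C f -> forall x : R, -1 <= x <= 1 -> `|f x| <= C.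
Proof. by case: k => [|k] []. Qed.

Lemma bdd_der_cont k C f : bdd_der k C f ->
  forall x : R, -1 <= x <= 1 -> {for x, continuous f}.
Proof. by case: k => [|k] [_] // [f' df _ x /df]; exact: isder_cont. Qed.

Lemma bdd_der_cont_on k C f : bdd_der k C f -> cont_on (-1) 1 f.
Proof. by move=> h; apply: cont_on_for; exact: bdd_der_cont h. Qed.

Lemma bdd_der_ge0 k C f : bdd_der k C f -> 0 <= C.
Proof.
move=> /bdd_der_le/(_ 0) h; apply: le_trans (h _); first exact: normr_ge0.
by rewrite lerN10 ler01.
Qed.

Lemma bdd_der_mono k C C' f : C <= C' -> bdd_der k C f -> bdd_der k C' f.
Proof.
move=> CC'; elim: k f => [|k IH] f [fC h]; split => //; try by move=> x /fC/le_trans; exact.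
by case: h => f' df hf'; exists f' => //; exact: IH.
Qed.

Lemma bdd_derW k C f : bdd_der k.+1 C f -> bdd_der k C f.
Proof.
elim: k f => [|k IH] f [fC [f' df hf']].
  by split => // x /df; exact: isder_cont.
by split => //; exists f' => //; exact: IH.
Qed.

Lemma bdd_der_cst k C (c : R) : `|c| <= C -> bdd_der k C (fun=> c).
Proof.
elim: k c => [|k IH] c cC; split => //.
  by move=> x _; exact: cst_continuous.
exists (fun=> 0); first by move=> x _; exact: isder_cst.
by apply: IH; rewrite normr0; apply: le_trans cC.
Qed.

Lemma bdd_der_add k C C' f g : bdd_der k C f -> bdd_der k C' g ->
  bdd_der k (C + C') (fun x => f x + g x).
Proof.
elim: k f g => [|k IH] f g [fC hf] [gC hg]; split.
- by move=> x xI; apply: (le_trans (ler_normD _ _)); rewrite lerD ?fC ?gC.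
- by move=> x xI; apply: continuousD; [exact: hf|exact: hg].
- by move=> x xI; apply: (le_trans (ler_normD _ _)); rewrite lerD ?fC ?gC.
case: hf hg => f' df hf' [g' dg hg'].
exists (fun x => f' x + g' x); last exact: IH.
by move=> x xI; exact: (isder_add (df x xI) (dg x xI)).
Qed.

(** The factor [2 ^+ k] counts Leibniz terms, doubled by each differentiation. *)
Lemma bdd_der_mul k C C' f g : bdd_der k C f -> bdd_der k C' g ->
  bdd_der k (2 ^+ k * (C * C')) (fun x => f x * g x).
Proof.
elim: k f g => [|k IH] f g hf hg; have C0 := bdd_der_ge0 hf; have C'0 := bdd_der_ge0 hg;
  have fC := bdd_der_le hf; have gC := bdd_der_le hg;
  have fgC (x : R) : -1 <= x <= 1 -> `|f x * g x| <= C * C' by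
    (move=> xI; rewrite normrM ler_pM ?fC ?gC).
  split; first by rewrite expr0 mul1r.
  by move=> x xI; apply: continuousM; [exact: (bdd_der_cont hf)|exact: (bdd_der_cont hg)].
split.
  move=> x /fgC/le_trans; apply; rewrite ler_peMl ?mulr_ge0//.
  by rewrite exprn_ege1// ler1n.
have hfW := bdd_derW hf; have hgW := bdd_derW hg.
case: hf hg => _ [f' df hf'] [_ [g' dg hg']].
exists (fun x => f' x * g x + f x * g' x).
  by move=> x xI; exact: (isder_mul (df x xI) (dg x xI)).
have := bdd_der_add (IH _ _ hf' hgW) (IH _ _ hfW hg').
by apply: bdd_der_mono; rewrite exprS; lra.
Qed.

Lemma bdd_der_scale k C (c : R) f : bdd_der k C f -> bdd_der k (`|c| * C) (fun x => c * f x).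
Proof.
elim: k f => [|k IH] f [fC hf]; split.
- by move=> x xI; rewrite normrM ler_wpM2l ?fC.
- by move=> x xI; apply: continuousM; [exact: cst_continuous|exact: hf].
- by move=> x xI; rewrite normrM ler_wpM2l ?fC.
case: hf => f' df hf'; exists (fun x => c * f' x); last exact: IH.
move=> x xI; apply: is_derive_eq (isder_mul (isder_cst x c) (df x xI)) _.
by rewrite mul0r add0r.
Qed.

Lemma bdd_der_id k : bdd_der k 1 (fun x : R => x).
Proof.
have h (x : R) : -1 <= x <= 1 -> `|x : R| <= 1 by rewrite ler_norml.
case: k => [|k]; split => //; first by move=> x _; exact: (isder_cont (isder_id x)).
exists (fun=> 1); first by move=> x _; exact: isder_id.
by apply: bdd_der_cst; rewrite normr1.
Qed.

Lemma bdd_der_inv k C c : 0 < c -> exists C', forall p,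
  bdd_der k C p -> (forall x : R, -1 <= x <= 1 -> c <= `|p x|) ->
  bdd_der k C' (fun x => (p x)^-1).
Proof.
move=> c0.
have pV (p : R -> R) (x : R) : c <= `|p x| -> `|(p x)^-1| <= c^-1.
  by move=> h; rewrite normfV lef_pV2 ?posrE// (lt_le_trans c0).
have pn0 (p : R -> R) (x : R) : c <= `|p x| -> p x != 0 :> R.
  by move=> h; rewrite -normr_gt0 (lt_le_trans c0).
elim: k => [|k [C' IH]].
  exists c^-1 => p hp pc; split; first by move=> x /pc/pV.
  move=> x xI; apply: continuousV; first by apply: pn0; exact: pc.
  exact: (bdd_der_cont hp).
pose C1 := `|-1| * (2 ^+ k * ((2 ^+ k * (C * C')) * C')).
exists (Num.max c^-1 C1) => p hp pc; split.
  by move=> x xI; rewrite le_max pV ?pc.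
have hq := IH _ (bdd_derW hp) pc.
case: hp => _ [p' dp hp'].
exists (fun x => -1 * (p' x * (p x)^-1 * (p x)^-1)).
  move=> x xI; apply: is_derive_eq (isder_inv (dp x xI) (pn0 p _ (pc x xI))) _.
  by ring.
apply: (@bdd_der_mono _ C1); first by rewrite le_max lexx orbT.
by apply: bdd_der_scale; apply: bdd_der_mul => //; exact: bdd_der_mul.
Qed.

Lemma bdd_der_isqrt k C c : 0 < c -> exists C', forall p,
  bdd_der k C p -> (forall x : R, -1 <= x <= 1 -> c <= p x) ->
  bdd_der k C' (fun x => (Num.sqrt (p x))^-1).
Proof.
move=> c0.
have s0 : 0 < Num.sqrt c by rewrite sqrtr_gt0.
have sp (p : R -> R) (x : R) : c <= p x -> Num.sqrt c <= Num.sqrt (p x) by exact: ler_wsqrtr.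
have pV (p : R -> R) (x : R) : c <= p x -> `|(Num.sqrt (p x))^-1| <= (Num.sqrt c)^-1.
  move=> h; rewrite ger0_norm ?invr_ge0 ?sqrtr_ge0//.
  by rewrite lef_pV2 ?posrE ?sp// (lt_le_trans s0) ?sp.
elim: k => [|k [C' IH]].
  exists (Num.sqrt c)^-1 => p hp pc; split; first by move=> x /pc/pV.
  move=> x xI; apply: (@continuousV _ _ (fun x => Num.sqrt (p x))).
    by rewrite gt_eqF// (lt_le_trans s0)// sp// pc.
  apply: (@continuous_comp _ _ _ p Num.sqrt); first exact: (bdd_der_cont hp).
  exact: sqrt_continuous.
pose C1 := `|-2^-1| * (2 ^+ k * (C * (2 ^+ k * (2 ^+ k * (C' * C') * C')))).
exists (Num.max (Num.sqrt c)^-1 C1) => p hp pc; split.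
  by move=> x xI; rewrite le_max pV ?pc.
have hq := IH _ (bdd_derW hp) pc.
case: hp => _ [p' dp hp'].
exists (fun x => -2^-1 * (p' x * ((Num.sqrt (p x))^-1 * (Num.sqrt (p x))^-1 * (Num.sqrt (p x))^-1))).
  move=> x xI; apply: is_derive_eq (isder_isqrt (dp x xI) (lt_le_trans c0 (pc x xI))) _.
  by ring.
apply: (@bdd_der_mono _ C1); first by rewrite le_max lexx orbT.
apply: bdd_der_scale; apply: bdd_der_mul => //.
by apply: bdd_der_mul => //; exact: bdd_der_mul.
Qed.

End bounded_derivatives.

(** * Repeated integration by parts *)

Section oscillatory.
Context {R : realType}.
Local Notation mu := (@lebesgue_measure R).
Local Notation int f := (\int[mu]_(y in `[(-1)%R, 1%R]) f y)%R.

Lemma cosBpi2 (x : R) : cos (x - pi / 2) = sin x.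
Proof. by rewrite cosB cos_pihalf sin_pihalf mulr0 mulr1 add0r. Qed.

(** Each integration by parts against [q = 1 / p] gains a factor [lam^-1] and uses up one order of
    vanishing of [(1 - y ^+ 2) ^+ j] at the endpoints, so no boundary term appears. The free phase
    [al] lets the sine produced by a step be read as a cosine shifted by [pi / 2], so that one
    statement serves the induction. *)
Lemma oscillatory_int_le j (B : R) : 0 <= B -> exists2 C, 0 <= C &
  forall (lam al : R) (Psi p q g : R -> R), 0 < lam ->
  (forall x : R, -1 <= x <= 1 -> is_derive x 1 Psi (p x)) ->
  (forall x : R, -1 <= x <= 1 -> {for x, continuous p}) ->
  (forall x : R, -1 <= x <= 1 -> q x * p x = 1) ->
  bdd_der j B q -> bdd_der j B g ->
  `|int (fun y => (1 - y ^+ 2) ^+ j * g y * cos (lam * Psi y + al))| <= C / lam ^+ j.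
Proof.
have I11 : (-1 : R) <= 1 by lra.
have cPsi (lam al : R) Psi p : (forall x : R, -1 <= x <= 1 -> is_derive x 1 Psi (p x)) ->
   cont_on (-1) 1 (fun y => lam * Psi y + al).
  move=> dPsi; apply: cont_onD; last exact: cont_on_cst.
  apply: cont_onM; first exact: cont_on_cst.
  by apply: cont_on_for => x /dPsi; exact: isder_cont.
elim: j B => [|j IH] B B0.
  exists (B * 2); first by lra.
  move=> lam al Psi p q g lam0 dPsi _ _ _ hg.
  rewrite expr0 divr1.
  have -> : 2 = (1 - -1) :> R by lra.
  apply: int_abs_le => //.
    apply: cont_onM; last by apply: cont_on_comp (cPsi _ _ _ _ dPsi); exact: continuous_cos.
    apply: cont_onM; last exact: bdd_der_cont_on hg.
    exact: cont_on_cst.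
  move=> x xI; rewrite mul1r normrM -[B]mulr1 ler_pM ?(bdd_der_le hg)//.
  by rewrite ler_norml cos_geN1 cos_le1.
(* [B1] bounds [g * q]; [B2] bounds the amplitude [gt] left after one integration by parts. *)
pose B1 := 2 ^+ j.+1 * (B * B).
pose c1 : R := - (2 * j.+1%:R).
pose B2 := `|c1| * (2 ^+ j * (1 * B1)) +
  2 ^+ j * ((1 + `|-1| * (2 ^+ j * (1 * 1))) * B1).
have Bm : B <= Num.max B B2 by rewrite le_max lexx.
have [C C0 hC] := IH (Num.max B B2) (le_trans B0 Bm).
exists C => // lam al Psi p q g lam0 dPsi cp qp hq hg.
have hgq := bdd_der_mul hg hq; rewrite -/B1 in hgq.
have hgqW := bdd_derW hgq.
have [_ [h' dh hh']] := hgq.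
pose h x := g x * q x.
(* The derivative of [(1 - x ^+ 2) ^+ j.+1 * h x] with the factor [(1 - x ^+ 2) ^+ j] taken out. *)
pose gt x := c1 * (x * h x) + (1 + -1 * (x * x)) * h' x.
have idj := @bdd_der_id R j.
have hgt : bdd_der j B2 gt.
  apply: bdd_der_add.
    by apply: bdd_der_scale; exact: bdd_der_mul.
  apply: bdd_der_mul => //; apply: bdd_der_add.
    by apply: bdd_der_cst; rewrite normr1.
  by apply: bdd_der_scale; exact: bdd_der_mul.
pose beta (y : R) := 1 - y ^+ 2.
pose F y := beta y ^+ j.+1 * h y * sin (lam * Psi y + al).
pose f1 y := beta y ^+ j.+1 * g y * cos (lam * Psi y + al).
pose f2 y := beta y ^+ j * gt y * cos (lam * Psi y + (al - pi / 2)).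
have dbeta (x : R) : is_derive x 1 beta (- (2 * x)).
  apply: is_derive_eq (isder_sub (isder_cst x 1) (isder_pow 1 (isder_id x))) _.
  by ring.
have dlin (x : R) : -1 <= x <= 1 -> is_derive x 1 (fun y => lam * Psi y + al) (lam * p x).
  move=> xI; apply: is_derive_eq (isder_add (isder_mul (isder_cst x lam) (dPsi x xI)) (isder_cst x al)) _.
  by ring.
have dF (x : R) : -1 <= x <= 1 -> is_derive x 1 F (lam * f1 x + f2 x).
  move=> xI.
  have ds := isder_comp (is_derive_sin _) (dlin x xI).
  apply: is_derive_eq (isder_mul (isder_mul (isder_pow j (dbeta x)) (dh x xI)) ds) _.
  rewrite /f1 /f2 addrA cosBpi2 /gt /h /c1.
  have -> : 1 + -1 * (x * x) = beta x by rewrite /beta; ring.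
  have -> : beta x ^+ j.+1 * (g x * q x) * (cos (lam * Psi x + al) * (lam * p x)) =
    lam * (beta x ^+ j.+1 * g x * cos (lam * Psi x + al)) * (q x * p x) by ring.
  by rewrite (qp x xI) exprS; ring.
have cbeta k : cont_on (-1) 1 (fun y => beta y ^+ k).
  apply: cont_on_for => x _; case: k => [|k].
    exact: (@isder_cont _ (fun=> 1) x 0 (isder_cst x 1)).
  exact: (isder_cont (isder_pow k (dbeta x))).
have cf1 : cont_on (-1) 1 f1.
  apply: cont_onM; last by apply: cont_on_comp (cPsi _ _ _ _ dPsi); exact: continuous_cos.
  by apply: cont_onM => //; exact: bdd_der_cont_on hg.
have cf2 : cont_on (-1) 1 f2.
  apply: cont_onM; last by apply: cont_on_comp (cPsi _ _ _ _ dPsi); exact: continuous_cos.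
  by apply: cont_onM => //; exact: bdd_der_cont_on hgt.
have E : lam * int f1 + int f2 = 0.
  rewrite -intZ// -intD//; last by apply: cont_onM => //; exact: cont_on_cst.
  have cF : cont_on (-1) 1 F.
    by apply: cont_on_for => x xI; exact: (isder_cont (dF x xI)).
  have cf : cont_on (-1) 1 (fun x => lam * f1 x + f2 x).
    by apply: cont_onD => //; apply: cont_onM => //; exact: cont_on_cst.
  have dF' (x : R) : -1 < x < 1 -> is_derive x 1 F (lam * f1 x + f2 x).
    by move=> /andP[x1 x2]; apply: dF; rewrite !ltW.
  have := int_deriv I11 cF cf dF'; rewrite /int_deriv => ->.
  by rewrite /F /beta sqrrN expr1n subrr expr0n /= !mul0r subrr.
have -> : int f1 = - lam^-1 * int f2.
  apply: (mulfI (lt0r_neq0 lam0)).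
  by rewrite mulrA mulrN divff ?gt_eqF// mulN1r; apply/eqP; rewrite -addr_eq0 E.
have li0 : 0 < lam^-1 by rewrite invr_gt0.
have -> : C / lam ^+ j.+1 = lam^-1 * (C / lam ^+ j) by rewrite exprSr invfM mulrA mulrC.
rewrite normrM normrN (gtr0_norm li0) (ler_wpM2l (ltW li0))//.
apply: hC dPsi cp qp _ _ => //.
  by apply: bdd_der_mono (bdd_derW hq).
by apply: bdd_der_mono hgt; rewrite le_max lexx orbT.
Qed.

End oscillatory.

(** * Decay of smeared exponentials along two nearby directions *)

Section kernel.
Context {R : realType}.
Local Notation mu := (@lebesgue_measure R).
Local Notation int f := (\int[mu]_(y in `[(-1)%R, 1%R]) f y)%R.

Section line.
Context {n : nat}.
Implicit Types (X E v : 'rV[R]_n).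

(** With Y = X + yE, the phase <Y,v> / |Y| has derivative (<E,v>|Y|^2 - <Y,v><Y,E>) / |Y|^3, and the
    last hypothesis keeps the numerator away from 0. Dividing by [s] normalises the phase: all
    derivative bounds then depend on [A] and [m] only, and the large parameter is [r * s]. *)
Lemma line_osc (A m : R) : 0 < m -> exists2 C, 0 <= C &
  forall X E v (r al s : R), 0 < s -> 0 < r ->
  (forall y : R, -1 <= y <= 1 -> 4^-1 <= enorm (X + y *: E)) ->
  enorm X <= 3 -> enorm E <= 1 ->
  `|dotp X v| <= A * s -> `|dotp E v| <= A * s ->
  (forall y : R, -1 <= y <= 1 -> m * s <=
    `|dotp E v * enorm (X + y *: E) ^+ 2 - dotp (X + y *: E) v * dotp (X + y *: E) E|) ->
  `|int (fun y => (1 - y ^+ 2) ^+ 4 *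
      cos (r * dotp (dir (X + y *: E)) v + al))| <= C / (r * s) ^+ 4.
Proof.
move=> m0.
have c16 : 0 < 16^-1 :> R by [].
(* Bounds for [dotp X X], [2 * dotp X E * y] and [dotp E E * (y * y)], from [enorm X <= 3] and
   [enorm E <= 1]. *)
pose CD : R := 9 + (6 * 1 + 1 * (2 ^+ 5 * (1 * 1))).
have [CI hCI] := bdd_der_isqrt 5 CD c16.
pose CN := A + A * 1.
pose Cp := 2 ^+ 4 * (A * CI) + 2 ^+ 4 * (CN * (`|- 2^-1| * (2 ^+ 4 *
  ((6 + 2 * 1) * (2 ^+ 4 * (2 ^+ 4 * (CI * CI) * CI)))))).
(* The numerator of the derivative is at least [m * s], and its denominator contains
   [enorm (X + y *: E) ^+ 3 <= 4 ^+ 3]. *)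
have m64 : 0 < m / 64 by rewrite divr_gt0.
have [Cq hCq] := bdd_der_inv 4 Cp m64.
pose B := Num.max Cq 1.
have B0 : 0 <= B by rewrite le_max ler01 orbT.
have [C C0 hC] := oscillatory_int_le 4 B0.
exists C => // X E v r al s s0 r0 hX X3 E1 Xv Ev hm.
pose Nn y := dotp X v / s + dotp E v / s * y.
pose D y := dotp X X + (2 * dotp X E * y + dotp E E * (y * y)).
have DE y : D y = enorm (X + y *: E) ^+ 2.
  by rewrite enorm_sqr !(dotpDl, dotpDr, dotpZl, dotpZr) (dotpC E X) /D; ring.
have D16 (y : R) : -1 <= y <= 1 -> 16^-1 <= D y.
  move=> /hX h; rewrite DE (_ : 16^-1 = 4^-1 ^+ 2); last by field.
  by rewrite ler_pXn2r// nnegrE// enorm_ge0.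
have XX : dotp X X <= 9.
  rewrite -enorm_sqr (_ : 9 = 3 ^+ 2); last by ring.
  by rewrite ler_pXn2r// nnegrE// enorm_ge0.
have EE : dotp E E <= 1.
  rewrite -enorm_sqr (_ : 1 = 1 ^+ 2 :> R); last by ring.
  by rewrite ler_pXn2r// nnegrE// enorm_ge0.
have XE : `|dotp X E| <= 3.
  apply: le_trans (dotp_le _ _) _; rewrite -[3]mulr1.
  by apply: ler_pM => //; exact: enorm_ge0.
have hD : bdd_der 5 CD D.
  apply: bdd_der_add; first by apply: bdd_der_cst; rewrite ger0_norm ?dotp_ge0.
  apply: bdd_der_add.
    apply: (@bdd_der_mono _ _ (`|2 * dotp X E| * 1)); last by apply: bdd_der_scale; exact: bdd_der_id.
    by rewrite ler_wpM2r// normrM ger0_norm//; lra.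
  apply: (@bdd_der_mono _ _ (`|dotp E E| * (2 ^+ 5 * (1 * 1)))).
    by rewrite ler_wpM2r// ger0_norm ?dotp_ge0.
  by apply: bdd_der_scale; apply: bdd_der_mul; exact: bdd_der_id.
have hI := hCI _ hD D16.
have as0 (t : R) : `|t| <= A * s -> `|t / s| <= A.
  by move=> h; rewrite normrM normfV (gtr0_norm s0) ler_pdivrMr.
have hN : bdd_der 4 CN Nn.
  apply: bdd_der_add; first by apply: bdd_der_cst; exact: as0.
  apply: (@bdd_der_mono _ _ (`|dotp E v / s| * 1)); first by rewrite ler_wpM2r// as0.
  by apply: bdd_der_scale; exact: bdd_der_id.
pose I y := (Num.sqrt (D y))^-1.
pose Psi y := Nn y * I y.
pose D' y := 2 * dotp X E + 2 * dotp E E * y.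
pose p y := dotp E v / s * I y + Nn y * (- 2^-1 * (D' y * (I y * I y * I y))).
have dD (y : R) : is_derive y 1 D (D' y).
  have d2 := isder_mul (isder_cst y (dotp E E)) (isder_mul (isder_id y) (isder_id y)).
  have d1 := isder_mul (isder_cst y (2 * dotp X E)) (isder_id y).
  apply: is_derive_eq (isder_add (isder_cst y (dotp X X)) (isder_add d1 d2)) _.
  by rewrite /D'; ring.
have dPsi (y : R) : -1 <= y <= 1 -> is_derive y 1 Psi (p y).
  move=> yI.
  have dN : is_derive y 1 Nn (dotp E v / s).
    apply: is_derive_eq (isder_add (isder_cst y _) (isder_mul (isder_cst y (dotp E v / s)) (isder_id y))) _.
    by ring.
  apply: is_derive_eq (isder_mul dN (isder_isqrt (dD y) (lt_le_trans c16 (D16 _ yI)))) _.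
  by rewrite /p /I; ring.
have hp : bdd_der 4 Cp p.
  have hI4 := bdd_derW hI.
  apply: bdd_der_add.
    by apply: bdd_der_mul => //; apply: bdd_der_cst; exact: as0.
  apply: bdd_der_mul => //; apply: bdd_der_scale; apply: bdd_der_mul.
    apply: bdd_der_add.
      by apply: bdd_der_cst; rewrite normrM ger0_norm//; lra.
    apply: (@bdd_der_mono _ _ (`|2 * dotp E E| * 1)).
      by rewrite mulr1 ger0_norm ?mulr_ge0 ?dotp_ge0//; lra.
    by apply: bdd_der_scale; exact: bdd_der_id.
  by apply: bdd_der_mul => //; exact: bdd_der_mul.
have pm (y : R) : -1 <= y <= 1 -> m / 64 <= `|p y|.
  move=> yI; have := hm y yI; set Y := X + y *: E => hmY.
  have Y0 : 0 < enorm Y by apply: lt_le_trans (hX _ yI).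
  have Y4 : enorm Y <= 4.
    apply: le_trans (enormD _ _) _; rewrite enormZ.
    have : `|y| * enorm E <= 1 * 1 by apply: ler_pM => //; [exact: enorm_ge0|rewrite ler_norml].
    lra.
  have IY : I y = (enorm Y)^-1 by rewrite /I DE sqrtr_sqr ger0_norm ?enorm_ge0.
  have NY : Nn y = dotp Y v / s by rewrite /Nn /Y dotpDl dotpZl; ring.
  have D'Y : D' y = 2 * dotp Y E by rewrite /D' /Y dotpDl dotpZl; ring.
  have -> : p y = (dotp E v * enorm Y ^+ 2 - dotp Y v * dotp Y E) / (s * enorm Y ^+ 3).
    rewrite /p IY NY D'Y; field.
    by rewrite !gt_eqF.
  rewrite normrM normfV (@gtr0_norm _ (s * _)) ?mulr_gt0 ?exprn_gt0//.
  rewrite ler_pdivlMr ?mulr_gt0 ?exprn_gt0//.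
  apply: le_trans hmY.
  rewrite -mulrA (ler_wpM2l (ltW m0))// mulrCA -[leRHS]mulr1 (ler_wpM2l (ltW s0))//.
  rewrite ler_pdivrMl// mulr1 (_ : 64 = 4 ^+ 3); last by ring.
  by rewrite ler_pXn2r// nnegrE// ltW.
have hq := hCq _ hp pm.
have qp (y : R) : -1 <= y <= 1 -> (p y)^-1 * p y = 1.
  move=> /pm h; rewrite mulVf//.
  by apply/eqP => p0; move: h; rewrite p0 normr0 leNgt m64.
have g1 : bdd_der 4 B (fun=> 1 : R).
  by apply: bdd_der_cst; rewrite normr1 le_max lexx orbT.
have := hC (r * s) al Psi p _ _ (mulr_gt0 r0 s0) dPsi (bdd_der_cont hp) qp
  (bdd_der_mono _ hq) g1.
rewrite le_max lexx => /(_ isT); apply: le_trans; rewrite le_eqVlt; apply/orP; left.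
apply/eqP; congr (`| _ |); apply: eq_Rintegral => y /set_mem.
rewrite /= in_itv /= => /hX Xy; rewrite mulr1; congr (_ * cos (_ + al)).
rewrite /Psi /Nn /I DE sqrtr_sqr (ger0_norm (enorm_ge0 _)) /dir dotpZl dotpDl dotpZl.
by field; rewrite !gt_eqF// (lt_le_trans _ Xy).
Qed.

End line.

Lemma bounded_integrable (g : R -> R) (M : R) :
  measurable_fun [set: measurableTypeR R] g ->
  (forall y : R, -1 <= y <= 1 -> `|g y| <= M) ->
  mu.-integrable `[(-1)%R, 1%R] (EFin \o g).
Proof.
move=> mg gM; apply: (@measurable_bounded_integrable _ _ _ mu) => //.
- have : (mu `[(0 - 1)%R, (0 + 1)%R] < +oo)%E by rewrite leb_itv_center// ltry.
  by rewrite sub0r add0r.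
- exact: measurable_funTS.
- exists M; split; first exact: num_real.
  move=> x Mx y1 /=; rewrite !in_itv /= => h1.
  by apply: le_trans (ltW Mx); exact: gM.
Qed.

Lemma bounded_int_le (g : R -> R) (M : R) :
  mu.-integrable `[(-1)%R, 1%R] (EFin \o g) ->
  (forall y : R, -1 <= y <= 1 -> `|g y| <= M) -> `|int g| <= M * 2.
Proof.
move=> ig gM; apply: le_trans (le_normr_Rintegral _ ig) _ => //.
have muI : mu `[(-1)%R, 1%R] = 2%:E.
  have : mu `[(0 - 1)%R, (0 + 1)%R] = 2%:E by rewrite leb_itv_center// mulr1.
  by rewrite sub0r add0r.
rewrite -(_ : int (cst M) = M * 2); last by rewrite Rintegral_cst//= [mu _]muI.
apply: le_Rintegral => //.
- exact: (integrable_norm ig).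
- by apply: cont_integrable; exact: cont_on_cst.
Qed.

Section box.
Local Notation I11 := (`[(-1)%R, 1%R]%classic : set (measurableTypeR R)).
Variables (f : R * R -> R) (M : R).
Hypothesis mf : measurable_fun [set: measurableTypeR R * measurableTypeR R] f.
Hypothesis fM : forall y1 y2 : R, -1 <= y1 <= 1 -> -1 <= y2 <= 1 -> `|f (y1, y2)| <= M.

(** Extension by zero off the square, so that Fubini can be used on the whole plane. *)
Let fb : (measurableTypeR R * measurableTypeR R)%type -> R := f \_ (I11 `*` I11).

Let mI : measurable I11.
Proof. exact: measurable_itv. Qed.

Let muI : mu I11 = 2%:E.
Proof.
have -> : mu I11 = mu `[(0 - 1)%R, (0 + 1)%R] by rewrite sub0r add0r.
by rewrite leb_itv_center// mulr1.
Qed.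

Let fb_integrable : (mu \x mu)%E.-integrable setT (EFin \o fb).
Proof.
have mII : measurable (I11 `*` I11) by exact: measurableX.
rewrite /fb -restrict_EFin; apply/integrable_restrict => //; rewrite setTI.
apply: (@measurable_bounded_integrable _ _ _ (mu \x mu)%E) => //.
- have : ((mu \x mu) (I11 `*` I11) < +oo)%E.
    rewrite product_measure1E//; have : (mu I11 * mu I11 < +oo)%E by rewrite muI -EFinM ltry.
    exact.
  exact.
- exact: measurable_funTS.
- exists M; split; first exact: num_real.
  move=> x Mx [y1 y2] [/=]; rewrite !in_itv /= => h1 h2.
  by apply: le_trans (ltW Mx); exact: fM.
Qed.

Let fbE (y1 y2 : R) : -1 <= y2 <= 1 ->
  fb (y1, y2) = ((fun y1 => f (y1, y2)) \_ I11) y1.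
Proof.
move=> h; rewrite /fb !patchE in_setX /=.
by rewrite [y2 \in _]mem_set ?andbT// /= in_itv.
Qed.

Let fbE' (y1 y2 : R) : -1 <= y1 <= 1 ->
  fb (y1, y2) = ((fun y2 => f (y1, y2)) \_ I11) y2.
Proof.
move=> h; rewrite /fb !patchE in_setX /=.
by rewrite [y1 \in _]mem_set // /= in_itv.
Qed.

Let fb0 (y1 y2 : R) : ~~ (-1 <= y2 <= 1) -> fb (y1, y2) = 0.
Proof.
move=> h; rewrite /fb !patchE in_setX /=.
by rewrite [y2 \in _]memNset ?andbF// /= in_itv/=; exact/negP.
Qed.

Let fb0' (y1 y2 : R) : ~~ (-1 <= y1 <= 1) -> fb (y1, y2) = 0.
Proof.
move=> h; rewrite /fb !patchE in_setX /=.
by rewrite [y1 \in _]memNset// /= in_itv/=; exact/negP.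
Qed.

Let G y2 := int (fun y1 => f (y1, y2)).
Let H y1 := int (fun y2 => f (y1, y2)).

Let f1_int (y2 : R) : -1 <= y2 <= 1 -> mu.-integrable I11 (fun y1 => (f (y1, y2))%:E).
Proof.
move=> h; apply: (bounded_integrable (g := fun y1 => f (y1, y2)) (M := M)).
  exact: (measurableT_comp mf (measurable_pair2 y2)).
by move=> y hy; exact: fM.
Qed.

Lemma box_section_integrable (y1 : R) : -1 <= y1 <= 1 -> mu.-integrable I11 (fun y2 => (f (y1, y2))%:E).
Proof.
move=> h; apply: (bounded_integrable (g := fun y2 => f (y1, y2)) (M := M)).
  exact: (measurableT_comp mf (measurable_pair1 y1)).
by move=> y hy; exact: fM.
Qed.

Let GE (y2 : R) : (\int[mu]_y1 (fb (y1, y2))%:E)%E = ((G \_ I11) y2)%:E.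
Proof.
rewrite patchE; case: ifPn => [/set_mem|]; rewrite ?notin_setE /= in_itv /= => h.
  rewrite /G /Rintegral fineK; last exact: (integrable_fin_num _ (f1_int h)).
  rewrite [RHS]integral_mkcond; apply: eq_integral => y1 _.
  by rewrite fbE// restrict_EFin.
rewrite (eq_integral (cst 0%E)) ?integral_cst ?mul0e// => y1 _.
by rewrite fb0//; exact/negP.
Qed.

Let HE (y1 : R) : (\int[mu]_y2 (fb (y1, y2))%:E)%E = ((H \_ I11) y1)%:E.
Proof.
rewrite patchE; case: ifPn => [/set_mem|]; rewrite ?notin_setE /= in_itv /= => h.
  rewrite /H /Rintegral fineK; last exact: (integrable_fin_num _ (box_section_integrable h)).
  rewrite [RHS]integral_mkcond; apply: eq_integral => y2 _.
  by rewrite fbE'// restrict_EFin.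
rewrite (eq_integral (cst 0%E)) ?integral_cst ?mul0e// => y1' _.
by rewrite fb0'//; exact/negP.
Qed.

Lemma box_outer_integrable : mu.-integrable I11 (EFin \o H).
Proof.
rewrite integrable_mkcond// (_ : _ \_ _ = fun y1 => (\int[mu]_y2 (fb (y1, y2))%:E)%E).
  exact: (integrable_fubini_F fb_integrable).
by apply/funext => y1; rewrite HE restrict_EFin.
Qed.

(** The direction in which an exponential oscillates depends on its frequency, whereas the average
    over a cell has a fixed order of integration. *)
Lemma box_swap : int G = int H.
Proof.
rewrite /Rintegral; congr fine.
rewrite [LHS]integral_mkcond [RHS]integral_mkcond.
transitivity (\int[mu]_y2 \int[mu]_y1 (fb (y1, y2))%:E)%E.
  by apply: eq_integral => y2 _; rewrite GE restrict_EFin.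
rewrite -(Fubini fb_integrable).
by apply: eq_integral => y1 _; rewrite HE restrict_EFin.
Qed.

Lemma box_le (K : R) : (forall y1 : R, -1 <= y1 <= 1 -> `|H y1| <= K) -> `|int H| <= K * 2.
Proof. exact: (bounded_int_le box_outer_integrable). Qed.

Lemma box_EFin :
  (\int[mu]_(y1 in `[(-1)%R, 1%R]) \int[mu]_(y2 in `[(-1)%R, 1%R]) (f (y1, y2))%:E)%E =
  (int H)%:E.
Proof.
rewrite [in RHS]/Rintegral fineK; last exact: (integrable_fin_num _ box_outer_integrable).
apply: eq_integral => y1 /set_mem; rewrite /= in_itv /= => h.
by rewrite /H /Rintegral fineK//; exact: (integrable_fin_num _ (box_section_integrable h)).
Qed.

Lemma box_inner_le (y1 : R) : -1 <= y1 <= 1 -> `|H y1| <= M * 2.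
Proof. by move=> h; apply: (bounded_int_le (box_section_integrable h)) => y hy; exact: fM. Qed.

End box.

(** The weight of [oscillatory_int_le] for [j = 4]. *)
Definition weight (y : R) : R := (1 - y ^+ 2) ^+ 4.

Lemma weight_ge0 y : 0 <= weight y.
Proof. by rewrite /weight (exprM _ 2 2) sqr_ge0. Qed.

Lemma weight_le1 (y : R) : -1 <= y <= 1 -> weight y <= 1.
Proof.
move=> yI; have y2 : y ^+ 2 <= 1 by rewrite -real_normK ?num_real// exprn_ile1// ler_norml.
by rewrite exprn_ile1// ?subr_ge0// lerBlDr lerDl sqr_ge0.
Qed.

Lemma measurable_weight : measurable_fun [set: measurableTypeR R] (weight : measurableTypeR R -> R).
Proof. by apply: measurable_funX; apply: measurable_funB => //; exact: measurable_funX. Qed.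

Section gram.
Context {n : nat}.
Variables V1 V2 : 'rV[R]_n.
Hypothesis gram_gt0 : 0 < dotp V1 V1 * dotp V2 V2 - dotp V1 V2 ^+ 2.
Let B := 1 + enorm V1 + enorm V2.

(** Cramer's rule for the Gram matrix: [det * c1] and [det * c2] are combinations of the two
    pairings, so the larger pairing controls [|c1| + |c2|]. Which of [V1], [V2] gives it decides in
    which variable the kernel is integrated by parts. *)
Lemma gram_lower : exists2 g0, 0 < g0 & forall c1 c2 : R,
  g0 * (`|c1| + `|c2|) <= `|dotp V1 (c1 *: V1 + c2 *: V2)| \/
  g0 * (`|c1| + `|c2|) <= `|dotp V2 (c1 *: V1 + c2 *: V2)|.
Proof.
pose det := dotp V1 V1 * dotp V2 V2 - dotp V1 V2 ^+ 2.
have det0 : 0 < det by [].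
pose S := dotp V1 V1 + 2 * `|dotp V1 V2| + dotp V2 V2.
have S0 : 0 <= S by rewrite !addr_ge0 ?dotp_ge0 ?mulr_ge0.
have S1 : 0 < 1 + S by rewrite ltr_pwDl.
exists (det / (1 + S)); first by rewrite divr_gt0.
move=> c1 c2.
set p1 := dotp V1 _; set p2 := dotp V2 _.
set a := dotp V1 V1 in S S0 S1 *; set b := dotp V1 V2 in S S0 S1 *; set e := dotp V2 V2 in S S0 S1 *.
have p1E : p1 = a * c1 + b * c2 by rewrite /p1 !(dotpDr, dotpZr) -/a -/b; ring.
have p2E : p2 = b * c1 + e * c2.
  by rewrite /p2 !(dotpDr, dotpZr) (dotpC V2 V1) -/a -/b -/e; ring.
have h1 : det * c1 = e * p1 - b * p2 by rewrite p1E p2E /det -/a -/b -/e; ring.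
have h2 : det * c2 = a * p2 - b * p1 by rewrite p1E p2E /det -/a -/b -/e; ring.
have key m : `|p1| <= m -> `|p2| <= m -> det * (`|c1| + `|c2|) <= S * m.
  move=> hp1 hp2.
  have -> : det * (`|c1| + `|c2|) = `|det * c1| + `|det * c2|.
    by rewrite !normrM (gtr0_norm det0) mulrDr.
  rewrite h1 h2; apply: le_trans (lerD (ler_normB _ _) (ler_normB _ _)) _.
  rewrite !normrM (ger0_norm (dotp_ge0 V1)) (ger0_norm (dotp_ge0 V2)) -/a -/e.
  have m0 : 0 <= m by apply: le_trans hp1.
  have := ler_wpM2l (dotp_ge0 V2) hp1; have := ler_wpM2l (dotp_ge0 V1) hp2.
  have := ler_wpM2l (normr_ge0 b) hp1; have := ler_wpM2l (normr_ge0 b) hp2.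
  by rewrite -/a -/e /S; lra.
have fin m : 0 <= m -> det * (`|c1| + `|c2|) <= S * m ->
    det / (1 + S) * (`|c1| + `|c2|) <= m.
  by move=> m0 h; rewrite mulrAC ler_pdivrMr// (le_trans h)// mulrC ler_wpM2l// lerDr.
by case: (leP `|p1| `|p2|) => h; [right|left]; apply: fin => //; apply: key => //; exact: ltW.
Qed.

Lemma unit_mul_le (y a : R) : -1 <= y <= 1 -> `|y * a| <= `|a|.
Proof. by move=> h; rewrite normrM ler_piMl// ler_norml. Qed.

Lemma shift_geom (kap c0 y1 y2 : R) (x : 'rV[R]_n) : 0 < kap ->
  kap * B <= 16^-1 -> kap * B ^+ 2 <= c0 / 2 ->
  -1 <= y1 <= 1 -> -1 <= y2 <= 1 ->
  let X := x + y2 *: (kap *: V2) + y1 *: (kap *: V1) in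
  [/\ enorm x - 16^-1 <= enorm X, enorm X <= enorm x + 16^-1,
    `|dotp X V1| <= `|dotp x V1| + c0 & `|dotp X V2| <= `|dotp x V2| + c0].
Proof.
move=> kap0 kapB kapB2 h1 h2 X.
have nB1 : enorm V1 <= B by rewrite /B; have := enorm_ge0 V2; lra.
have nB2 : enorm V2 <= B by rewrite /B; have := enorm_ge0 V1; lra.
have zE : enorm (y2 *: (kap *: V2) + y1 *: (kap *: V1)) <= 16^-1.
  have t (y : R) (V : 'rV[R]_n) : -1 <= y <= 1 -> enorm (y *: (kap *: V)) <= kap * enorm V.
    move=> hy; rewrite !enormZ mulrA (ler_wpM2r (enorm_ge0 _))// -normrM.
    by apply: le_trans (unit_mul_le _ hy) _; rewrite (gtr0_norm kap0).
  apply: le_trans (enormD _ _) _; apply: le_trans (lerD (t _ _ h2) (t _ _ h1)) _.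
  apply: le_trans kapB; rewrite -mulrDr (ler_wpM2l (ltW kap0))// /B; lra.
have XE : X = x + (y2 *: (kap *: V2) + y1 *: (kap *: V1)) by rewrite addrA.
have hdot (V : 'rV[R]_n) : `|kap * dotp V2 V| <= c0 / 2 -> `|kap * dotp V1 V| <= c0 / 2 ->
    `|dotp X V| <= `|dotp x V| + c0.
  move=> hV2 hV1; rewrite /X !dotpDl !dotpZl.
  apply: le_trans (ler_normD _ _) _; apply: le_trans (lerD (ler_normD _ _) (lexx _)) _.
  have := unit_mul_le (kap * dotp V2 V) h2; have := unit_mul_le (kap * dotp V1 V) h1.
  move: hV2 hV1; lra.
have nn (U W : 'rV[R]_n) : enorm U <= B -> enorm W <= B -> `|kap * dotp U W| <= c0 / 2.
  move=> hU hW; rewrite normrM (gtr0_norm kap0); apply: le_trans kapB2.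
  rewrite (ler_wpM2l (ltW kap0))// (le_trans (dotp_le _ _))// expr2.
  by apply: ler_pM => //; exact: enorm_ge0.
split.
- by rewrite XE; have := enormD_ge x (y2 *: (kap *: V2) + y1 *: (kap *: V1)); lra.
- by rewrite XE; have := enormD x (y2 *: (kap *: V2) + y1 *: (kap *: V1)); lra.
- by apply: hdot => //; exact: nn.
- by apply: hdot => //; exact: nn.
Qed.

Lemma kernel_geom (kap c0 y1 y2 : R) (x : 'rV[R]_n) : 0 < kap ->
  kap * B <= 16^-1 -> kap * B ^+ 2 <= c0 / 2 ->
  3 / 8 <= enorm x <= 2 -> `|dotp x V1| <= 2 * c0 -> `|dotp x V2| <= 2 * c0 ->
  -1 <= y1 <= 1 -> -1 <= y2 <= 1 ->
  let X := x + y2 *: (kap *: V2) + y1 *: (kap *: V1) in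
  [/\ 4^-1 <= enorm X, enorm X <= 3, `|dotp X V1| <= 3 * c0 & `|dotp X V2| <= 3 * c0].
Proof.
move=> kap0 kapB kapB2 /andP[x1 x2] xV1 xV2 h1 h2 X.
by have [] := shift_geom x kap0 kapB kapB2 h1 h2; rewrite -/X => *; split; lra.
Qed.

(** Checks the lower bound required by [line_osc]. The term [dotp V v * enorm X ^+ 2] is at least
    [g0 / 32 * s], as [V] detects [v] and [enorm X >= 1 / 4]. The other term, [dotp X v * dotp X V],
    is of second order in [c0] because [X] is nearly orthogonal to [V1] and [V2]: it is at most
    [18 * c0 ^+ 2 * s], which the choice of [c0] makes at most [g0 / 64 * s]. *)
Lemma kernel_direction (kap c0 g0 eta C1 : R) : 0 < kap -> kap * B <= 16^-1 ->
  0 < c0 -> c0 <= 1 -> c0 <= g0 / (36 * 32) -> 0 < eta -> eta <= c0 ->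
  eta <= g0 / (2 * B) -> 0 < g0 ->
  (forall (X E v : 'rV[R]_n) (r al s : R), 0 < s -> 0 < r ->
  (forall y : R, -1 <= y <= 1 -> 4^-1 <= enorm (X + y *: E)) ->
  enorm X <= 3 -> enorm E <= 1 ->
  `|dotp X v| <= 6 * B * s -> `|dotp E v| <= 6 * B * s ->
  (forall y : R, -1 <= y <= 1 -> kap * g0 / 64 * s <=
    `|dotp E v * enorm (X + y *: E) ^+ 2 - dotp (X + y *: E) v * dotp (X + y *: E) E|) ->
  `|int (fun y => (1 - y ^+ 2) ^+ 4 *
      cos (r * dotp (dir (X + y *: E)) v + al))| <= C1 / (r * s) ^+ 4) ->
  forall (r al c1 c2 : R) (v V X0 : 'rV[R]_n), 0 < r -> 0 < `|c1| + `|c2| ->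
  enorm (v - (c1 *: V1 + c2 *: V2)) <= eta * (`|c1| + `|c2|) ->
  enorm V <= B -> g0 * (`|c1| + `|c2|) <= `|dotp V (c1 *: V1 + c2 *: V2)| ->
  (forall X, `|dotp X V1| <= 3 * c0 -> `|dotp X V2| <= 3 * c0 -> `|dotp X V| <= 3 * c0) ->
  (forall y : R, -1 <= y <= 1 -> let X := X0 + y *: (kap *: V) in
     [/\ 4^-1 <= enorm X, enorm X <= 3, `|dotp X V1| <= 3 * c0 & `|dotp X V2| <= 3 * c0]) ->
  `|int (fun y => weight y * cos (r * dotp (dir (X0 + y *: (kap *: V))) v + al))|
    <= C1 / (r * (`|c1| + `|c2|)) ^+ 4.
Proof.
move=> kap0 kapB c00 c01 c0g eta0 etac etag g00 hC1 r al c1 c2 v V X0 r0.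
set s := `|c1| + `|c2|; set w := c1 *: V1 + c2 *: V2.
move=> s1 hv VB Vw hV hX0.
have B1 : 1 <= B by rewrite /B; have := enorm_ge0 V1; have := enorm_ge0 V2; lra.
have B0 : 0 < B by apply: lt_le_trans B1.
have s0 := ltW s1.
have nB1 : enorm V1 <= B by rewrite /B; have := enorm_ge0 V2; lra.
have nB2 : enorm V2 <= B by rewrite /B; have := enorm_ge0 V1; lra.
have vE : v = w + (v - w) by rewrite addrC subrK.
have geomv (X : 'rV[R]_n) : enorm X <= 3 -> `|dotp X V1| <= 3 * c0 -> `|dotp X V2| <= 3 * c0 ->
   `|dotp X v| <= 6 * c0 * s.
  move=> X3 X1 X2.
  have -> : dotp X v = c1 * dotp X V1 + c2 * dotp X V2 + dotp X (v - w).
    by rewrite dotpBr /w dotpDr !dotpZr; ring.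
  apply: le_trans (ler_normD _ _) _.
  apply: le_trans (lerD (ler_normD _ _) (dotp_le _ _)) _.
  rewrite !normrM.
  have := ler_wpM2l (normr_ge0 c1) X1; have := ler_wpM2l (normr_ge0 c2) X2.
  have : enorm X * enorm (v - w) <= 3 * (c0 * s).
    apply: ler_pM => //; try exact: enorm_ge0.
    by apply: le_trans hv _; rewrite ler_wpM2r.
  by rewrite /s /w; clear; lra.
have vB : enorm v <= 2 * B * s.
  rewrite vE; apply: le_trans (enormD _ _) _.
  apply: le_trans (lerD (enormD _ _) hv) _; rewrite !enormZ -/s.
  have : eta * s <= 1 * s by rewrite ler_wpM2r// (le_trans etac).
  have : `|c1| * enorm V1 <= `|c1| * B.
    by rewrite ler_wpM2l.
  have : `|c2| * enorm V2 <= `|c2| * B.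
    by rewrite ler_wpM2l.
  have : 1 * s <= B * s by rewrite ler_wpM2r.
  by rewrite /s; clear; lra.
have E16 : enorm (kap *: V) <= 16^-1.
  by rewrite enormZ (gtr0_norm kap0); apply: le_trans kapB; rewrite (ler_wpM2l (ltW kap0)).
have X03 : enorm X0 <= 3.
  have /hX0[] : -1 <= (0 : R) <= 1 by rewrite lerN10 ler01.
  by rewrite scale0r addr0.
have Bs : 0 <= B * s by rewrite mulr_ge0// ltW.
apply: hC1 => //.
- by move=> y /hX0[].
- by apply: le_trans E16 _; rewrite invf_le1// ler1n.
- apply: le_trans (dotp_le _ _) _; apply: (@le_trans _ _ (3 * (2 * B * s))).
    by apply: ler_pM => //; exact: enorm_ge0.
  by move: Bs; clear; lra.
- apply: le_trans (dotp_le _ _) _; apply: (@le_trans _ _ (16^-1 * (2 * B * s))).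
    by apply: ler_pM => //; exact: enorm_ge0.
  by move: Bs; clear; lra.
move=> y /hX0; set X := X0 + _ => -[X4 X3 X1 X2].
have -> : dotp (kap *: V) v * enorm X ^+ 2 - dotp X v * dotp X (kap *: V) =
    kap * (dotp V v * enorm X ^+ 2 - dotp X v * dotp X V) by rewrite dotpZl dotpZr; ring.
rewrite normrM (gtr0_norm kap0).
rewrite -!mulrA (ler_wpM2l (ltW kap0))//.
have Vv : g0 / 2 * s <= `|dotp V v|.
  have : g0 * s <= `|dotp V v| + g0 / 2 * s.
    apply: le_trans Vw _.
    have -> : w = v - (v - w) by rewrite opprB addrC subrK.
    rewrite dotpBr; apply: le_trans (ler_normB _ _) _; rewrite lerD2l.
    apply: le_trans (dotp_le _ _) _.
    apply: (@le_trans _ _ (B * (g0 / (2 * B) * s))).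
      apply: ler_pM => //; try exact: enorm_ge0.
      by apply: le_trans hv _; rewrite ler_wpM2r.
    by rewrite le_eqVlt; apply/orP; left; apply/eqP; field; rewrite gt_eqF.
  by clear; lra.
have XX : 16^-1 <= enorm X ^+ 2.
  rewrite (_ : 16^-1 = 4^-1 ^+ 2); last by field.
  by rewrite ler_pXn2r// nnegrE// enorm_ge0.
have p1 : g0 / 2 * s * 16^-1 <= `|dotp V v * enorm X ^+ 2|.
  rewrite normrM (ger0_norm (sqr_ge0 _)) ler_pM// ?mulr_ge0//.
  exact: ltW.
have p2 : `|dotp X v * dotp X V| <= 6 * c0 * s * (3 * c0).
  by rewrite normrM ler_pM// ?geomv// hV.
have p3 : 6 * c0 * s * (3 * c0) <= g0 / 64 * s.
  have : c0 * c0 * s <= 1 * (g0 / (36 * 32)) * s.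
    by rewrite ler_wpM2r// ler_pM// ltW.
  by clear; lra.
have := lerB_normD (dotp V v * enorm X ^+ 2) (- (dotp X v * dotp X V)).
rewrite normrN => p4; apply: le_trans p4; move: p1 p2 p3; clear; lra.
Qed.

(** For [r * (|c1| + |c2|) <= 1] the trivial bound suffices; otherwise [gram_lower] names the
    direction, and integration by parts in that variable alone gives the full decay. The admissible
    error in [v] is relative to [|c1| + |c2|], so it cannot cancel the main term. *)
Lemma kernel_le : exists kap c0 eta C : R,
  [/\ 0 < kap, 0 < c0, 0 < eta, 0 <= C & [/\ kap * B <= 16^-1, kap * B ^+ 2 <= c0 / 2 &
  forall (r al c1 c2 : R) (x v : 'rV[R]_n), 0 < r ->
  enorm (v - (c1 *: V1 + c2 *: V2)) <= eta * (`|c1| + `|c2|) ->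
  3 / 8 <= enorm x <= 2 -> `|dotp x V1| <= 2 * c0 -> `|dotp x V2| <= 2 * c0 ->
  `|int (fun y2 => int (fun y1 => weight y2 * weight y1 *
      cos (r * dotp (dir (x + y2 *: (kap *: V2) + y1 *: (kap *: V1))) v + al)))|
    <= C / (1 + r * (`|c1| + `|c2|)) ^+ 4]].
Proof.
have [g0 g00 hg] := gram_lower.
have n1 := enorm_ge0 V1; have n2 := enorm_ge0 V2.
have B1 : 1 <= B by rewrite /B; lra.
have nB1 : enorm V1 <= B by rewrite /B; lra.
have nB2 : enorm V2 <= B by rewrite /B; lra.
have B0 : 0 < B by lra.
pose c0 := Num.min 1 (g0 / (36 * 32)).
have c00 : 0 < c0 by rewrite lt_min ltr01 divr_gt0// mulr_gt0.
have c01 : c0 <= 1 by rewrite ge_min lexx.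
have c0g : c0 <= g0 / (36 * 32) by rewrite ge_min lexx orbT.
pose eta := Num.min c0 (g0 / (2 * B)).
have eta0 : 0 < eta by rewrite lt_min c00 divr_gt0// mulr_gt0.
have etac : eta <= c0 by rewrite ge_min lexx.
have etag : eta <= g0 / (2 * B) by rewrite ge_min lexx orbT.
pose kap := Num.min (16 * B)^-1 (c0 / (2 * B ^+ 2)).
have kap0 : 0 < kap by rewrite lt_min invr_gt0 mulr_gt0// divr_gt0// mulr_gt0// exprn_gt0.
have kapB : kap * B <= 16^-1.
  by rewrite -ler_pdivlMr// -invfM mulrC ge_min [B * _]mulrC lexx.
have kapB2 : kap * B ^+ 2 <= c0 / 2.
  rewrite -ler_pdivlMr ?exprn_gt0// -mulrA -invfM ge_min lexx orbT//.
pose m := kap * g0 / 64.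
have m0 : 0 < m by rewrite divr_gt0// mulr_gt0.
have [C1 C10 hC1] := @line_osc n (6 * B) m m0.
(* With [s = |c1| + |c2|]: [64 = 4 * 2 ^+ 4] covers [r * s <= 1], where [1 + r * s <= 2];
   [32 * C1 = 2 * C1 * 2 ^+ 4] covers [r * s > 1], where [1 + r * s <= 2 * (r * s)]. *)
exists kap, c0, eta, (Num.max 64 (32 * C1)); split => //.
  by rewrite le_max ler0n.
split => // r al c1 c2 x v r0 hv x12 xV1 xV2.
set s := `|c1| + `|c2|.
have s0 : 0 <= s by rewrite addr_ge0.
pose E1 := kap *: V1; pose E2 := kap *: V2.
pose f (p : R * R) : R := weight p.1 * weight p.2 *
  cos (r * dotp (dir (x + p.1 *: E2 + p.2 *: E1)) v + al).
have f1 (y1 y2 : R) : -1 <= y1 <= 1 -> -1 <= y2 <= 1 -> `|f (y1, y2)| <= 1.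
  move=> h1 h2; rewrite /f normrM [X in X * _]normrM !(ger0_norm (weight_ge0 _)) /=.
  apply: mulr_ile1; [|exact: normr_ge0| |by rewrite ler_norml cos_geN1 cos_le1].
    exact: (mulr_ge0 (weight_ge0 _) (weight_ge0 _)).
  exact: (mulr_ile1 (weight_ge0 _) (weight_ge0 _) (weight_le1 h1) (weight_le1 h2)).
have mf : measurable_fun [set: measurableTypeR R * measurableTypeR R] f.
  apply: measurable_funM.
    apply: measurable_funM.
      exact: (measurableT_comp measurable_weight measurable_fst).
    exact: (measurableT_comp measurable_weight measurable_snd).
  apply: (measurableT_comp (f := cos)).
    by apply: continuous_measurable_fun; exact: continuous_cos.
  apply: measurable_funD => //; apply: measurable_funM => //.
  apply: (measurableT_comp (measurable_dotpl v)).
  apply: (measurableT_comp measurable_dir).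
  apply: measurable_fun_coordP => i; under eq_fun do rewrite !mxE.
  apply: measurable_funD.
    by apply: measurable_funD => //; apply: measurable_funM => //; exact: measurable_fst.
  by apply: measurable_funM => //; exact: measurable_snd.
have mf' : measurable_fun [set: measurableTypeR R * measurableTypeR R] (fun p => f (p.2, p.1)).
  apply: (measurableT_comp mf (f := f)).
  exact: (measurable_fun_pair measurable_snd measurable_fst).
have key K : (forall y2 : R, -1 <= y2 <= 1 -> `|int (fun y1 => f (y2, y1))| <= K) \/
    (forall y1 : R, -1 <= y1 <= 1 -> `|int (fun y2 => f (y2, y1))| <= K) ->
    `|int (fun y2 => int (fun y1 => f (y2, y1)))| <= K * 2.
  case => h; first exact: (box_le mf f1 h).
  rewrite -(box_swap mf f1).
  by apply: (box_le (f := fun p => f (p.2, p.1)) mf' (M := 1)) => // y1 y2 ? ?; exact: f1.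
have triv : `|int (fun y2 => int (fun y1 => f (y2, y1)))| <= 4.
  rewrite (_ : 4 = 2 * 2); last by ring.
  apply: key; left => y2 y2I.
  by have := box_inner_le mf f1 y2I; rewrite mul1r.
have [rs1|rs1] := leP (r * s) 1.
  apply: le_trans triv _.
  rewrite ler_pdivlMr; last by rewrite exprn_gt0// ltr_pwDl// mulr_ge0// ltW.
  apply: (@le_trans _ _ (4 * 2 ^+ 4)).
    have rs0 : 0 <= r * s by rewrite mulr_ge0// ltW.
    by rewrite ler_wpM2l// ler_pXn2r ?nnegrE//; move: rs0 rs1; clear; lra.
  by rewrite le_max; apply/orP; left; rewrite -natrX -natrM ler_nat.
have s1 : 0 < s.
  by rewrite lt_neqAle s0 andbT; apply/eqP => h; move: rs1; rewrite -h mulr0 ltr10.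
have geom (y1 y2 : R) := @kernel_geom kap c0 y1 y2 x kap0 kapB kapB2 x12 xV1 xV2.
have dirk := kernel_direction kap0 kapB c00 c01 c0g eta0 etac etag g00 hC1 al r0 s1 hv.
have wfac (g : R -> R) y2 : measurable_fun [set: measurableTypeR R] g ->
    (forall y : R, -1 <= y <= 1 -> `|g y| <= 1) -> -1 <= y2 <= 1 ->
    `|int g| <= C1 / (r * s) ^+ 4 -> `|int (fun y1 => weight y2 * g y1)| <= C1 / (r * s) ^+ 4.
  move=> mg g1 y2I h; rewrite RintegralZl//; last exact: (bounded_integrable mg g1).
  rewrite normrM (ger0_norm (weight_ge0 _)); apply: le_trans h.
  by rewrite ler_piMl// weight_le1.
have fin : (forall y2 : R, -1 <= y2 <= 1 -> `|int (fun y1 => f (y2, y1))| <= C1 / (r * s) ^+ 4) \/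
    (forall y1 : R, -1 <= y1 <= 1 -> `|int (fun y2 => f (y2, y1))| <= C1 / (r * s) ^+ 4).
  have gb (X : 'rV[R]_n) (y1 : R) : -1 <= y1 <= 1 ->
     `|weight y1 * cos (r * dotp (dir X) v + al)| <= 1.
    move=> h; rewrite normrM (ger0_norm (weight_ge0 _)).
    apply: mulr_ile1; [exact: weight_ge0|exact: normr_ge0|exact: weight_le1|].
    by rewrite ler_norml cos_geN1 cos_le1.
  have mg (X E : 'rV[R]_n) : measurable_fun [set: measurableTypeR R]
     (fun y : measurableTypeR R => weight y * cos (r * dotp (dir (X + (y : R) *: E)) v + al)).
    apply: measurable_funM; first exact: measurable_weight.
    apply: (measurableT_comp (f := cos)).
      by apply: continuous_measurable_fun; exact: continuous_cos.
    apply: measurable_funD => //; apply: measurable_funM => //.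
    apply: (measurableT_comp (measurable_dotpl v)).
    apply: (measurableT_comp measurable_dir).
    apply: measurable_fun_coordP => i; under eq_fun do rewrite !mxE.
    by apply: measurable_funD => //; exact: measurable_funM.
  case: (hg c1 c2) => hV; [left=> y2 y2I|right=> y1 y1I].
  - have -> : int (fun y1 => f (y2, y1)) = int (fun y1 => weight y2 *
      (weight y1 * cos (r * dotp (dir (x + y2 *: E2 + y1 *: E1)) v + al))).
      by apply: eq_Rintegral => y1 _; rewrite /f /= mulrA.
    apply: wfac; [exact: mg|by move=> y yI; exact: gb|exact: y2I|].
    by apply: dirk => // y yI; exact: geom.
  - have XE y2 : x + y2 *: E2 + y1 *: E1 = x + y1 *: E1 + y2 *: E2 by rewrite addrAC.
    have -> : int (fun y2 => f (y2, y1)) = int (fun y2 => weight y1 *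
      (weight y2 * cos (r * dotp (dir (x + y1 *: E1 + y2 *: E2)) v + al))).
      by apply: eq_Rintegral => y2 _; rewrite /f /= XE mulrA [weight y2 * _]mulrC.
    apply: wfac; [exact: mg|by move=> y yI; exact: gb|exact: y1I|].
    by apply: dirk => // y2 y2I; rewrite /= -/E2 -XE; exact: geom.
apply: le_trans (key _ fin) _.
have rs0 : 0 < r * s by apply: lt_trans rs1.
apply: (@le_trans _ _ (32 * C1 / (1 + r * s) ^+ 4)); last first.
  rewrite ler_wpM2r ?le_max ?lexx ?orbT// invr_ge0 exprn_ge0//; move: rs0; clear; lra.
rewrite ler_pdivlMr ?exprn_gt0//; last by move: rs0; clear; lra.
apply: (@le_trans _ _ (C1 / (r * s) ^+ 4 * 2 * (2 * (r * s)) ^+ 4)).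
  have q0 : 0 <= C1 / (r * s) ^+ 4 * 2.
    by rewrite !mulr_ge0// invr_ge0 exprn_ge0// ltW.
  rewrite (ler_wpM2l q0)// ler_pXn2r ?nnegrE//; move: rs0 rs1; clear; lra.
rewrite [(2 * _) ^+ 4]exprMn le_eqVlt; apply/orP; left; apply/eqP.
by field; rewrite !gt_eqF.
Qed.

End gram.

End kernel.

(** * Lattice sums *)

Section sums.
Context {R : realType}.
Implicit Types (rho z : R) (u w : nat -> R).

Let pot rho z (x : R) := (x - z) / (1 + rho * `|x - z|).

Let den_gt0 rho (x : R) : 0 < rho -> 0 < 1 + rho * `|x|.
Proof. by move=> r0; rewrite ltr_pwDl// mulr_ge0// ltW. Qed.

Let pot_le rho z x : 0 < rho -> `|pot rho z x| <= rho^-1.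
Proof.
move=> r0; rewrite /pot normrM normfV (gtr0_norm (den_gt0 _ r0)).
rewrite ler_pdivrMr ?den_gt0// -ler_pdivrMl ?invr_gt0// invrK lerDr ler01//.
Qed.

(* [pot rho z] is an antiderivative of [x |-> 1 / (1 + rho |x - z|) ^ 2]. *)
Let pot_step rho z (x y : R) : 0 < rho -> x <= y -> rho * (y - x) <= 1 ->
  (y - x) / (1 + rho * `|x - z|) ^+ 2 <= 2 * (pot rho z y - pot rho z x).
Proof.
move=> r0 xy st; rewrite /pot.
set a := x - z; set b := y - z.
have -> : y - x = b - a by rewrite /a /b; ring.
have ab : a <= b by rewrite lerB.
have {}st : rho * (b - a) <= 1 by rewrite (_ : b - a = y - x)// /a /b; ring.
have A0 := den_gt0 a r0; have B0 := den_gt0 b r0.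
set A := 1 + rho * `|a| in A0 *; set B := 1 + rho * `|b| in B0 *.
have BA : B <= 2 * A.
  have : rho * `|b| <= rho * `|a| + rho * (b - a).
    rewrite -mulrDr (ler_wpM2l (ltW r0))//.
    have -> : b = a + (b - a) by ring.
    apply: le_trans (ler_normD _ _) _; rewrite lerD2l ger0_norm ?subr_ge0//; lra.
  have : 1 <= A by rewrite /A lerDl mulr_ge0// ltW.
  rewrite /A /B; lra.
have key : (b - a) / (A * B) <= b / B - a / A.
  rewrite [leRHS](_ : _ = (b * A - a * B) / (A * B)); last by field; rewrite !gt_eqF.
  rewrite ler_pM2r ?invr_gt0 ?mulr_gt0// /A /B.
  have : 0 <= rho * (b * `|a| - a * `|b|); last by lra.
  rewrite mulr_ge0 ?(ltW r0)//.
  by case: (ger0P a); case: (ger0P b) => ? ?; nra.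
apply: le_trans (ler_wpM2l _ key) => //.
rewrite mulrCA (ler_wpM2l _) ?subr_ge0// expr2 invfM invfM mulrCA.
by rewrite (ler_wpM2l _) ?invr_ge0 ?(ltW A0)// ler_pdivlMr// mulrC ler_pdivrMr// mulrC.
Qed.

(** Comparison with the integral of [(1 + rho * |x - z|) ^- 2] by telescoping [pot], uniformly in
    [z]: steps of length at most [rho^-1] change the kernel by a bounded factor only. *)
Lemma sum_decay_le rho z u w n : 0 < rho ->
  (forall k, u k <= u k.+1) ->
  (forall k, (k < n)%N -> rho * (u k.+1 - u k) <= 1) ->
  (forall k, (k < n)%N -> w k <= u k.+1 - u k) ->
  \sum_(0 <= k < n) w k / (1 + rho * `|z - u k|) ^+ 2 <= 4 / rho.
Proof.
move=> r0 ndu st wu.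
have : \sum_(0 <= k < n) w k / (1 + rho * `|z - u k|) ^+ 2 <=
    2 * (pot rho z (u n) - pot rho z (u 0%N)).
  elim: n st wu => [|n IH] st wu; first by rewrite big_geq// subrr mulr0.
  rewrite big_nat_recr//=.
  have h : w n / (1 + rho * `|z - u n|) ^+ 2 <= 2 * (pot rho z (u n.+1) - pot rho z (u n)).
    apply: le_trans (pot_step _ r0 (ndu n) (st n (ltnSn n))).
    by rewrite distrC ler_wpM2r ?invr_ge0 ?exprn_ge0 ?(ltW (den_gt0 _ r0))// wu.
  have := IH (fun k kn => st k (ltnW kn)) (fun k kn => wu k (ltnW kn)); lra.
move=> /le_trans; apply.
have := pot_le z (u n) r0; have := pot_le z (u 0%N) r0.
rewrite !ler_norml; lra.
Qed.

Lemma sum_linear_decay rho z (s : nat) n : 0 < rho -> (0 < s)%N -> rho * s%:R <= 1 ->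
  \sum_(0 <= k < n) ((1 + rho * `|z - (s * k)%:R|) ^+ 2)^-1 <= 4 / rho.
Proof.
move=> r0 s0 rs.
have E k : (s * k.+1)%:R - (s * k)%:R = s%:R :> R by rewrite mulnS natrD addrK.
under eq_bigr do rewrite -[_^-1]mul1r.
apply: (@sum_decay_le rho z (fun k => (s * k)%:R) (fun=> 1) n) => //.
- by move=> k; rewrite ler_nat leq_mul2l leqnSn orbT.
- by move=> k _; rewrite E.
- by move=> k _; rewrite E ler1n.
Qed.

Lemma sum_square_decay rho z n : 0 < rho -> rho * (2 * n%:R) <= 1 ->
  \sum_(0 <= k < n) k%:R / (1 + rho * `|z - (k%:R) ^+ 2|) ^+ 2 <= 4 / rho.
Proof.
move=> r0 rn.
have E k : (k.+1%:R ^+ 2) - (k%:R) ^+ 2 = 2 * k%:R + 1 :> R by rewrite -natr1; ring.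
apply: (@sum_decay_le rho z (fun k => (k%:R) ^+ 2) (fun k => k%:R) n) => //.
- by move=> k; rewrite -subr_ge0 E addr_ge0// mulr_ge0.
- move=> k kn; rewrite E; apply: le_trans rn; rewrite (ler_wpM2l (ltW r0))//.
  by have : k.+1%:R <= n%:R :> R by [rewrite ler_nat]; rewrite -natr1; lra.
- by move=> k _; rewrite E; have := ler0n R k; lra.
Qed.

Lemma sum_above_le (k M : nat) (f : nat -> R) : (forall l, 0 <= f l) ->
  \sum_(l < M | (k < l)%N) f l <= \sum_(0 <= h < M) f (h + k)%N.
Proof.
move=> f0.
rewrite -(big_mkord (fun l => (k < l)%N) f).
have [kM|Mk] := leqP k M; last first.
  rewrite big_nat_cond big_pred0; first by apply: sumr_ge0.
  move=> l; apply/negP => /andP[/andP[_ lM] kl].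
  by have := ltn_trans kl (ltn_trans lM Mk); rewrite ltnn.
rewrite (big_cat_nat _ kM)//= [X in X + _]big_nat_cond [X in X + _]big_pred0 ?add0r; last first.
  by move=> l; apply/negP => /andP[/andP[_ lk] kl]; have := ltn_trans kl lk; rewrite ltnn.
apply: (@le_trans _ _ (\sum_(k <= l < M) f l)).
  by rewrite big_mkcond ler_sum// => l _; case: ifP.
rewrite -{1}(add0n k) big_addn.
rewrite (big_nat_widen 0 _ M) ?leq_subr//= [leRHS]big_mkcond /= big_mkcond/= ler_sum// => h _.
by case: ifP => // _.
Qed.

Let kap rho (x : R) := ((1 + rho * `|x|) ^+ 2)^-1.

Let kap_ge0 rho x : 0 < rho -> 0 <= kap rho x.
Proof. by move=> r0; rewrite invr_ge0 exprn_ge0// ltW// den_gt0. Qed.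

(** With [h] the gap and [k] the lower index, the first factor depends on [2 * k + h] and the second
    on [h ^+ 2]. Summing over [k] at fixed [h] gives [4 / rho]; the weight [h] then lets the sum
    over squares be bounded by [4 / rho2]. *)
Lemma sum_pair_inner_le rho rho2 (z1 z2 : R) (M : nat) : 0 < rho -> 0 < rho2 ->
  2 * rho <= 1 -> rho2 * (2 * M%:R) <= 1 ->
  \sum_(p : 'I_M * 'I_M | (p.1 < p.2)%N) (p.2%:R - p.1%:R) *
    (((1 + rho * `|z1 - (p.1%:R + p.2%:R)|) ^+ 2)^-1 *
     ((1 + rho2 * `|z2 - (p.2%:R - p.1%:R) ^+ 2|) ^+ 2)^-1) <= 16 / (rho * rho2).
Proof.
move=> r0 r20 r1 r21.
rewrite -(pair_big_dep (fun=> true) (fun k l : 'I_M => (k < l)%N) (fun k l : 'I_M =>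
   (l%:R - k%:R) * (kap rho (z1 - (k%:R + l%:R)) * kap rho2 (z2 - (l%:R - k%:R) ^+ 2))))/=.
pose f (k h : nat) := h%:R * (kap rho (z1 - (2 * k + h)%:R) * kap rho2 (z2 - h%:R ^+ 2)).
have f0 k h : 0 <= f k h by rewrite /f !mulr_ge0 ?kap_ge0.
apply: (@le_trans _ _ (\sum_(k < M) \sum_(0 <= h < M) f k h)).
  apply: ler_sum => k _.
  pose g (l : nat) := if (k < l)%N then f k (l - k)%N else 0.
  have g0 l : 0 <= g l by rewrite /g; case: ifP.
  apply: (@le_trans _ _ (\sum_(l < M | (k < l)%N) g l)).
    apply: ler_sum => l kl; rewrite /g kl /f natrB ?(ltnW kl)//.
    by rewrite mul2n -addnn -addnA subnKC ?(ltnW kl)// natrD.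
  apply: le_trans (sum_above_le _ _ g0) _; apply: ler_sum => h _.
  by rewrite /g addnK; case: ifP.
rewrite -(big_mkord (fun=> true) (fun k => \sum_(0 <= h < M) f k h)) exchange_big /=.
apply: (@le_trans _ _ (\sum_(0 <= h < M) (h%:R * kap rho2 (z2 - h%:R ^+ 2)) * (4 / rho))).
  apply: ler_sum => h _.
  rewrite (eq_bigr (fun k => (h%:R * kap rho2 (z2 - h%:R ^+ 2)) * kap rho ((z1 - h%:R) - (2 * k)%:R))).
    rewrite -mulr_sumr (ler_wpM2l _) ?mulr_ge0 ?kap_ge0//.
    by apply: sum_linear_decay => //; rewrite mulrC.
  move=> k _; rewrite /f natrD (_ : z1 - _ = z1 - h%:R - (2 * k)%:R); last by ring.
  by rewrite [kap rho _ * _]mulrC mulrA.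
rewrite -mulr_suml (_ : 16 / (rho * rho2) = 4 / rho2 * (4 / rho)); last first.
  by field; rewrite !gt_eqF.
rewrite ler_wpM2r ?divr_ge0 ?(ltW r0)//.
exact: sum_square_decay.
Qed.

Lemma harmonic_le (M : nat) : (0 < M)%N ->
  \sum_(1 <= h < M.+1) (h%:R)^-1 <= 1 + ln M%:R :> R.
Proof.
elim: M => // -[|M] IH _; first by rewrite big_nat1 invr1 ln1 addr0.
rewrite big_nat_recr//=.
have h0 : 0 < M.+1%:R :> R by rewrite ltr0n.
have h1 : 0 < M.+2%:R :> R by rewrite ltr0n.
have M2 : M.+2%:R^-1 < 1 :> R by rewrite invf_lt1// ltr1n.
have E : M.+1%:R = M.+2%:R * (1 + - M.+2%:R^-1) :> R.
  by rewrite mulrDr mulrN divff ?gt_eqF// mulr1 -[M.+2%:R]natr1 addrK.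
have := IH isT.
rewrite [in X in ln X]E lnM ?posrE//; last by rewrite subr_gt0.
have : ln (1 + - M.+2%:R^-1) <= - M.+2%:R^-1 :> R by apply: le_ln1Dx; rewrite ltrN2.
have fin (A B C S : R) : B <= - C -> S <= 1 + (A + B) -> S + C <= 1 + A by lra.
exact: fin.
Qed.

Lemma sum_inv_gap_le (M : nat) : (0 < M)%N ->
  \sum_(p : 'I_M * 'I_M | (p.1 < p.2)%N) (p.2%:R - p.1%:R)^-1 <= M%:R * (1 + ln M%:R) :> R.
Proof.
move=> M0.
rewrite -(pair_big_dep (fun=> true) (fun k l : 'I_M => (k < l)%N) (fun k l : 'I_M =>
   (l%:R - k%:R)^-1 : R))/=.
apply: (@le_trans _ _ (\sum_(k < M) (1 + ln M%:R))); last by rewrite sumr_const card_ord mulr_natl.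
apply: ler_sum => k _; apply: le_trans (harmonic_le M0).
pose g (l : nat) : R := if (k < l)%N then (l - k)%:R^-1 else 0.
have g0 l : 0 <= g l by rewrite /g; case: ifP.
apply: (@le_trans _ _ (\sum_(l < M | (k < l)%N) g l)).
  by apply: ler_sum => l kl; rewrite /g kl natrB ?(ltnW kl).
apply: le_trans (sum_above_le _ _ g0) _.
apply: (@le_trans _ _ (\sum_(0 <= h < M.+1) h%:R^-1)).
  rewrite [leRHS]big_nat_recr//= -[leLHS]addr0; apply: lerD; last by rewrite invr_ge0.
  by apply: ler_sum => h _; rewrite /g addnK; case: ifP; rewrite ?invr_ge0.
by rewrite (@big_cat_nat _ _ _ 1)//= big_nat1 invr0 add0r.
Qed.

(* Schur's test with weight [h = l - k]: by symmetry and
   [1 <= (h'/h + h/h')/2] the double sum is at most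
   [\sum (1/h) \sum' h' K], and the inner sum is bounded uniformly. *)
Lemma sum_pair_le rho rho2 (M : nat) : 0 < rho -> 0 < rho2 ->
  2 * rho <= 1 -> rho2 * (2 * M%:R) <= 1 -> (0 < M)%N ->
  \sum_(p : 'I_M * 'I_M | (p.1 < p.2)%N) \sum_(q : 'I_M * 'I_M | (q.1 < q.2)%N)
    (((1 + rho * `|(p.1%:R + p.2%:R) - (q.1%:R + q.2%:R)|) ^+ 2)^-1 *
     ((1 + rho2 * `|(p.2%:R - p.1%:R) ^+ 2 - (q.2%:R - q.1%:R) ^+ 2|) ^+ 2)^-1)
  <= M%:R * (1 + ln M%:R) * (16 / (rho * rho2)).
Proof.
move=> r0 r20 r1 r21 M0.
pose h (p : 'I_M * 'I_M) : R := p.2%:R - p.1%:R.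
have h0 (p : 'I_M * 'I_M) : (p.1 < p.2)%N -> 0 < h p by rewrite /h subr_gt0 ltr_nat.
pose K (p q : 'I_M * 'I_M) := kap rho ((p.1%:R + p.2%:R) - (q.1%:R + q.2%:R)) *
  kap rho2 (h p ^+ 2 - h q ^+ 2).
have K0 p q : 0 <= K p q by rewrite mulr_ge0 ?kap_ge0.
have Ksym p q : K p q = K q p.
  by rewrite /K /kap distrC [X in _ / (1 + rho2 * X) ^+ 2]distrC.
pose S1 := \sum_(p : 'I_M * 'I_M | (p.1 < p.2)%N) \sum_(q : 'I_M * 'I_M | (q.1 < q.2)%N)
  (h p)^-1 * (h q * K p q).
have S1E : \sum_(p : 'I_M * 'I_M | (p.1 < p.2)%N) \sum_(q : 'I_M * 'I_M | (q.1 < q.2)%N)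
  (h q)^-1 * (h p * K p q) = S1.
  rewrite exchange_big /=; apply: eq_bigr => p _; apply: eq_bigr => q _.
  by rewrite Ksym.
apply: (@le_trans _ _ (2^-1 * (S1 + S1))).
  rewrite -{2}S1E -big_split mulr_sumr; apply: ler_sum => p hp.
  rewrite -big_split mulr_sumr; apply: ler_sum => q hq /=.
  have hp0 := h0 _ hp; have hq0 := h0 _ hq.
  change (K p q <= 2^-1 * ((h p)^-1 * (h q * K p q) + (h q)^-1 * (h p * K p q))).
  have -> : 2^-1 * ((h p)^-1 * (h q * K p q) + (h q)^-1 * (h p * K p q)) =
    2^-1 * ((h p)^-1 * h q + (h q)^-1 * h p) * K p q by ring.
  apply: ler_peMl => //.
  rewrite -subr_ge0 (_ : _ - 1 = (h p - h q) ^+ 2 / (2 * h p * h q)); last first.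
    by field; rewrite !gt_eqF.
  by rewrite divr_ge0 ?sqr_ge0// !mulr_ge0// ltW.
have -> : 2^-1 * (S1 + S1) = S1 by field.
apply: (@le_trans _ _ (\sum_(p : 'I_M * 'I_M | (p.1 < p.2)%N) (h p)^-1 * (16 / (rho * rho2)))).
  apply: ler_sum => p hp; rewrite -mulr_sumr ler_wpM2l ?invr_ge0 ?(ltW (h0 _ hp))//.
  exact: sum_pair_inner_le.
rewrite -mulr_suml ler_wpM2r ?divr_ge0 ?mulr_ge0 ?(ltW r0) ?(ltW r20)//.
exact: sum_inv_gap_le.
Qed.

End sums.

(** * Trigonometric polynomials on a cap of the sphere *)

Section box_linear.
Context {R : realType}.
Local Notation mu := (@lebesgue_measure R).
Local Notation int f := (\int[mu]_(y in `[(-1)%R, 1%R]) f y)%R.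

Definition box (f : R * R -> R) : R := int (fun y1 => int (fun y2 => f (y1, y2))).

Definition box_bounded (f : R * R -> R) :=
  measurable_fun [set: measurableTypeR R * measurableTypeR R] f /\
  exists M, forall y1 y2 : R, -1 <= y1 <= 1 -> -1 <= y2 <= 1 -> `|f (y1, y2)| <= M.

Lemma box_boundedD f g : box_bounded f -> box_bounded g ->
  box_bounded (fun p => f p + g p).
Proof.
move=> [mf [M fM]] [mg [N gN]]; split; first exact: measurable_funD.
by exists (M + N) => y1 y2 h1 h2; apply: le_trans (ler_normD _ _) _; rewrite lerD ?fM ?gN.
Qed.

Lemma box_boundedZ c f : box_bounded f -> box_bounded (fun p => c * f p).
Proof.
move=> [mf [M fM]]; split; first exact: measurable_funM.
by exists (`|c| * M) => y1 y2 h1 h2; rewrite normrM ler_wpM2l ?fM.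
Qed.

Lemma boxD f g : box_bounded f -> box_bounded g ->
  box (fun p => f p + g p) = box f + box g.
Proof.
move=> [mf [M fM]] [mg [N gN]]; rewrite /box.
rewrite -RintegralD//; last 2 first.
- exact: (box_outer_integrable mf fM).
- exact: (box_outer_integrable mg gN).
apply: eq_Rintegral => y1 /set_mem; rewrite /= in_itv /= => h.
rewrite RintegralD//.
- exact: (box_section_integrable mf fM h).
- exact: (box_section_integrable mg gN h).
Qed.

Lemma boxZ c f : box_bounded f -> box (fun p => c * f p) = c * box f.
Proof.
move=> [mf [M fM]]; rewrite /box -RintegralZl//; last exact: (box_outer_integrable mf fM).
apply: eq_Rintegral => y1 /set_mem; rewrite /= in_itv /= => h.
by rewrite RintegralZl//; exact: (box_section_integrable mf fM h).
Qed.

Lemma box_bounded_sum (I : Type) (s : seq I) (f : I -> R * R -> R) :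
  (forall i, box_bounded (f i)) -> box_bounded (fun p => \sum_(i <- s) f i p).
Proof.
move=> bf; elim: s => [|i s IH].
  under eq_fun do rewrite big_nil.
  by split => //; exists 0 => y1 y2 _ _; rewrite normr0.
under eq_fun do rewrite big_cons.
exact: box_boundedD.
Qed.

Lemma box_sum (I : Type) (s : seq I) (f : I -> R * R -> R) :
  (forall i, box_bounded (f i)) ->
  box (fun p => \sum_(i <- s) f i p) = \sum_(i <- s) box (f i).
Proof.
move=> bf; elim: s => [|i s IH].
  rewrite big_nil -[RHS](mul0r (box (fun=> 0))) -boxZ.
    by congr box; apply/funext => p; rewrite big_nil mul0r.
  by split => //; exists 0 => y1 y2 _ _; rewrite normr0.
rewrite big_cons -IH -(boxD (bf i) (box_bounded_sum s bf)).
by apply: eq_Rintegral => y1 _; apply: eq_Rintegral => y2 _; rewrite big_cons.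
Qed.

(** On [-1/2, 1/2] the weight is at least [(3 / 4) ^+ 4], so the rescaled weight dominates the
    indicator produced by the smearing. Nonnegativity of the integrand is what permits this passage
    from a sharp to a smooth cut-off. *)
Lemma ge0_integral_weight_le (g : R -> \bar R) :
  measurable_fun [set: measurableTypeR R] g -> (forall y, (0 <= g y)%E) ->
  (\int[mu]_(y in `[(- 2^-1)%R, (2^-1)%R]) g y <=
   \int[mu]_(y in `[(-1)%R, 1%R]) (((4 / 3) ^+ 4 * weight y)%:E * g y))%E.
Proof.
move=> mg g0.
have w0 (y : R) : 0 <= (4 / 3) ^+ 4 * weight y by rewrite mulr_ge0 ?weight_ge0// exprn_ge0.
have mw : measurable_fun [set: measurableTypeR R]
    (fun y : measurableTypeR R => (((4 / 3) ^+ 4 * weight y)%:E * g y)%E).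
  apply: emeasurable_funM => //; apply/measurable_EFinP.
  by apply: measurable_funM => //; exact: measurable_weight.
apply: (@le_trans _ _ (\int[mu]_(y in `[(- 2^-1)%R, (2^-1)%R])
    (((4 / 3) ^+ 4 * weight y)%:E * g y))%E); last first.
  apply: ge0_subset_integral => //.
  - exact: measurable_funTS.
  - by move=> y _; apply: mule_ge0; rewrite ?lee_fin.
  - by apply: subset_itv; rewrite bnd_simp; lra.
apply: ge0_le_integral => //.
- exact: measurable_funTS.
- exact: measurable_funTS.
move=> y; rewrite /= in_itv /= => /andP[y1 y2].
rewrite -[leLHS]mul1e lee_pmul// lee_fin -exprMn -{1}(expr1n R 4).
rewrite ler_pXn2r// ?nnegrE//; last first.
  have : y ^+ 2 <= 1; last by lra.
  by rewrite expr2; nra.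
have : y ^+ 2 <= 4^-1; last by lra.
by rewrite expr2; nra.
Qed.

End box_linear.

Section quadratic.
Context {R : realType} {n : nat}.
Local Notation mu := (@lebesgue_measure R).
Local Notation int f := (\int[mu]_(y in `[(-1)%R, 1%R]) f y)%R.
Local Notation leb := (lebesgue_rV R n).
Implicit Types (I : finType) (w x v : 'rV[R]_n).

(** The squared modulus of the exponential sum with real coefficients [b] and frequencies [P]. *)
Definition trig_sqr I (b : I -> R) (P : I -> 'rV[R]_n) (xi : 'rV[R]_n) : R :=
  (\sum_i b i * cos (dotp xi (P i))) ^+ 2 + (\sum_i b i * sin (dotp xi (P i))) ^+ 2.

Lemma trig_sqr_ge0 I (b : I -> R) P xi : 0 <= trig_sqr b P xi.
Proof. by rewrite addr_ge0// sqr_ge0. Qed.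

Lemma trig_sqrE I (b : I -> R) P xi : trig_sqr b P xi =
  \sum_i \sum_j b i * b j * cos (dotp xi (P i - P j)).
Proof.
rewrite /trig_sqr !expr2 !big_distrl /= -big_split; apply: eq_bigr => i _ /=.
rewrite !big_distrr -big_split; apply: eq_bigr => j _ /=.
by rewrite dotpBr cosB; ring.
Qed.

Lemma trig_sqr_le I (b : I -> R) P xi : trig_sqr b P xi <= \sum_i \sum_j `|b i| * `|b j|.
Proof.
rewrite trig_sqrE; apply: ler_sum => i _; apply: ler_sum => j _.
apply: le_trans (ler_norm _) _; rewrite !normrM ler_piMr ?mulr_ge0//.
by rewrite ler_norml cos_geN1 cos_le1.
Qed.

Lemma measurable_cos_dotp (r : R) v :
  measurable_fun [set: 'rV[R]_n] (fun w => cos (dotp (r *: w) v)).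
Proof.
apply: (measurableT_comp (f := cos)).
  by apply: continuous_measurable_fun; exact: continuous_cos.
under eq_fun do rewrite dotpZl.
by apply: measurable_funM => //; exact: measurable_dotpl.
Qed.

Lemma measurable_trig_sqr I (b : I -> R) P (r : R) :
  measurable_fun [set: 'rV[R]_n] (fun w => trig_sqr b P (r *: w)).
Proof.
under eq_fun do rewrite trig_sqrE.
apply: measurable_sum => i; apply: measurable_sum => j.
by apply: measurable_funM => //; exact: measurable_cos_dotp.
Qed.

Variables V1 V2 : 'rV[R]_n.
Hypothesis gram_gt0 : 0 < dotp V1 V1 * dotp V2 V2 - dotp V1 V2 ^+ 2.

Definition cap (c0 : R) : set 'rV[R]_n :=
  [set w | `|dotp w V1| <= c0 /\ `|dotp w V2| <= c0].

Lemma measurable_cap c0 : measurable (cap c0).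
Proof.
have h (V : 'rV[R]_n) : measurable [set w | `|dotp w V| <= c0].
  rewrite (_ : [set w | _] = (fun x => dotp x V) @^-1` `[(- c0)%R, c0]).
    by rewrite -[X in measurable X]setTI; apply: measurable_dotpl.
  by apply/seteqP; split => x; rewrite /= in_itv/= -ler_norml.
exact: measurableI (h V1) (h V2).
Qed.

Lemma dotp_dir_mul x v : 0 < enorm x -> dotp x v = enorm x * dotp (dir x) v.
Proof. by move=> x0; rewrite /dir dotpZl mulrA divff ?gt_eqF// mul1r. Qed.

(* The average of a trigonometric polynomial over a cap around the orthogonal
   complement of [V1] and [V2] only sees the pairs of frequencies
   whose difference is not much larger than the wavelength. *)
Lemma cap_trig_sqr_le : (0 < n)%N -> exists c0 eta C : R, [/\ 0 < c0, 0 < eta, 0 <= C &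
  forall (I : finType) (b : I -> R) (P : I -> 'rV[R]_n) (c1 c2 : I -> I -> R) (r : R),
  0 < r ->
  (forall i j, b i * b j != 0 ->
    enorm (P i - P j - (c1 i j *: V1 + c2 i j *: V2)) <= eta * (`|c1 i j| + `|c2 i j|)) ->
  (\int[surface_measure]_w (\1_(cap c0) w * trig_sqr b P (r *: w))%:E <=
   (C * \sum_i \sum_j `|b i| * `|b j| / (1 + r * (`|c1 i j| + `|c2 i j|)) ^+ 4)%:E)%E].
Proof.
move=> n0.
have [kap [c0 [eta [C [kap0 c00 eta0 C0 [kB kB2 hK]]]]]] := kernel_le gram_gt0.
(* The annulus and the cap, enlarged to contain every base point from which a shift can land in
   them. *)
pose A' : set 'rV[R]_n := [set x | [/\ 3 / 8 <= enorm x <= 2, `|dotp x V1| <= 2 * c0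
  & `|dotp x V2| <= 2 * c0]].
have mA' : measurable A'.
  rewrite (_ : A' = [set x | enorm x \in `[3 / 8, 2]] `&` cap (2 * c0)).
    by apply: measurableI; [exact: measurable_enorm_itv|exact: measurable_cap].
  apply/seteqP; split => x; rewrite /A' /cap /= in_itv /=.
    by move=> [? ? ?].
  by move=> [? [? ?]].
have fA' : leb A' \is a fin_num.
  by rewrite ge0_fin_numE//; apply: (leb_bounded (K := 2)) => // x [/andP[]].
(* [2 * n%:R] comes from the reduction to the annulus, one [(4 / 3) ^+ 4] from each of the two
   weights, and [C] from the kernel. *)
pose C' := 2 * n%:R * ((4 / 3) ^+ 8 * C * fine (leb A')).
have q0 : 0 <= (4 / 3) ^+ 8 :> R by rewrite exprn_ge0// divr_ge0.
exists c0, eta, C'; split => //.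
  by rewrite /C' !mulr_ge0// fine_ge0.
move=> I b P c1 c2 r r0 hP.
set S := \sum_i \sum_j _.
have S0 : 0 <= S.
  apply: sumr_ge0 => i _; apply: sumr_ge0 => j _.
  apply: divr_ge0; first exact: mulr_ge0.
  by apply: exprn_ge0; apply: addr_ge0 => //; apply: mulr_ge0; [exact: ltW|exact: addr_ge0].
pose Q w := trig_sqr b P (r *: w).
have mQ : measurable_fun [set: 'rV[R]_n] Q by exact: measurable_trig_sqr.
have mcap := measurable_cap c0.
have mf : measurable_fun [set: 'rV[R]_n] (fun w => (\1_(cap c0) w * Q w)%:E).
  by apply/measurable_EFinP; apply: measurable_funM => //; exact: measurable_indic.
have f0 w : (0 <= (\1_(cap c0) w * Q w)%:E)%E.
  by rewrite lee_fin mulr_ge0 ?trig_sqr_ge0.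
have fK w : enorm w = 1 -> ((\1_(cap c0) w * Q w)%:E <= (\sum_i \sum_j `|b i| * `|b j|)%:E)%E.
  move=> _; rewrite lee_fin; apply: le_trans (trig_sqr_le b P (r *: w)).
  by rewrite ler_piMl ?trig_sqr_ge0// indicE; case: (_ \in _).
apply: le_trans (surface_le_annulus n0 mf f0 fK) _.
have mAN := @measurable_annulus R n.
pose A := annulus `&` (dir @^-1` cap c0) : set 'rV[R]_n.
have mdc : measurable (dir @^-1` cap c0 : set 'rV[R]_n).
  by rewrite -[X in measurable X]setTI; exact: measurable_dir.
have mA : measurable A by exact: measurableI.
pose h x := (Q (dir x))%:E.
have mh : measurable_fun setT h.
  by apply/measurable_EFinP; exact: (measurableT_comp mQ measurable_dir).
have h0 x : (0 <= h x)%E by rewrite lee_fin trig_sqr_ge0.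
have -> : (\int[leb]_(x in annulus) (\1_(cap c0) (dir x) * Q (dir x))%:E =
    \int[leb]_(x in A) h x)%E.
  rewrite [LHS]integral_mkcond [RHS]integral_mkcond; apply: eq_integral => x _.
  rewrite !patchE /A in_setI; case: (x \in annulus) => //=.
  rewrite indicE; have -> : (x \in dir @^-1` cap c0) = (dir x \in cap c0).
    by apply/idP/idP => /set_mem hx; exact/mem_set.
  by case: (dir x \in _); rewrite ?mul1r ?mul0r.
have -> : (C' * S)%:E = ((2 * n%:R)%:E * (((4 / 3) ^+ 8 * (C * S))%:E * leb A'))%E.
  by rewrite -(fineK fA') -!EFinM; congr (_%:E); rewrite /C'; ring.
apply: lee_wpmul2l; first by rewrite lee_fin mulr_ge0.
apply: (@smear2_le R n (kap *: V1) (kap *: V2) A A' h ((4 / 3) ^+ 8 * (C * S))) => //.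
- by rewrite !mulr_ge0.
- move=> x y1 y2 hy1 hy2; set X := _ + _ => -[/andP[X1 X2] [XV1 XV2]].
  have X0 : 0 < enorm X by apply: lt_trans X1.
  have y1I : -1 <= - y1 <= 1 by rewrite -ler_norml normrN (le_trans hy1)// invf_le1// ler1n.
  have y2I : -1 <= - y2 <= 1 by rewrite -ler_norml normrN (le_trans hy2)// invf_le1// ler1n.
  have [] := shift_geom X kap0 kB kB2 y1I y2I.
  have -> : X + - y2 *: (kap *: V2) + - y1 *: (kap *: V1) = x.
    by rewrite /X !scaleNr addrAC addrK addrK.
  have key V : `|dotp (dir X) V| <= c0 -> `|dotp X V| <= c0.
    move=> hV; rewrite dotp_dir_mul// normrM gtr0_norm//; apply: le_trans hV.
    by rewrite ler_piMl.
  move: (key _ XV1) (key _ XV2) => k1 k2 e1 e2 e3 e4.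
  split; [apply/andP; split|..]; move: k1 k2 e1 e2 e3 e4 X1 X2; clear; lra.
move=> x [x12 xV1 xV2].
pose X (p : R * R) := x + p.1 *: (kap *: V2) + p.2 *: (kap *: V1).
have mX : measurable_fun [set: measurableTypeR R * measurableTypeR R] X.
  apply: measurable_fun_coordP => i; under eq_fun do rewrite !mxE.
  apply: measurable_funD.
    by apply: measurable_funD => //; apply: measurable_funM => //; exact: measurable_fst.
  by apply: measurable_funM => //; exact: measurable_snd.
have mhX := measurableT_comp mh mX.
have mdX := measurableT_comp measurable_dir mX.
pose F i j (p : R * R) := weight p.1 * weight p.2 * cos (dotp (r *: dir (X p)) (P i - P j)).
have bF i j : box_bounded (F i j).
  split.
    apply: measurable_funM.
      apply: measurable_funM.
        exact: (measurableT_comp measurable_weight measurable_fst).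
      exact: (measurableT_comp measurable_weight measurable_snd).
    exact: (measurableT_comp (measurable_cos_dotp r (P i - P j)) mdX).
  exists 1 => y1 y2 h1 h2; rewrite /F normrM [X in X * _]normrM !(ger0_norm (weight_ge0 _)) /=.
  apply: mulr_ile1; [|exact: normr_ge0| |by rewrite ler_norml cos_geN1 cos_le1].
    exact: (mulr_ge0 (weight_ge0 _) (weight_ge0 _)).
  exact: (mulr_ile1 (weight_ge0 _) (weight_ge0 _) (weight_le1 h1) (weight_le1 h2)).
(* The weighted integrand on a cell, expanded over pairs of frequencies: its average is a
   combination of averages of the [F i j], to which the kernel bound applies. *)
pose G (p : R * R) := \sum_i \sum_j (((4 / 3) ^+ 8 * (b i * b j)) * F i j p).
have bG1 i : box_bounded (fun p => \sum_j (((4 / 3) ^+ 8 * (b i * b j)) * F i j p)).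
  by apply: box_bounded_sum => j; exact: box_boundedZ.
have bG : box_bounded G by exact: box_bounded_sum.
have GE p : G p = (4 / 3) ^+ 4 * weight p.1 * ((4 / 3) ^+ 4 * weight p.2) * Q (dir (X p)).
  rewrite /G /Q trig_sqrE mulr_sumr; apply: eq_bigr => i _; rewrite mulr_sumr.
  apply: eq_bigr => j _; rewrite /F (exprD _ 4 4).
  by move: (weight p.1) (weight p.2) => u1 u2; ring.
have w0 (y : R) : 0 <= (4 / 3) ^+ 4 * weight y by rewrite mulr_ge0 ?weight_ge0// exprn_ge0.
apply: (@le_trans _ _ (box G)%:E); last first.
  rewrite lee_fin box_sum//.
  have -> : (4 / 3) ^+ 8 * (C * S) = \sum_i \sum_j ((4 / 3) ^+ 8 * (`|b i| * `|b j|)) *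
     (C / (1 + r * (`|c1 i j| + `|c2 i j|)) ^+ 4).
    rewrite mulrA mulr_sumr; apply: eq_bigr => i _; rewrite mulr_sumr.
    by apply: eq_bigr => j _; ring.
  apply: ler_sum => i _; rewrite box_sum; last by move=> j; exact: box_boundedZ.
  apply: ler_sum => j _; rewrite boxZ//.
  (* Pairs with zero coefficient are discarded first: the comparison [hP] is assumed only for the
     others. *)
  have [b0|b0] := eqVneq (b i * b j) 0.
    by rewrite b0 mulr0 mul0r -normrM b0 normr0 mulr0 mul0r.
  apply: le_trans (ler_norm _) _; rewrite normrM normrM (ger0_norm q0) normrM.
  rewrite ler_wpM2l ?mulr_ge0//.
  have -> : box (F i j) = int (fun y2 => int (fun y1 => weight y2 * weight y1 *
      cos (r * dotp (dir (x + y2 *: (kap *: V2) + y1 *: (kap *: V1))) (P i - P j) + 0))).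
    by apply: eq_Rintegral => y2 _; apply: eq_Rintegral => y1 _; rewrite /F dotpZl addr0.
  exact: (hK r 0 (c1 i j) (c2 i j) x (P i - P j) r0 (hP i j b0) x12 xV1 xV2).
have [mG [MG hMG]] := bG.
rewrite /box -(box_EFin mG hMG).
have mg1 (y2 : R) : measurable_fun [set: measurableTypeR R] (fun y1 : R => h (X (y2, y1))).
  exact: (measurableT_comp mhX (measurable_pair1 y2)).
have mgi : measurable_fun [set: measurableTypeR R] (fun y2 : R => (\int[mu]_(y1 in `[(- 2^-1)%R, (2^-1)%R]) h (X (y2, y1)))%E).
  have ms := measurable_smear (kap *: V1) mh h0.
  exact: (measurableT_comp ms (measurableT_comp (measurable_shift (kap *: V2))
    (measurable_pair1 x))).
apply: le_trans (ge0_integral_weight_le mgi _) _.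
  by move=> y2; exact: integral_ge0.
apply: ge0_le_integral => //.
- by move=> y2 _; apply: mule_ge0; rewrite ?lee_fin//; exact: integral_ge0.
- apply: measurable_funTS; apply: emeasurable_funM => //; apply/measurable_EFinP.
  by apply: measurable_funM => //; exact: measurable_weight.
- apply: (eq_measurable_fun (EFin \o (fun y2 => \int[mu]_(y1 in `[(-1)%R, 1%R]) G (y2, y1)))).
    move=> y2 /set_mem; rewrite /= in_itv /= => h2.
    by rewrite /Rintegral fineK//; exact: (integrable_fin_num _ (box_section_integrable mG hMG h2)).
  exact: (measurable_int mu (box_outer_integrable mG hMG)).
move=> y2 _.
apply: le_trans (lee_wpmul2l _ (ge0_integral_weight_le (mg1 y2) _)) _ => //.
  by rewrite lee_fin.
rewrite -ge0_integralZl_EFin//; last 2 first.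
- by move=> y1 _; apply: mule_ge0; [rewrite lee_fin; exact: w0|exact: h0].
- apply: measurable_funTS; apply: emeasurable_funM => //; apply/measurable_EFinP.
  by apply: measurable_funM => //; exact: measurable_weight.
rewrite le_eqVlt; apply/orP; left; apply/eqP; apply: eq_integral => y1 _.
by rewrite GE /h -!EFinM mulrA.
Qed.

End quadratic.

(** * Exponential sums along sample points *)

Section discrete.
Context {R : realType} {n : nat}.
Implicit Types (a : nat -> R) (g : nat -> 'rV[R]_n).

(** Each unordered pair is kept once, in increasing order, where the sum and the squared gap
    determine the pair; the diagonal is treated apart. *)
Definition pair_coef M a (p : 'I_M * 'I_M) : R :=
  if (p.1 < p.2)%N then a p.1 * a p.2 else 0.

Definition pair_freq M g (p : 'I_M * 'I_M) : 'rV[R]_n := g p.1 + g p.2.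

Lemma sum_sym_pairs M (f : 'I_M -> 'I_M -> R) : (forall k l, f k l = f l k) ->
  \sum_k \sum_l f k l = \sum_k f k k +
    2 * \sum_(p : 'I_M * 'I_M | (p.1 < p.2)%N) f p.1 p.2.
Proof.
move=> fs.
rewrite -(pair_big_dep (fun=> true) (fun k l : 'I_M => (k < l)%N) (fun k l : 'I_M => f k l))/=.
have E k : \sum_l f k l = f k k + (\sum_(l < M | (k < l)%N) f k l + \sum_(l < M | (l < k)%N) f k l).
  rewrite (bigD1 k)//=; congr (_ + _); rewrite (bigID (fun l : 'I_M => (k < l)%N))/=.
  congr (_ + _); apply: eq_bigl => l.
    by rewrite andb_idl// => kl; rewrite -val_eqE gtn_eqF.
  by rewrite -leqNgt -val_eqE andbC ltn_neqAle andbC.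
rewrite (eq_bigr _ (fun k _ => E k)) !big_split /=; congr (_ + _).
have -> : \sum_(k < M) \sum_(l < M | (l < k)%N) f k l = \sum_(k < M) \sum_(l < M | (k < l)%N) f k l.
  rewrite (exchange_big_dep (fun=> true))//=; apply: eq_bigr => k _.
  by apply: eq_bigr => l _; exact: fs.
ring.
Qed.

(** The fourth power is the squared modulus of the square of the sum, and that square is twice the
    sum over increasing pairs plus a diagonal whose real and imaginary parts are at most
    [M%:R * A ^+ 2]. *)
Lemma trig_sqr_sqr_le M a g (A : R) xi : (forall k, `|a k| <= A) ->
  trig_sqr (fun k : 'I_M => a k) (fun k => g k) xi ^+ 2 <=
  8 * trig_sqr (@pair_coef M a) (@pair_freq M g) xi + 4 * (M%:R * A ^+ 2) ^+ 2.
Proof.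
move=> aA; rewrite /trig_sqr.
pose ph k := dotp xi (g k).
set c := \sum_i _; set s := \sum_i _; set H1 := \sum_i _; set H2 := \sum_i _.
have key (u : R -> R) : (forall x, `|u x| <= 1) -> exists D,
    \sum_(k < M) \sum_(l < M) a k * a l * u (ph k + ph l) =
      D + 2 * \sum_p @pair_coef M a p * u (dotp xi (pair_freq g p)) /\ `|D| <= M%:R * A ^+ 2.
  move=> u1; exists (\sum_(k < M) a k * a k * u (ph k + ph k)); split.
    rewrite (sum_sym_pairs (f := fun k l : 'I_M => a k * a l * u (ph k + ph l))); last first.
      by move=> k l; rewrite [a k * _]mulrC [ph k + _]addrC.
    congr (_ + 2 * _); rewrite big_mkcond; apply: eq_bigr => p _.
    by rewrite /pair_coef /pair_freq dotpDr; case: ifP => //; rewrite mul0r.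
  apply: le_trans (ler_norm_sum _ _ _) _.
  apply: (@le_trans _ _ (\sum_(k < M) A ^+ 2)); last by rewrite sumr_const card_ord mulr_natl.
  apply: ler_sum => k _; rewrite normrM normrM -[leRHS]mulr1 expr2.
  by rewrite ler_pM ?mulr_ge0// ler_pM.
have cos1 (x : R) : `|cos x| <= 1 by rewrite ler_norml cos_geN1 cos_le1.
have sin1 (x : R) : `|sin x| <= 1 by rewrite ler_norml sin_geN1 sin_le1.
have [d1 [E1 D1]] := key cos cos1.
have [d2 [E2 D2]] := key sin sin1.
have X : c ^+ 2 - s ^+ 2 = \sum_(k < M) \sum_(l < M) a k * a l * cos (ph k + ph l).
  rewrite /c /s !expr2 !big_distrl /= -sumrB; apply: eq_bigr => k _.
  rewrite !big_distrr -sumrB; apply: eq_bigr => l _ /=.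
  by rewrite -!/(ph _) cosD; ring.
have Y : 2 * c * s = \sum_(k < M) \sum_(l < M) a k * a l * sin (ph k + ph l).
  have -> : 2 * c * s = c * s + s * c by ring.
  rewrite /c /s !big_distrl /= -big_split; apply: eq_bigr => k _ /=.
  rewrite !big_distrr -big_split; apply: eq_bigr => l _ /=.
  by rewrite -!/(ph _) sinD; ring.
move: X Y; rewrite E1 E2 -/H1 -/H2.
set m := M%:R * _ in D1 D2 *.
have sq (d : R) : `|d| <= m -> d ^+ 2 <= m ^+ 2.
  by move=> h; rewrite -real_normK ?num_real// ler_pXn2r// nnegrE// (le_trans _ h).
have := sq _ D1; have := sq _ D2.
have -> : (c ^+ 2 + s ^+ 2) ^+ 2 = (c ^+ 2 - s ^+ 2) ^+ 2 + (2 * c * s) ^+ 2 by ring.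
move=> q2 q1 -> ->.
have := sqr_ge0 (d1 - 2 * H1); have := sqr_ge0 (d2 - 2 * H2).
move: q1 q2; clear.
move: (m ^+ 2) => m2; rewrite !expr2; lra.
Qed.

Variables V1 V2 : 'rV[R]_n.
Hypothesis gram_gt0 : 0 < dotp V1 V1 * dotp V2 V2 - dotp V1 V2 ^+ 2.

Lemma decay4_le2 (x : R) : 0 <= x -> ((1 + x) ^+ 4)^-1 <= ((1 + x) ^+ 2)^-1.
Proof.
move=> x0; have x1 : 1 <= 1 + x by rewrite lerDl.
by rewrite lef_pV2 ?posrE ?exprn_gt0 ?(lt_le_trans ltr01)// ler_weXn2l.
Qed.

(** Splits fourth-order decay in a sum of two variables into second-order decay in each, which is
    still summable. *)
Lemma decay4_le22 (x y : R) : 0 <= x -> 0 <= y ->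
  ((1 + (x + y)) ^+ 4)^-1 <= ((1 + x) ^+ 2)^-1 * ((1 + y) ^+ 2)^-1.
Proof.
move=> x0 y0; rewrite -invfM.
have xp : 0 < 1 + x by rewrite ltr_pwDl.
have yp : 0 < 1 + y by rewrite ltr_pwDl.
have xyp : 0 < 1 + (x + y) by rewrite ltr_pwDl// addr_ge0.
rewrite lef_pV2 ?posrE ?mulr_gt0 ?exprn_gt0// (exprD _ 2 2).
by apply: ler_pM; rewrite ?exprn_ge0 ?(ltW xp) ?(ltW yp)// ler_pXn2r ?nnegrE ?(ltW xp) ?(ltW yp) ?(ltW xyp)// lerD2l ?lerDl ?lerDr.
Qed.

(** Two instances of [cap_trig_sqr_le]: the sample points, with differences along [V1], and the
    increasing pairs, with differences along [V1] and [V2] governed by the sum and by the squared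
    half gap. The conditions on [r * L] and [r * L ^+ 2] say that the sampling is finer than the
    wavelength in both variables. *)
Lemma cap_discrete_le : (0 < n)%N -> exists c0 eta C : R, [/\ 0 < c0, 0 < eta, 0 <= C &
  forall (M : nat) (L A r : R) a g (t : nat -> R), (0 < M)%N -> 0 < L -> 0 < r ->
  2 * (r * L) <= M%:R -> r * L ^+ 2 <= 2 * M%:R ->
  (forall k, `|a k| <= A) -> (forall k, t k = L * k%:R / M%:R) ->
  (forall k l, (k < M)%N -> (l < M)%N ->
    enorm (g k - g l - (t k - t l) *: V1) <= eta * `|t k - t l|) ->
  (forall k l k' l', (k < l < M)%N -> (k' < l' < M)%N ->
    let c1 := (t k + t l) - (t k' + t l') in
    let c2 := ((t l - t k) ^+ 2 - (t l' - t k') ^+ 2) / 4 in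
    enorm (g k + g l - (g k' + g l') - (c1 *: V1 + c2 *: V2)) <= eta * (`|c1| + `|c2|)) ->
  (\int[surface_measure]_w (\1_(cap V1 V2 c0) w *
      trig_sqr (fun k : 'I_M => a k) (fun k => g k) (r *: w))%:E <=
    (C * (A ^+ 2 * M%:R ^+ 2) / (r * L))%:E)%E /\
  (\int[surface_measure]_w (\1_(cap V1 V2 c0) w *
      trig_sqr (@pair_coef M a) (@pair_freq M g) (r *: w))%:E <=
    (C * (A ^+ 4 * M%:R ^+ 4) * (1 + ln M%:R) / (r ^+ 2 * L ^+ 3))%:E)%E].
Proof.
move=> n0; have [c0 [eta [C [c00 eta0 C0 hC]]]] := cap_trig_sqr_le gram_gt0 n0.
exists c0, eta, (64 * C); split => //; first by rewrite mulr_ge0.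
move=> M L A r a g t M0 L0 r0 rM1 rM2 aA tE h1 h2.
have A0 : 0 <= A := le_trans (normr_ge0 _) (aA 0%N).
have MR : 0 < M%:R :> R by rewrite ltr0n.
(* Frequencies in index units: [t] is [L / M%:R] times the index, and the squared half gap is
   [L ^+ 2 / (4 * M%:R ^+ 2)] times the squared index gap. *)
pose rho := r * L / M%:R; pose rho2 := r * L ^+ 2 / (4 * M%:R ^+ 2).
have rho0 : 0 < rho by rewrite divr_gt0// mulr_gt0.
have rho20 : 0 < rho2 by rewrite divr_gt0 ?mulr_gt0// exprn_gt0.
have rho1 : 2 * rho <= 1 by rewrite /rho mulrA ler_pdivrMr// mul1r.
have rho21 : rho2 * (2 * M%:R) <= 1.
  rewrite (_ : rho2 * _ = r * L ^+ 2 / (2 * M%:R)); last by rewrite /rho2; field; rewrite gt_eqF.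
  by rewrite ler_pdivrMr ?mulr_gt0// mul1r.
split.
- apply: le_trans (hC 'I_M (fun k => a k) (fun k => g k) (fun k l => t k - t l) (fun _ _ => 0) r r0 _) _.
    by move=> k l _; rewrite scale0r addr0 normr0 addr0; exact: h1.
  rewrite lee_fin.
  apply: (@le_trans _ _ (C * (\sum_(k < M) A ^+ 2 * (4 / rho)))).
    rewrite ler_wpM2l//; apply: ler_sum => k _.
    apply: (@le_trans _ _ (\sum_(l < M) A ^+ 2 * ((1 + rho * `|k%:R - (1 * l)%:R|) ^+ 2)^-1)).
      apply: ler_sum => l _; rewrite normr0 addr0 ler_pM ?mulr_ge0 ?invr_ge0 ?exprn_ge0//.
      - by rewrite addr_ge0// mulr_ge0// ltW.
      - by rewrite expr2 ler_pM.
      have -> : rho * `|k%:R - (1 * l)%:R| = r * `|t k - t l|.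
        rewrite mul1n !tE (_ : L * k%:R / M%:R - _ = L / M%:R * (k%:R - l%:R)); last by ring.
        by rewrite normrM (gtr0_norm (divr_gt0 L0 MR)) /rho; ring.
      by apply: decay4_le2; rewrite mulr_ge0// ltW.
    rewrite -mulr_sumr ler_wpM2l ?exprn_ge0//.
    rewrite -(big_mkord (fun=> true) (fun l => ((1 + rho * `|k%:R - (1 * l)%:R|) ^+ 2)^-1)).
    by apply: sum_linear_decay => //; lra.
  rewrite sumr_const card_ord -mulr_natl.
  rewrite (_ : C * _ = 4 * C * (A ^+ 2 * M%:R ^+ 2) / (r * L)); last first.
    by rewrite /rho; field; rewrite !gt_eqF.
  rewrite ler_wpM2r ?invr_ge0 ?mulr_ge0 ?(ltW r0) ?(ltW L0)//.
  rewrite ler_wpM2r ?mulr_ge0 ?exprn_ge0//; lra.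
pose c1 (p q : 'I_M * 'I_M) := (t p.1 + t p.2) - (t q.1 + t q.2).
pose c2 (p q : 'I_M * 'I_M) := ((t p.2 - t p.1) ^+ 2 - (t q.2 - t q.1) ^+ 2) / 4.
apply: le_trans (hC ('I_M * 'I_M)%type (@pair_coef M a) (@pair_freq M g) c1 c2 r r0 _) _.
  move=> p q; rewrite /pair_coef; case: ifP => hp; last by rewrite mul0r eqxx.
  case: ifP => hq; last by rewrite mulr0 eqxx.
  by move=> _; apply: h2; rewrite ?hp ?hq ltn_ord.
rewrite lee_fin.
pose K (p q : 'I_M * 'I_M) : R := (((1 + rho * `|(p.1%:R + p.2%:R) - (q.1%:R + q.2%:R)|) ^+ 2)^-1 *
     ((1 + rho2 * `|(p.2%:R - p.1%:R) ^+ 2 - (q.2%:R - q.1%:R) ^+ 2|) ^+ 2)^-1).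
have K0 p q : 0 <= K p q.
  by rewrite mulr_ge0 ?invr_ge0 ?exprn_ge0// addr_ge0// mulr_ge0// ltW.
have pc p : `|@pair_coef M a p| <= (if (p.1 < p.2)%N then A ^+ 2 else 0).
  by rewrite /pair_coef; case: ifP; rewrite ?normr0// normrM expr2 => _; rewrite ler_pM.
apply: (@le_trans _ _ (C * (\sum_(p : 'I_M * 'I_M | (p.1 < p.2)%N) \sum_(q : 'I_M * 'I_M | (q.1 < q.2)%N)
    A ^+ 4 * K p q))).
  rewrite ler_wpM2l// [leRHS]big_mkcond; apply: ler_sum => p _.
  have := pc p; case: ifP => hp pc1; last first.
    rewrite big1// => q _; have -> : pair_coef a p = 0 by apply/normr0_eq0/le_anti; rewrite pc1/=.
    by rewrite normr0 !mul0r.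
  rewrite [leRHS]big_mkcond; apply: ler_sum => q _.
  have := pc q; case: ifP => hq pc2; last first.
    have -> : pair_coef a q = 0 by apply/normr0_eq0/le_anti; rewrite pc2/=.
    by rewrite normr0 mulr0 mul0r.
  rewrite ler_pM ?mulr_ge0 ?invr_ge0 ?exprn_ge0//.
  - by rewrite addr_ge0// mulr_ge0 ?addr_ge0// ltW.
  - by rewrite (exprD _ 2 2) ler_pM.
  rewrite mulrDr.
  have -> : r * `|c1 p q| = rho * `|(p.1%:R + p.2%:R) - (q.1%:R + q.2%:R)|.
    rewrite /c1 !tE (_ : _ - _ = L / M%:R * ((p.1%:R + p.2%:R) - (q.1%:R + q.2%:R))); last by ring.
    by rewrite normrM (gtr0_norm (divr_gt0 L0 MR)) /rho; ring.
  have -> : r * `|c2 p q| = rho2 * `|(p.2%:R - p.1%:R) ^+ 2 - (q.2%:R - q.1%:R) ^+ 2|.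
    rewrite /c2 !tE (_ : _ / 4 = L ^+ 2 / (4 * M%:R ^+ 2) *
      ((p.2%:R - p.1%:R) ^+ 2 - (q.2%:R - q.1%:R) ^+ 2)); last by field; rewrite gt_eqF.
    rewrite normrM gtr0_norm ?divr_gt0 ?mulr_gt0 ?exprn_gt0// /rho2; ring.
  by apply: decay4_le22; rewrite mulr_ge0// ltW.
have := sum_pair_le rho0 rho20 rho1 rho21 M0.
have -> : \sum_(p : 'I_M * 'I_M | (p.1 < p.2)%N) \sum_(q : 'I_M * 'I_M | (q.1 < q.2)%N) A ^+ 4 * K p q
  = A ^+ 4 * \sum_(p : 'I_M * 'I_M | (p.1 < p.2)%N) \sum_(q : 'I_M * 'I_M | (q.1 < q.2)%N) K p q.
  by rewrite mulr_sumr; apply: eq_bigr => p _; rewrite mulr_sumr.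
rewrite -/(K _ _) => hS.
apply: (le_trans (ler_wpM2l C0 (ler_wpM2l (exprn_ge0 4 A0) hS))).
rewrite le_eqVlt; apply/orP; left; apply/eqP; rewrite /rho /rho2; field.
by rewrite !gt_eqF.
Qed.

End discrete.

(** * Second-order expansion of phases, van der Corput estimates *)

Section mean_value.
Context {R : realType}.
Implicit Types (f F G : R -> R) (a b : R).

(** Monotonicity of [G - F] and of [G + F]. Comparing with a function [G] rather than a constant is
    what integrates the bound [eps * (2 * x)] in [fixed_mid]. *)
Lemma mvt_le a b F F' G G' : a <= b ->
  (forall x : R, a <= x <= b -> is_derive x 1 F (F' x)) ->
  (forall x : R, a <= x <= b -> is_derive x 1 G (G' x)) ->
  (forall x : R, a <= x <= b -> `|F' x| <= G' x) ->
  `|F b - F a| <= G b - G a.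
Proof.
rewrite le_eqVlt => /predU1P[->|ab] dF dG FG; first by rewrite !subrr normr0.
have key (H H' : R -> R) : (forall x : R, a <= x <= b -> is_derive x 1 H (H' x)) ->
    (forall x : R, a <= x <= b -> 0 <= H' x) -> H a <= H b.
  move=> dH H0.
  have dH' : forall x : R, x \in `]a, b[%R -> is_derive x 1 H (H' x).
    by move=> x; rewrite in_itv/= => /andP[h1 h2]; apply: dH; rewrite !ltW.
  have cH : cont_on a b H by apply: cont_on_for => x xab; exact: (isder_cont (dH x xab)).
  have [c cab E] := MVT ab dH' cH.
  rewrite -subr_ge0 E mulr_ge0 ?subr_ge0 ?(ltW ab)// H0//.
  by move: cab; rewrite in_itv/= => /andP[h1 h2]; rewrite !ltW.
have h1 : G a - F a <= G b - F b.
  apply: (key (fun x => G x - F x) (fun x => G' x - F' x)) => x xab.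
    exact: isder_sub (dG x xab) (dF x xab).
  by move: (FG x xab); rewrite ler_norml => /andP[]; lra.
have h2 : G a + F a <= G b + F b.
  apply: (key (fun x => G x + F x) (fun x => G' x + F' x)) => x xab.
    exact: isder_add (dG x xab) (dF x xab).
  by move: (FG x xab); rewrite ler_norml => /andP[]; lra.
by rewrite ler_norml; apply/andP; split; lra.
Qed.

End mean_value.

Section pair_sums.
Context {R : realType}.
Variables (c e : R) (f f1 f2 : R -> R) (v1 v2 eps : R).
Hypothesis df : forall t : R, c <= t <= e -> is_derive t 1 f (f1 t).
Hypothesis df1 : forall t : R, c <= t <= e -> is_derive t 1 f1 (f2 t).
Hypothesis f1v : forall t : R, c <= t <= e -> `|f1 t - v1| <= eps.
Hypothesis f2v : forall t : R, c <= t <= e -> `|f2 t - v2| <= eps.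

Lemma increment_approx (s t : R) : c <= s <= e -> c <= t <= e ->
  `|f t - f s - (t - s) * v1| <= eps * `|t - s|.
Proof.
wlog st : s t / s <= t.
  move=> h hs ht; have [st|/ltW ts] := leP s t; first exact: h.
  have := h t s ts ht hs; rewrite distrC [`|s - t|]distrC; congr (`|_| <= _); ring.
move=> /andP[s1 s2] /andP[t1 t2]; rewrite (ger0_norm (_ : 0 <= t - s)) ?subr_ge0//.
have dF (x : R) : s <= x <= t -> is_derive x 1 (fun y => f y - y * v1) (f1 x - v1).
  move=> /andP[x1 x2]; have xc : c <= x <= e by rewrite (le_trans s1)// (le_trans x2).
  apply: is_derive_eq (isder_sub (df xc) (isder_mul (isder_id x) (isder_cst x v1))) _.
  by ring.
have dG (x : R) : s <= x <= t -> is_derive x 1 (fun y => eps * y) eps.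
  move=> _; apply: is_derive_eq (isder_mul (isder_cst x eps) (isder_id x)) _.
  by ring.
have := mvt_le st dF dG; rewrite -mulrBr.
have -> : f t - t * v1 - (f s - s * v1) = f t - f s - (t - s) * v1 by ring.
apply=> x /andP[x1 x2]; apply: f1v; rewrite (le_trans s1)// (le_trans x2)//.
Qed.

(* With [m] the midpoint and [h] the half gap of a pair, [f (m + h) + f (m - h)]
   is, up to [eps], the linear form [2 m v1 + h ^ 2 v2] in [m] and [h ^ 2]. *)
Let fixed_mid (m h h' : R) : 0 <= h' -> h' <= h -> c <= m - h -> m + h <= e ->
  `|f (m + h) + f (m - h) - (f (m + h') + f (m - h')) - (h ^+ 2 - h' ^+ 2) * v2|
    <= eps * (h ^+ 2 - h' ^+ 2).
Proof.
move=> h'0 h'h m1 m2.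
pose F x := f (m + x) + f (m - x) - x ^+ 2 * v2.
pose F' x := f1 (m + x) - f1 (m - x) - 2 * x * v2.
have dF (x : R) : h' <= x <= h -> is_derive x 1 F (F' x).
  move=> /andP[x1 x2].
  have p1 : is_derive (m + x) 1 f (f1 (m + x)) by apply: df; apply/andP; split; lra.
  have p2 : is_derive (m - x) 1 f (f1 (m - x)) by apply: df; apply/andP; split; lra.
  have q1 := isder_comp p1 (isder_add (isder_cst x m) (isder_id x)).
  have q2 := @isder_comp _ f (fun y => m - y) x _ _ p2 (isder_sub (isder_cst x m) (isder_id x)).
  have q3 := isder_mul (isder_pow 1 (isder_id x)) (isder_cst x v2).
  apply: is_derive_eq (isder_sub (isder_add q1 q2) q3) _.
  by rewrite /F'; ring.
have dG (x : R) : h' <= x <= h -> is_derive x 1 (fun y => eps * y ^+ 2) (eps * (2 * x)).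
  move=> _; apply: is_derive_eq (isder_mul (isder_cst x eps) (isder_pow 1 (isder_id x))) _.
  by ring.
have := mvt_le h'h dF dG; rewrite -mulrBr /F.
have -> : f (m + h) + f (m - h) - h ^+ 2 * v2 - (f (m + h') + f (m - h') - h' ^+ 2 * v2) =
  f (m + h) + f (m - h) - (f (m + h') + f (m - h')) - (h ^+ 2 - h' ^+ 2) * v2 by ring.
apply=> x /andP[x1 x2].
have dF1 (y : R) : m - x <= y <= m + x -> is_derive y 1 (fun z => f1 z - z * v2) (f2 y - v2).
  move=> /andP[y1 y2]; have yc : c <= y <= e by apply/andP; split; lra.
  apply: is_derive_eq (isder_sub (df1 yc) (isder_mul (isder_id y) (isder_cst y v2))) _.
  by ring.
have dG1 (y : R) : m - x <= y <= m + x -> is_derive y 1 (fun z => eps * z) eps.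
  move=> _; apply: is_derive_eq (isder_mul (isder_cst y eps) (isder_id y)) _.
  by ring.
have mx : m - x <= m + x by lra.
have := mvt_le mx dF1 dG1; rewrite -mulrBr.
have -> : f1 (m + x) - (m + x) * v2 - (f1 (m - x) - (m - x) * v2) = F' x by rewrite /F'; ring.
have -> : m + x - (m - x) = 2 * x by ring.
apply=> y /andP[y1 y2]; apply: f2v; apply/andP; split; lra.
Qed.

(** The pair is moved in two stages: the midpoint at fixed half gap [h'], with an error proportional
    to [c1], then the half gap at fixed midpoint, with an error proportional to [c2]. An error of
    the form [eps * |h - h'|] would not do: for short gaps it is not bounded by [eps * |c2|]. *)
Lemma pair_sum_approx (s t s' t' c1 c2 : R) :
  c <= s -> s <= t -> t <= e -> c <= s' -> s' <= t' -> t' <= e ->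
  c1 = (s + t) - (s' + t') -> c2 = ((t - s) ^+ 2 - (t' - s') ^+ 2) / 4 ->
  `|f s + f t - (f s' + f t') - (c1 * v1 + c2 * v2)| <= eps * (`|c1| + `|c2|).
Proof.
(* With the smaller gap second, the intermediate points [m - h'] and [m + h'] stay between [s] and
   [t]. *)
wlog hh : s t s' t' c1 c2 / t' - s' <= t - s.
  move=> h cs st te cs' st' te' c1E c2E; have [hh|/ltW hh] := leP (t' - s') (t - s).
    exact: (h s t s' t' c1 c2 hh).
  have := h s' t' s t (- c1) (- c2) hh cs' st' te' cs st te.
  rewrite c1E c2E !normrN => H; apply: (le_trans _ (H _ _)); [|by ring..].
  rewrite le_eqVlt; apply/orP; left; apply/eqP; rewrite -[RHS]normrN; congr (`|_|).
  by ring.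
move=> cs st te cs' st' te' c1E c2E.
pose m := (s + t) / 2; pose h := (t - s) / 2; pose m' := (s' + t') / 2; pose h' := (t' - s') / 2.
have -> : s = m - h by rewrite /m /h; field.
have -> : t = m + h by rewrite /m /h; field.
have E1 : s' = m' - h' by rewrite /m' /h'; field.
have E2 : t' = m' + h' by rewrite /m' /h'; field.
rewrite E1 E2.
have h'0 : 0 <= h' by rewrite /h'; lra.
have h'h : h' <= h by rewrite /h' /h; lra.
have i1 : c <= m - h by rewrite (_ : m - h = s)// /m /h; field.
have i2 : m + h <= e by rewrite (_ : m + h = t)// /m /h; field.
have i3 : c <= m' - h' by rewrite -E1.
have i4 : m' + h' <= e by rewrite -E2.
have A1 := fixed_mid h'0 h'h i1 i2.
have A2 : `|f (m + h') - f (m' + h') - ((m + h') - (m' + h')) * v1| <= eps * `|(m + h') - (m' + h')|.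
  by apply: increment_approx; apply/andP; split; lra.
have A3 : `|f (m - h') - f (m' - h') - ((m - h') - (m' - h')) * v1| <= eps * `|(m - h') - (m' - h')|.
  by apply: increment_approx; apply/andP; split; lra.
have mm : c1 = 2 * (m - m') by rewrite c1E /m /m'; field.
have {}c2E : c2 = h ^+ 2 - h' ^+ 2 by rewrite c2E /h /h'; field.
have c20 : 0 <= c2 by rewrite c2E subr_ge0 ler_pXn2r// nnegrE; lra.
have B2 : (m + h') - (m' + h') = m - m' by ring.
have B3 : (m - h') - (m' - h') = m - m' by ring.
rewrite B2 in A2; rewrite B3 in A3.
rewrite (ger0_norm c20) mm normrM (ger0_norm (_ : 0 <= 2))//.
rewrite c2E; move: A1 A2 A3; set D := h ^+ 2 - _; move=> A1 A2 A3.
have -> : f (m - h) + f (m + h) - (f (m' - h') + f (m' + h')) - (2 * (m - m') * v1 + D * v2) =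
  (f (m + h) + f (m - h) - (f (m + h') + f (m - h')) - D * v2) +
  ((f (m + h') - f (m' + h') - (m - m') * v1) + (f (m - h') - f (m' - h') - (m - m') * v1)) by ring.
apply: le_trans (ler_normD _ _) _; apply: le_trans (lerD (lexx _) (ler_normD _ _)) _.
by move: A1 A2 A3; clear; lra.
Qed.

End pair_sums.

(** * Derivative tests for oscillatory integrals, and Riemann sums *)

Section stationary_phase.
Context {R : realType}.
Local Notation mu := (@lebesgue_measure R).
Local Notation int a b f := (\int[mu]_(x in `[a, b]) f x)%R.
Implicit Types (f chi : R -> R).

(** One integration by parts. The integral of [|f2| / f1 ^+ 2] is left as the parameter [Kq] because
    it is bounded in two ways: by its size when [f1] has a fixed lower bound, and by exact
    integration when [f1] is monotone. *)
Lemma nonstationary_le (c e : R) (f f1 f2 chi chi1 : R -> R) (X X1 del Kq r al : R) :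
  c <= e -> 0 < r -> 0 < del ->
  (forall t : R, c <= t <= e -> is_derive t 1 f (f1 t)) ->
  (forall t : R, c <= t <= e -> is_derive t 1 f1 (f2 t)) ->
  (forall t : R, c <= t <= e -> {for t, continuous f2}) ->
  (forall t : R, c <= t <= e -> is_derive t 1 chi (chi1 t)) ->
  (forall t : R, c <= t <= e -> {for t, continuous chi1}) ->
  (forall t : R, c <= t <= e -> `|chi t| <= X) ->
  (forall t : R, c <= t <= e -> `|chi1 t| <= X1) ->
  (forall t : R, c <= t <= e -> del <= `|f1 t|) ->
  int c e (fun t => `|f2 t| * (f1 t)^-1 ^+ 2) <= Kq ->
  `|int c e (fun t => chi t * cos (r * f t + al))| <=
    (2 * X / del + X1 / del * (e - c) + X * Kq) / r.
Proof.
move=> ce r0 del0 df df1 cf2 dchi cchi1 chiX chiX1 f1del hKq.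
have f10 t : c <= t <= e -> f1 t != 0.
  by move=> /f1del h; rewrite -normr_gt0 (lt_le_trans del0).
pose q t := (f1 t)^-1.
have qdel t : c <= t <= e -> `|q t| <= del^-1.
  by move=> h; rewrite normfV lef_pV2 ?posrE ?f1del// normr_gt0 f10.
pose F t := chi t * q t * sin (r * f t + al).
pose g1 t := chi t * cos (r * f t + al).
pose g2 t := (chi1 t * q t + chi t * (- f2 t * q t * q t)) * sin (r * f t + al).
have dF t : c <= t <= e -> is_derive t 1 F (r * g1 t + g2 t).
  move=> tce.
  have dl : is_derive t 1 (fun t => r * f t + al) (r * f1 t).
    apply: is_derive_eq (isder_add (isder_mul (isder_cst t r) (df t tce)) (isder_cst t al)) _.
    by ring.
  have ds := @isder_comp _ sin (fun t => r * f t + al) t _ _ (is_derive_sin _) dl.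
  have dq := isder_inv (df1 t tce) (f10 t tce).
  apply: is_derive_eq (isder_mul (isder_mul (dchi t tce) dq) ds) _.
  rewrite /g1 /g2 /q; move: (f10 t tce); move: (f1 t) (f2 t) (chi t) (chi1 t) (cos _) (sin _).
  by move=> a1 a2 b1 b2 C S a10; field.
have cc h : (forall t, c <= t <= e -> {for t, continuous h}) -> cont_on c e h by exact: cont_on_for.
have cchi : cont_on c e chi by apply: cc => t h; exact: (isder_cont (dchi t h)).
have cf : cont_on c e f by apply: cc => t h; exact: (isder_cont (df t h)).
have cq : cont_on c e q.
  by apply: cc => t h; exact: (isder_cont (isder_inv (df1 t h) (f10 t h))).
have clin : cont_on c e (fun t => r * f t + al).
  by apply: cont_onD; [apply: cont_onM => //|]; exact: cont_on_cst.
have cg1 : cont_on c e g1.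
  by apply: cont_onM => //; apply: cont_on_comp => //; exact: continuous_cos.
have cf2' := cc _ cf2; have cchi1' := cc _ cchi1.
have cu : cont_on c e (fun t => chi t * (- f2 t * q t * q t)).
  apply: cont_onM => //; apply: cont_onM => //; apply: cont_onM => //.
  have := cont_onM (@cont_on_cst _ c e (-1)) cf2'.
  by congr cont_on; apply/funext => t; rewrite mulN1r.
have cg2 : cont_on c e g2.
  apply: cont_onM; last by apply: cont_on_comp => //; exact: continuous_sin.
  by apply: cont_onD => //; exact: cont_onM.
have crg1 : cont_on c e (fun t => r * g1 t) by apply: cont_onM => //; exact: cont_on_cst.
have cF : cont_on c e F by apply: cc => t h; exact: (isder_cont (dF t h)).
have dF' t : c < t < e -> is_derive t 1 F (r * g1 t + g2 t).
  by move=> /andP[h1 h2]; apply: dF; rewrite !ltW.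
have := int_deriv ce cF (cont_onD crg1 cg2) dF'.
rewrite (intD crg1 cg2) (intZ r cg1) => E.
have cabs : cont_on c e (fun t => `|f2 t| * (f1 t)^-1 ^+ 2).
  apply: cont_onM.
    by apply: cont_on_comp => //; exact: norm_continuous.
  have := cont_onM cq cq; congr cont_on; apply/funext => t; by rewrite expr2.
have X0 : 0 <= X by apply: le_trans (chiX c _); rewrite ?normr_ge0// lexx.
have g2le : `|int c e g2| <= X1 / del * (e - c) + X * Kq.
  pose B t := X1 / del + X * (`|f2 t| * (f1 t)^-1 ^+ 2).
  have cXa : cont_on c e (fun t => X * (`|f2 t| * (f1 t)^-1 ^+ 2)).
    by apply: cont_onM => //; exact: cont_on_cst.
  have cB : cont_on c e B by apply: cont_onD => //; exact: cont_on_cst.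
  apply: (@le_trans _ _ (int c e B)).
    apply: le_trans (le_normr_Rintegral _ (cont_integrable cg2)) _ => //.
    apply: le_Rintegral => //.
    - apply: (cont_integrable (f := fun t => `|g2 t|)); apply: cont_on_comp => //; exact: norm_continuous.
    - exact: cont_integrable.
    move=> t; rewrite /= in_itv/= => tce.
    rewrite normrM -[leRHS]mulr1; apply: ler_pM => //; last by rewrite ler_norml sin_geN1 sin_le1.
    apply: le_trans (ler_normD _ _) _; rewrite /B normrM; apply: lerD.
      by rewrite ler_pM ?chiX1 ?qdel.
    rewrite normrM ler_pM ?chiX// !normrM normrN -mulrA ler_wpM2l//.
    by rewrite -normrM -expr2 ger0_norm ?sqr_ge0.
  rewrite /B intD//; last exact: cont_on_cst.
  apply: lerD; last by rewrite intZ// ler_wpM2l.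
  apply: le_trans (ler_norm _) _.
  have X10 : 0 <= X1 / del.
    by rewrite divr_ge0 ?(ltW del0)//; apply: le_trans (chiX1 c _); rewrite ?normr_ge0// lexx.
  apply: int_abs_le => //; first exact: cont_on_cst.
  by move=> t _; rewrite ger0_norm.
have Fle t : c <= t <= e -> `|F t| <= X / del.
  move=> h; rewrite /F normrM -[leRHS]mulr1 normrM ler_pM ?mulr_ge0//.
    by rewrite ler_pM ?chiX ?qdel.
  by rewrite ler_norml sin_geN1 sin_le1.
rewrite -/g1 ler_pdivlMr// mulrC -(ger0_norm (ltW r0)) -normrM.
have -> : r * int c e g1 = F e - F c - int c e g2 by rewrite -E; ring.
have Fe := Fle e; have Fc := Fle c; rewrite !lexx ce in Fe Fc.
apply: le_trans (ler_normB _ _) _; apply: le_trans (lerD (ler_normB _ _) g2le) _.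
have := Fe isT; have := Fc isT; clear; lra.
Qed.

(** With [f2 >= 0] the integrand is the derivative of [- (f1)^-1], so the bound involves neither the
    length of the interval nor the size of [f2]. *)
Lemma int_inv_sqr_le (c e : R) (f1 f2 : R -> R) (del : R) : c <= e -> 0 < del ->
  (forall t : R, c <= t <= e -> is_derive t 1 f1 (f2 t)) ->
  (forall t : R, c <= t <= e -> {for t, continuous f2}) ->
  (forall t : R, c <= t <= e -> del <= `|f1 t|) ->
  (forall t : R, c <= t <= e -> 0 <= f2 t) ->
  int c e (fun t => `|f2 t| * (f1 t)^-1 ^+ 2) <= 2 / del.
Proof.
move=> ce del0 df1 cf2 f1del f20.
have f10 t : c <= t <= e -> f1 t != 0.
  by move=> /f1del h; rewrite -normr_gt0 (lt_le_trans del0).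
pose F t := -1 * (f1 t)^-1.
have dF t : c <= t <= e -> is_derive t 1 F (`|f2 t| * (f1 t)^-1 ^+ 2).
  move=> h; apply: is_derive_eq (isder_mul (isder_cst t (-1)) (isder_inv (df1 t h) (f10 t h))) _.
  by rewrite ger0_norm ?f20//; ring.
have cF : cont_on c e F by apply: cont_on_for => t h; exact: (isder_cont (dF t h)).
have cq : cont_on c e (fun t => (f1 t)^-1).
  by apply: cont_on_for => t h; exact: (isder_cont (isder_inv (df1 t h) (f10 t h))).
have cg : cont_on c e (fun t => `|f2 t| * (f1 t)^-1 ^+ 2).
  apply: cont_onM.
    apply: cont_on_comp; first exact: norm_continuous.
    exact: cont_on_for.
  have := cont_onM cq cq; congr cont_on; apply/funext => t; by rewrite expr2.
have dF' t : c < t < e -> is_derive t 1 F (`|f2 t| * (f1 t)^-1 ^+ 2).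
  by move=> /andP[h1 h2]; apply: dF; rewrite !ltW.
have := int_deriv ce cF cg dF' => ->.
have Fle t : c <= t <= e -> `|F t| <= del^-1.
  by move=> h; rewrite /F mulN1r normrN normfV lef_pV2 ?posrE ?f1del// normr_gt0 f10.
have Fe := Fle e; have Fc := Fle c; rewrite !lexx ce in Fe Fc.
apply: le_trans (ler_norm _) _; apply: le_trans (ler_normB _ _) _.
have := Fe isT; have := Fc isT; clear; lra.
Qed.

(* A monotone derivative splits the interval into two nonstationary pieces and
   the piece [`]u, v[] where the derivative is small. *)
Lemma monotone_phase_le (c e : R) (f f1 f2 chi chi1 : R -> R) (X X1 del : R) :
  c <= e -> 0 < del ->
  (forall t : R, c <= t <= e -> is_derive t 1 f (f1 t)) ->
  (forall t : R, c <= t <= e -> is_derive t 1 f1 (f2 t)) ->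
  (forall t : R, c <= t <= e -> {for t, continuous f2}) ->
  (forall t : R, c <= t <= e -> is_derive t 1 chi (chi1 t)) ->
  (forall t : R, c <= t <= e -> {for t, continuous chi1}) ->
  (forall t : R, c <= t <= e -> `|chi t| <= X) ->
  (forall t : R, c <= t <= e -> `|chi1 t| <= X1) ->
  (forall t : R, c <= t <= e -> 0 <= f2 t) ->
  exists u v, [/\ c <= u, u <= v, v <= e,
    forall t, u < t < v -> `|f1 t| <= del &
    forall r al : R, 0 < r -> `|int c e (fun t => chi t * cos (r * f t + al))| <=
      2 * (4 * X + X1 * (e - c)) / (r * del) + X * (v - u)].
Proof.
move=> ce del0 df df1 cf2 dchi cchi1 chiX chiX1 f20.
have X0 : 0 <= X by apply: le_trans (chiX c _); rewrite ?normr_ge0// lexx.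
have X10 : 0 <= X1 by apply: le_trans (chiX1 c _); rewrite ?normr_ge0// lexx.
have mono s t : c <= s -> s <= t -> t <= e -> f1 s <= f1 t.
  move=> cs st te.
  have sub x : s <= x <= t -> c <= x <= e by move=> /andP[h1 h2]; rewrite (le_trans cs)// (le_trans h2).
  have f2x (x : R) : s <= x <= t -> `|0 : R| <= f2 x by move=> /sub h; rewrite normr0 f20.
  have := mvt_le st (fun x h => isder_cst x 0) (fun x h => df1 x (sub x h)) f2x.
  by rewrite subr0 normr0 subr_ge0.
have cf1 : cont_on c e f1 by apply: cont_on_for => t h; exact: (isder_cont (df1 t h)).
(* [u] and [v] are where [f1] crosses [- del] and [del], or an endpoint of the interval when there
   is no crossing. The implications from [c < u] and [v < e] ask nothing of an outer piece reduced
   to a point. *)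
have uv : exists u v, [/\ c <= u, u <= v, v <= e, (forall t, u < t < v -> `|f1 t| <= del) &
   (c < u -> f1 u <= - del) /\ (v < e -> del <= f1 v)].
  have [h1|h1] := leP (f1 e) (- del).
    exists e, e; split => //; first by move=> t /andP[/lt_trans h/h]; rewrite ltxx.
    by split => //; rewrite ltxx.
  have [h2|h2] := leP del (f1 c).
    exists c, c; split => //; first by move=> t /andP[/lt_trans h/h]; rewrite ltxx.
    by split => //; rewrite ltxx.
  have [u [cu ue hu hu']] : exists u, [/\ c <= u, u <= e, - del <= f1 u & c < u -> f1 u <= - del].
    have [h|h] := leP (- del) (f1 c); first by exists c; rewrite ltxx.
    have [|u] := @IVT R f1 c e (- del) ce cf1.
      by rewrite ge_min le_max (ltW h) (ltW h1) orbT.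
    by rewrite /= in_itv/= => /andP[u1 u2] E; exists u; split => //; rewrite E.
  have [v [cv ve hv hv']] : exists v, [/\ c <= v, v <= e, f1 v <= del & v < e -> del <= f1 v].
    have [h|h] := leP (f1 e) del; first by exists e; rewrite ltxx.
    have [|v] := @IVT R f1 c e del ce cf1.
      by rewrite ge_min le_max (ltW h) (ltW h2) orbT.
    by rewrite /= in_itv/= => /andP[v1 v2] E; exists v; split => //; rewrite E.
  exists u, v; split => //.
    have [//|vu] := leP u v.
    have := mono v u cv (ltW vu) ue.
    have := hu' (le_lt_trans cv vu); have := hv' (lt_le_trans vu ue); lra.
  move=> t /andP[ut tv]; rewrite ler_norml; apply/andP; split.
    by apply: le_trans hu _; apply: mono => //; [exact: ltW|exact: le_trans (ltW tv) ve].
  by apply: le_trans _ hv; apply: mono => //; [exact: le_trans cu (ltW ut)|exact: ltW].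
have [u [v [cu uv' ve small [hu hv]]]] := uv.
exists u, v; split => // r al r0.
pose g t := chi t * cos (r * f t + al).
have cg : cont_on c e g.
  apply: cont_onM.
    by apply: cont_on_for => t h; exact: (isder_cont (dchi t h)).
  apply: cont_on_comp; first exact: continuous_cos.
  apply: cont_onD; last exact: cont_on_cst.
  apply: cont_onM; first exact: cont_on_cst.
  by apply: cont_on_for => t h; exact: (isder_cont (df t h)).
have ns c' e' : c <= c' -> c' <= e' -> e' <= e ->
    (c' < e' -> forall t, c' <= t <= e' -> del <= `|f1 t|) ->
    `|int c' e' g| <= (4 * X + X1 * (e - c)) / (r * del).
  move=> cc' c'e' e'e; rewrite le_eqVlt in c'e'; case/predU1P: c'e' => [<-|c'e'] big.
    rewrite set_itv1 Rintegral_set1 normr0 divr_ge0 ?addr_ge0 ?mulr_ge0 ?subr_ge0 ?(ltW r0) ?(ltW del0)//.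
  have sub x : c' <= x <= e' -> c <= x <= e.
    by move=> /andP[k1 k2]; rewrite (le_trans cc')// (le_trans k2).
  have hK := int_inv_sqr_le (ltW c'e') del0 (fun x h => df1 x (sub x h))
    (fun x h => cf2 x (sub x h)) (big c'e') (fun x h => f20 x (sub x h)).
  have := nonstationary_le al (ltW c'e') r0 del0 (fun x h => df x (sub x h))
    (fun x h => df1 x (sub x h)) (fun x h => cf2 x (sub x h)) (fun x h => dchi x (sub x h))
    (fun x h => cchi1 x (sub x h)) (fun x h => chiX x (sub x h)) (fun x h => chiX1 x (sub x h))
    (big c'e') hK.
  move=> /le_trans; apply.
  (* The boundary terms and the bound [2 / del] for the integral of [|f2| / f1 ^+ 2] each give
     [2 * X / del]. *)
  rewrite (_ : 2 * X / del + _ + _ = (4 * X + X1 * (e' - c')) / del); last by field; rewrite gt_eqF.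
  rewrite invfM [r^-1 * _]mulrC mulrA ler_wpM2r ?invr_ge0 ?(ltW r0)// ler_wpM2r ?invr_ge0 ?(ltW del0)//.
  by rewrite lerD2l ler_wpM2l// lerB.
have i1 : `|int c u g| <= (4 * X + X1 * (e - c)) / (r * del).
  apply: ns => //; first exact: le_trans uv' ve.
  move=> cu' t /andP[t1 t2]; have h : f1 t <= - del.
    by apply: le_trans (mono t u t1 t2 (le_trans uv' ve)) (hu cu').
  by rewrite ler0_norm; lra.
have i3 : `|int v e g| <= (4 * X + X1 * (e - c)) / (r * del).
  apply: ns => //; first exact: le_trans cu uv'.
  move=> ve' t /andP[t1 t2]; have h : del <= f1 t.
    by apply: le_trans (hv ve') (mono v t (le_trans cu uv') t1 t2).
  by rewrite ger0_norm; lra.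
have i2 : `|int u v g| <= X * (v - u).
  apply: int_abs_le => //; first exact: cont_onS cg.
  move=> t /andP[t1 t2]; rewrite normrM -[leRHS]mulr1 ler_pM//.
    by apply: chiX; rewrite (le_trans cu)// (le_trans t2).
  by rewrite ler_norml cos_geN1 cos_le1.
have ue := le_trans uv' ve.
rewrite -/g (int_split cu ue cg) (int_split uv' ve (cont_onS cu (lexx e) cg)).
apply: le_trans (ler_normD _ _) _; apply: le_trans (lerD i1 (ler_normD _ _)) _.
move: i2 i3; set Z := (4 * X + _) / _; set I2 := `|_|; set I3 := `|_|.
rewrite -mulrA -/Z; lra.
Qed.

Lemma riemann_sum_le (c e Lam : R) (h : R -> R) (M : nat) : c <= e -> (0 < M)%N ->
  cont_on c e h ->
  (forall s t : R, c <= s <= e -> c <= t <= e -> `|h t - h s| <= Lam * `|t - s|) ->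
  `|int c e h - (e - c) / M%:R * \sum_(k < M) h (c + (e - c) * k%:R / M%:R)|
    <= Lam * (e - c) ^+ 2 / M%:R.
Proof.
move=> ce M0 ch hL.
have MR : 0 < M%:R :> R by rewrite ltr0n.
pose d := (e - c) / M%:R.
have d0 : 0 <= d by rewrite divr_ge0 ?subr_ge0// ltW.
pose t (k : nat) := c + d * k%:R.
have tE k : c + (e - c) * k%:R / M%:R = t k by rewrite /t /d; ring.
have tS k : t k.+1 = t k + d by rewrite /t -natr1; ring.
have tc k : c <= t k by rewrite lerDl mulr_ge0.
have tM : t M = e by rewrite /t /d; field; rewrite gt_eqF.
have te k : (k <= M)%N -> t k <= e.
  by move=> kM; rewrite -tM lerD2l ler_wpM2l// ler_nat.
have key m : (m <= M)%N ->
    `|int c (t m) h - d * \sum_(k < m) h (t k)| <= m%:R * (Lam * d ^+ 2).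
  elim: m => [_|m IH mM].
    by rewrite /t mulr0 addr0 set_itv1 Rintegral_set1 big_ord0 mulr0 subrr normr0 mul0r.
  have tmS : t m <= t m.+1 by rewrite tS lerDl.
  have ctS : cont_on c (t m.+1) h := cont_onS (lexx c) (te _ mM) ch.
  rewrite (int_split (tc m) tmS ctS) big_ord_recr/=.
  have ctm : cont_on (t m) (t m.+1) h := cont_onS (tc m) (lexx _) ctS.
  have st : `|int (t m) (t m.+1) h - d * h (t m)| <= Lam * d ^+ 2.
    have E : int (t m) (t m.+1) (fun x => h x + (- h (t m))) = int (t m) (t m.+1) h - d * h (t m).
      rewrite intD//; last exact: cont_on_cst.
      have dl (x : R) : t m < x < t m.+1 -> is_derive x 1 (fun x => - h (t m) * x) (- h (t m)).
        by move=> _; apply: is_derive_eq (isder_mul (isder_cst x _) (isder_id x)) _; ring.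
      have cl : cont_on (t m) (t m.+1) (fun x => - h (t m) * x).
        apply: cont_onM; first exact: cont_on_cst.
        by apply: cont_on_for => x _; exact: (isder_cont (isder_id x)).
      have := int_deriv tmS cl (@cont_on_cst _ _ _ _) dl => ->.
      by rewrite tS; ring.
    rewrite -E (_ : Lam * d ^+ 2 = (Lam * d) * (t m.+1 - t m)); last by rewrite tS; ring.
    apply: int_abs_le => //.
      by apply: cont_onD => //; exact: cont_on_cst.
    move=> x /andP[x1 x2].
    have L0 : 0 <= Lam * `|x - t m|.
      apply: le_trans (hL (t m) x _ _); rewrite ?normr_ge0 ?tc ?te ?(ltnW mM)//.
      by rewrite (le_trans (tc m) x1) (le_trans x2) ?te.
    apply: le_trans (hL (t m) x _ _) _.
    - by rewrite tc te// ltnW.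
    - by rewrite (le_trans (tc m) x1) (le_trans x2) ?te.
    have [->|xt] := eqVneq x (t m).
      have := hL c e; rewrite !lexx ce => /(_ isT isT) hce.
      have : 0 <= Lam * `|e - c| by apply: le_trans hce.
      rewrite subrr normr0 mulr0 /d mulrA (ger0_norm (_ : 0 <= e - c)) ?subr_ge0// => ?.
      by rewrite divr_ge0// ltW.
    have xt0 : 0 < `|x - t m| by rewrite normr_gt0 subr_eq0.
    have Lam0 : 0 <= Lam by rewrite -(pmulr_lge0 _ xt0).
    rewrite ler_wpM2l// ger0_norm ?subr_ge0//; move: x2; rewrite tS; lra.
  have := IH (ltnW mM); rewrite -[in m.+1%:R * _]natr1.
  have -> : int c (t m) h + int (t m) (t m.+1) h - d * (\sum_(i < m) h (t i) + h (t m)) =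
    (int c (t m) h - d * \sum_(i < m) h (t i)) + (int (t m) (t m.+1) h - d * h (t m)) by ring.
  move=> h1; apply: le_trans (ler_normD _ _) _; move: h1 st; lra.
have := key M (leqnn M); rewrite tM.
under eq_bigr do rewrite -tE.
move=> /le_trans; apply; rewrite le_eqVlt; apply/orP; left; apply/eqP.
by rewrite /d; field; rewrite gt_eqF.
Qed.

End stationary_phase.

(** * Oscillatory integrals along a curve *)

Section local_to_global.
Context {R : realType}.
Implicit Types (a b c e : R).

(** A supremum argument in place of a finite cover: an additive property need only hold on short
    intervals around each point, with a radius and constants that may depend on the point. *)
Lemma interval_induction a b (P : R -> R -> Prop) : a <= b ->
  (forall c m e, a <= c -> c <= m -> m <= e -> e <= b -> P c m -> P m e -> P c e) ->
  (forall t, a <= t <= b -> exists2 del : R, 0 < del &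
    forall c e, a <= c -> c <= e -> e <= b -> t - del <= c -> e <= t + del -> P c e) ->
  P a b.
Proof.
move=> ab add loc.
pose A := [set x | a <= x <= b /\ P a x].
have Aa : A a.
  have [|del del0 h] := loc a; first by rewrite lexx ab.
  by split; [rewrite lexx ab | apply: h; rewrite ?lexx//; lra].
have supA : has_sup A by split; [exists a | exists b => x [/andP[]]].
pose s := sup A.
have as_ : a <= s by exact: (ub_le_sup supA.2) Aa.
have sb : s <= b by apply: ge_sup; [exists a|move=> x [/andP[]]].
have [|del del0 h] := loc s; first by rewrite as_ sb.
have [x [/andP[ax xb] Px] sx] : exists2 x, A x & s - del < x.
  by have [x Ax xs] := sup_adherent del0 supA; exists x.
have xs : x <= s by apply: (ub_le_sup supA.2); split => //; rewrite ax.
pose y := Num.min b (s + del).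
have xy : x <= y by rewrite le_min xb; lra.
have yb : y <= b by rewrite ge_min lexx.
have ys : y <= s + del by rewrite ge_min lexx orbT.
have Py : P a y by apply: (add a x y) => //; apply: h => //; exact: ltW.
have : y <= s by apply: (ub_le_sup supA.2); split => //; rewrite (le_trans ax).
rewrite /y ge_min => /orP[bs|]; last by lra.
by move: Py; rewrite /y min_l//; lra.
Qed.

Lemma cont_bounded a b (f : R -> R) : a <= b -> cont_on a b f ->
  exists2 D, 0 <= D & forall t, a <= t <= b -> `|f t| <= D.
Proof.
move=> ab cf.
have [|m mab hm] := @EVT_max R (fun t => `|f t|) a b ab.
  by apply: cont_on_comp => //; exact: norm_continuous.
exists `|f m| => // t tab; apply: hm; by rewrite in_itv.
Qed.

End local_to_global.

Lemma cvg_sum_ord {R : realType} {T : Type} (F : set_system T) {FF : Filter F} m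
    (f : 'I_m -> T -> R) (l : 'I_m -> R) :
  (forall i, f i x @[x --> F] --> l i) ->
  (\sum_i f i x) @[x --> F] --> \sum_i l i.
Proof.
elim: m f l => [|m IH] f l fl.
  by rewrite big_ord0; under eq_fun do rewrite big_ord0; exact: cvg_cst.
rewrite big_ord_recr; under eq_fun do rewrite big_ord_recr.
by apply: cvgD => //; exact: IH.
Qed.

Section vector_curves.
Context {R : realType} {n : nat}.
Implicit Types (u v w z V : 'rV[R]_n) (g : R -> 'rV[R]_n).

(** Taking [u = z]. It turns scalar mean value estimates for the functions [dotp u (g t)] into
    estimates for vectors. *)
Lemma enorm_le_dual z (K : R) : 0 <= K ->
  (forall u, `|dotp u z| <= K * enorm u) -> enorm z <= K.
Proof.
move=> K0 h; have [->//|z0] := eqVneq (enorm z) 0.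
have zp : 0 < enorm z by rewrite lt_def z0 enorm_ge0.
rewrite -(ler_pM2r zp) -expr2 enorm_sqr; apply: le_trans (h z); exact: ler_norm.
Qed.

Lemma dotp_delta v i : dotp (delta_mx ord0 i) v = v ord0 i.
Proof.
rewrite /dotp (bigD1 i)//= mxE !eqxx mul1r big1 ?addr0// => j ji.
by rewrite mxE (negbTE ji) andbF mul0r.
Qed.

Lemma enorm_le_sum v : enorm v <= \sum_i `|dotp (delta_mx ord0 i) v|.
Proof.
under eq_bigr do rewrite dotp_delta.
apply: enorm_le_dual => [|u]; first exact: sumr_ge0.
rewrite mulr_suml; apply: le_trans (ler_norm_sum _ _ _) _; apply: ler_sum => i _.
by rewrite normrM mulrC ler_wpM2l// le_coord_enorm.
Qed.

Lemma curve_bounded a b g : a <= b ->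
  (forall w, cont_on a b (fun s => dotp w (g s))) ->
  exists2 D, 0 <= D & forall t, a <= t <= b -> enorm (g t) <= D.
Proof.
move=> ab cg.
have cs : cont_on a b (fun s => \sum_i `|dotp (delta_mx ord0 i) (g s)|).
  move=> x; apply: cvg_sum_ord => i.
  have : cont_on a b (fun s => `|dotp (delta_mx ord0 i) (g s)|).
    by apply: cont_on_comp => //; exact: norm_continuous.
  exact.
have [D D0 h] := cont_bounded ab cs; exists D => // t /h; apply: le_trans.
by apply: le_trans (enorm_le_sum _) _; exact: ler_norm.
Qed.

Lemma curve_near g (t0 eps : R) : 0 < eps ->
  (forall w, {for t0, continuous (fun s => dotp w (g s))}) ->
  exists2 del : R, 0 < del & forall t, `|t - t0| <= del -> enorm (g t - g t0) <= eps.
Proof.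
move=> eps0 cg.
pose f s := \sum_i `|dotp (delta_mx ord0 i) (g s) - dotp (delta_mx ord0 i) (g t0)|.
have cf : {for t0, continuous f}.
  apply: cvg_sum_ord => i.
  by apply: cvg_norm; apply: cvgB; [exact: cg|exact: cvg_cst].
have f0 : f t0 = 0 by rewrite /f big1// => i _; rewrite subrr normr0.
move/cvgrPdist_lt: cf => /(_ eps eps0) /nbhs_ballP[del/= del0 h].
exists (del / 2) => [|t tt0]; first by rewrite divr_gt0.
apply: le_trans (enorm_le_sum _) _.
under eq_bigr do rewrite dotpBr.
have := h t; rewrite /ball/= f0 sub0r normrN => h'.
apply: le_trans (ler_norm _) (ltW (h' _)); rewrite distrC; lra.
Qed.

(** Equality in Cauchy-Schwarz would make [u] a multiple of [v]. *)
Lemma gram_gt0_free u v : free [:: u; v] ->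
  0 < dotp u u * dotp v v - dotp u v ^+ 2.
Proof.
rewrite free_cons seq1_free span_seq1 => /andP[uv v0].
have vv : dotp v v != 0.
  rewrite -enorm_sqr sqrf_eq0; apply: contraNneq v0 => h; apply/eqP/rowP => i.
  by have := le_coord_enorm v i; rewrite h normr_le0 mxE => /eqP.
rewrite lt_def subr_ge0 dotp_sqr_le andbT; apply: contraNneq uv => E.
apply/vlineP; exists (dotp u v / dotp v v).
apply/eqP; rewrite -subr_eq0; set z := u - _.
have zz : enorm z ^+ 2 = 0.
  rewrite enorm_sqr /z dotpBl !dotpBr !dotpZl !dotpZr (dotpC v u).
  have -> : dotp u u = dotp u v ^+ 2 / dotp v v.
    by apply: (mulIf vv); rewrite -mulrA mulVf// mulr1; move/eqP: E; rewrite subr_eq0 => /eqP.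
  by field.
move/eqP: zz; rewrite sqrf_eq0 => /eqP zz; apply/eqP/rowP => i.
by have := le_coord_enorm z i; rewrite zz normr_le0 [in RHS]mxE => /eqP.
Qed.

End vector_curves.

Section oscillatory_integral.
Context {R : realType} {n : nat}.
Local Notation mu := (@lebesgue_measure R).
Local Notation int a b f := (\int[mu]_(x in `[a, b]) f x)%R.
Implicit Types (w : 'rV[R]_n) (g : R -> 'rV[R]_n) (a b c e r : R).

(** Regularity is tested on the scalar functions [dotp w (g s)], which are all that the phases
    involve. The derivatives are two-sided even at [a] and [b], so this is used on an interval
    strictly inside the one where the curve is smooth. *)
Definition curve_C2 a b g g1 g2 := [/\
  (forall t, a <= t <= b -> forall w,
     is_derive t (1 : R) (fun s => dotp w (g s)) (dotp w (g1 t))),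
  (forall t, a <= t <= b -> forall w,
     is_derive t (1 : R) (fun s => dotp w (g1 s)) (dotp w (g2 t))) &
  (forall t, a <= t <= b -> forall w, {for t, continuous (fun s => dotp w (g2 s))})].

Definition amplitude_C1 (h h1 : R -> R) :=
  (forall t : R, is_derive t (1 : R) h (h1 t)) /\ continuous h1.

(** The shift [al] gives both parts of a complex integral with real amplitude: 0 yields the cosine
    and [- (pi / 2)] the sine. *)
Definition osc h g c e r w al :=
  int c e (fun t => h t * cos (r * dotp w (g t) + al)).

(** The squared modulus of the complex oscillatory integral with amplitude [h]. *)
Definition osc_sqr h g c e r w :=
  osc h g c e r w 0 ^+ 2 + osc h g c e r w (- (pi / 2)) ^+ 2.

Variables (a b : R) (g g1 g2 : R -> 'rV[R]_n) (h h1 : R -> R).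
Hypothesis gC2 : curve_C2 a b g g1 g2.
Hypothesis hC1 : amplitude_C1 h h1.

Let cont_dotp c e w : a <= c -> e <= b -> cont_on c e (fun t => dotp w (g t)).
Proof.
move=> ac eb; have [dg _ _] := gC2; apply: cont_on_for => t /andP[ct te].
by apply: isder_cont; apply: dg; rewrite (le_trans ac)// (le_trans te).
Qed.

Lemma osc_cont c e r w al : a <= c -> e <= b ->
  cont_on c e (fun t => h t * cos (r * dotp w (g t) + al)).
Proof.
move=> ac eb; apply: cont_onM.
  by apply: cont_on_for => t _; exact: (isder_cont (hC1.1 t)).
apply: cont_on_comp; first exact: continuous_cos.
apply: cont_onD; last exact: cont_on_cst.
by apply: cont_onM; [exact: cont_on_cst|exact: cont_dotp].
Qed.

Lemma osc_split c m e r w al : a <= c -> c <= m -> m <= e -> e <= b ->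
  osc h g c e r w al = osc h g c m r w al + osc h g m e r w al.
Proof. by move=> ac cm me eb; apply: int_split => //; exact: osc_cont. Qed.

Lemma osc_self c r w al : osc h g c c r w al = 0.
Proof. by rewrite /osc set_itv1 Rintegral_set1. Qed.

Lemma osc_le c e r w al X : a <= c -> c <= e -> e <= b ->
  (forall t, a <= t <= b -> `|h t| <= X) -> `|osc h g c e r w al| <= X * (e - c).
Proof.
move=> ac ce eb hX; apply: int_abs_le => //; first exact: osc_cont.
move=> t /andP[ct te]; rewrite normrM -[leRHS]mulr1 ler_pM//.
  by apply: hX; rewrite (le_trans ac)// (le_trans te).
by rewrite ler_norml cos_geN1 cos_le1.
Qed.

Lemma osc_riemann c e r w al X X1 D1 M : a <= c -> c <= e -> e <= b -> 0 <= r ->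
  (0 < M)%N ->
  (forall t, a <= t <= b -> `|h t| <= X) -> (forall t, a <= t <= b -> `|h1 t| <= X1) ->
  (forall t, a <= t <= b -> enorm (g1 t) <= D1) ->
  `|osc h g c e r w al - (e - c) / M%:R * \sum_(k < M)
      (h (c + (e - c) * k%:R / M%:R) * cos (r * dotp w (g (c + (e - c) * k%:R / M%:R)) + al))|
  <= (X1 + X * (r * (enorm w * D1))) * (e - c) ^+ 2 / M%:R.
Proof.
move=> ac ce eb r0 M0 hX hX1 hD1; have [dg _ _] := gC2.
pose F t := h t * cos (r * dotp w (g t) + al).
apply: (@riemann_sum_le _ c e _ F) => //; first exact: osc_cont.
set Lam := _ + _.
suff lip s t : c <= s -> s <= t -> t <= e -> `|F t - F s| <= Lam * `|t - s|.
  move=> s t /andP[cs se] /andP[ct te]; have [st|/ltW ts] := leP s t; first exact: lip.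
  by rewrite distrC [`|t - s|]distrC; exact: lip.
move=> cs st te.
pose F1 x := h1 x * cos (r * dotp w (g x) + al) +
  h x * (- sin (r * dotp w (g x) + al) * (r * dotp w (g1 x))).
have sub x : s <= x <= t -> a <= x <= b.
  by move=> /andP[sx xt]; rewrite (le_trans ac (le_trans cs sx)) (le_trans xt (le_trans te eb)).
have dF (x : R) : s <= x <= t -> is_derive x 1 F (F1 x).
  move=> /sub xab.
  have dl : is_derive x 1 (fun t => r * dotp w (g t) + al) (r * dotp w (g1 x)).
    apply: is_derive_eq (isder_add (isder_mul (isder_cst x r) (dg x xab w)) (isder_cst x al)) _.
    by ring.
  exact: (isder_mul (hC1.1 x) (@isder_comp _ cos (fun t => r * dotp w (g t) + al) x _ _ (is_derive_cos _) dl)).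
have dG (x : R) : s <= x <= t -> is_derive x 1 (fun y => Lam * y) Lam.
  by move=> _; apply: is_derive_eq (isder_mul (isder_cst x _) (isder_id x)) _; ring.
have := mvt_le st dF dG; rewrite -mulrBr (ger0_norm (_ : 0 <= t - s)) ?subr_ge0//; apply.
move=> x /sub xab; apply: le_trans (ler_normD _ _) _; rewrite !normrM normrN.
have c1 y : `|cos y| <= 1 :> R by rewrite ler_norml cos_geN1 cos_le1.
have s1 y : `|sin y| <= 1 :> R by rewrite ler_norml sin_geN1 sin_le1.
apply: lerD; first by rewrite -[leRHS]mulr1 ler_pM ?hX1.
apply: ler_pM; rewrite ?mulr_ge0 ?hX//.
rewrite -[leRHS]mul1r; apply: ler_pM; rewrite ?mulr_ge0//.
rewrite ger0_norm// ler_wpM2l//; apply: le_trans (dotp_le _ _) _.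
by rewrite ler_wpM2l ?enorm_ge0// hD1.
Qed.

Lemma curve_C2_bounded : a <= b -> exists D, [/\ 0 <= D,
  (forall t, a <= t <= b -> enorm (g1 t) <= D) &
  (forall t, a <= t <= b -> enorm (g2 t) <= D)].
Proof.
move=> ab; have [dg dg1 cg2] := gC2.
have [|D1 D10 h1'] := @curve_bounded _ _ a b g1 ab.
  by move=> w; apply: cont_on_for => t tab; exact: isder_cont (dg1 t tab w).
have [|D2 D20 h2'] := @curve_bounded _ _ a b g2 ab.
  by move=> w; apply: cont_on_for => t tab; exact: cg2.
exists (Num.max D1 D2); split; first by rewrite le_max D10.
- by move=> t /h1'; rewrite le_max => ->.
- by move=> t /h2' h2; rewrite le_max h2 orbT.
Qed.

Lemma amplitude_C1_bounded : a <= b -> exists X, [/\ 0 <= X,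
  (forall t, a <= t <= b -> `|h t| <= X) & (forall t, a <= t <= b -> `|h1 t| <= X)].
Proof.
move=> ab; have [dh ch1] := hC1.
have [|X X0 hX] := @cont_bounded _ a b h ab.
  by apply: cont_on_for => t tab; exact: isder_cont (dh t).
have [|X1 X10 hX1] := @cont_bounded _ a b h1 ab.
  by apply: cont_on_for => t tab; exact: ch1.
exists (Num.max X X1); split; first by rewrite le_max X0.
- by move=> t /hX; rewrite le_max => ->.
- by move=> t /hX1 h2; rewrite le_max h2 orbT.
Qed.

(** A pointwise limit of Riemann sums, each a finite combination of cosines of affine functions of
    [w]. *)
Lemma measurable_osc c e r al : a <= c -> c <= e -> e <= b -> 0 <= r ->
  measurable_fun setT (fun w => osc h g c e r w al).
Proof.
move=> ac ce eb r0.
have ab : a <= b := le_trans ac (le_trans ce eb).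
have [D [D0 hD1 _]] := curve_C2_bounded ab.
have [X [X0 hX hX1]] := amplitude_C1_bounded ab.
pose S (m : nat) w := (e - c) / m.+1%:R * \sum_(k < m.+1)
  (h (c + (e - c) * k%:R / m.+1%:R) *
   cos (r * dotp w (g (c + (e - c) * k%:R / m.+1%:R)) + al)).
apply: (@measurable_fun_cvg _ _ _ _ S) => [m|w _].
  apply: measurable_funM => //; apply: measurable_sum => k; apply: measurable_funM => //.
  apply: (measurableT_comp (continuous_measurable_fun (@continuous_cos R))).
  apply: measurable_funD => //; apply: measurable_funM => //; exact: measurable_dotpl.
pose K := (X + X * (r * (enorm w * D))) * (e - c) ^+ 2.
have K0 : 0 <= K.
  by rewrite mulr_ge0 ?sqr_ge0// addr_ge0// !mulr_ge0// enorm_ge0.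
apply/cvgrPdist_le => eps eps0.
near=> m.
have := osc_riemann w al ac ce eb r0 (ltn0Sn m) hX hX1 hD1; rewrite -/(S m w) => H.
apply: (le_trans H); rewrite -/K ler_pdivrMr ?ltr0n// mulrC -ler_pdivrMr//.
apply: ltW; apply: lt_trans (_ : m%:R < _); last by rewrite ltr_nat.
near: m; exact: nbhs_infty_gtr.
Unshelve. all: by end_near. Qed.

Lemma measurable_osc_sqr c e r : a <= c -> c <= e -> e <= b -> 0 <= r ->
  measurable_fun setT (osc_sqr h g c e r).
Proof.
move=> ac ce eb r0.
by apply: measurable_funD; apply: measurable_funX; exact: measurable_osc.
Qed.

Lemma osc_sqr_ge0 c e r w : 0 <= osc_sqr h g c e r w.
Proof. by rewrite addr_ge0// sqr_ge0. Qed.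

Lemma osc_sqr_split c m e r w : a <= c -> c <= m -> m <= e -> e <= b ->
  osc_sqr h g c e r w <= 2 * osc_sqr h g c m r w + 2 * osc_sqr h g m e r w.
Proof.
move=> ac cm me eb; rewrite /osc_sqr !(osc_split r w _ ac cm me eb).
have sq (x y : R) : (x + y) ^+ 2 <= 2 * x ^+ 2 + 2 * y ^+ 2.
  by rewrite -subr_ge0 (_ : _ - _ = (x - y) ^+ 2) ?sqr_ge0//; ring.
by apply: le_trans (lerD (sq _ _) (sq _ _)) _; lra.
Qed.

Lemma osc_sqr_le_of c e r w K : (forall al, `|osc h g c e r w al| <= K) ->
  osc_sqr h g c e r w <= 2 * K ^+ 2.
Proof.
move=> hK; have K0 : 0 <= K := le_trans (normr_ge0 _) (hK 0).
have sq al : osc h g c e r w al ^+ 2 <= K ^+ 2.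
  by rewrite -real_normK ?num_real// ler_pXn2r ?nnegrE.
rewrite /osc_sqr mulr_natl mulr2n; exact: lerD.
Qed.

End oscillatory_integral.

Section surface_integrals.
Context {R : realType} {n : nat}.
Local Notation sigma := (@surface_measure R n).
Implicit Types (f k : 'rV[R]_n -> R).

Lemma surface_finite : exists2 S : R, 0 <= S & (sigma setT <= S%:E)%E.
Proof.
have fin : (lebesgue_rV R n (cone setT) < +oo)%E.
  rewrite (_ : cone setT = punctured_ball); last by apply/seteqP; split => x /= [].
  apply: (@leb_bounded _ _ _ 1); first exact: measurable_punctured_ball.
  by move=> x /= /andP[].
exists (fine (sigma setT)); first by rewrite fine_ge0.
by rewrite fineK// ge0_fin_numE// /surface_measure lte_mul_pinfty// lee_fin.
Qed.

Lemma surface_le f k :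
  measurable_fun setT f -> measurable_fun setT k ->
  (forall w, 0 <= f w) -> (forall w, 0 <= k w) ->
  (forall w, sphere w -> f w <= k w) ->
  (\int[sigma]_w (f w)%:E <= \int[sigma]_w (k w)%:E)%E.
Proof.
move=> mf mk f0 k0 fk.
apply: ae_ge0_le_integral => //.
- by move=> w _; rewrite lee_fin.
- exact/measurable_EFinP.
- by move=> w _; rewrite lee_fin.
- exact/measurable_EFinP.
exists (~` sphere); split.
- by apply: measurableC; exact: measurable_sphere.
- exact: surface_measure_sphereC.
move=> w /= h; apply: contra_not h => sw _; rewrite lee_fin; exact: fk.
Qed.

Lemma surface_integral_affine f (K k I S : R) : measurable_fun setT f ->
  (forall w, 0 <= f w) -> 0 <= K -> 0 <= k -> (sigma setT <= S%:E)%E ->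
  (\int[sigma]_w (f w)%:E <= I%:E)%E ->
  (\int[sigma]_w (K + k * f w)%:E <= (K * S + k * I)%:E)%E.
Proof.
move=> mf f0 K0 k0 hS hI.
under eq_integral do rewrite EFinD EFinM.
rewrite ge0_integralD//=; first last.
- by apply/measurable_EFinP; apply: measurable_funM.
- by move=> w _; rewrite lee_fin mulr_ge0.
rewrite integral_cst//= ge0_integralZl_EFin//; last 2 first.
- by move=> w _; rewrite lee_fin.
- exact/measurable_EFinP.
by rewrite EFinD !EFinM; apply: leeD; apply: lee_wpmul2l => //; rewrite lee_fin.
Qed.

Lemma surface_integral_lin f k (x I J : R) : measurable_fun setT f ->
  measurable_fun setT k -> (forall w, 0 <= f w) -> (forall w, 0 <= k w) -> 0 <= x ->
  (\int[sigma]_w (f w)%:E <= I%:E)%E -> (\int[sigma]_w (k w)%:E <= J%:E)%E ->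
  (\int[sigma]_w (x * f w + x * k w)%:E <= (x * I + x * J)%:E)%E.
Proof.
move=> mf mk f0 k0 x0 hI hJ; under eq_integral do rewrite EFinD !EFinM.
rewrite ge0_integralD//=; first last.
- by apply/measurable_EFinP; apply: measurable_funM.
- by move=> w _; rewrite lee_fin mulr_ge0.
- by apply/measurable_EFinP; apply: measurable_funM.
- by move=> w _; rewrite lee_fin mulr_ge0.
rewrite !ge0_integralZl_EFin//; try exact/measurable_EFinP; try by move=> w _; rewrite lee_fin.
by rewrite EFinD !EFinM; apply: leeD; apply: lee_wpmul2l => //; rewrite lee_fin.
Qed.

End surface_integrals.

(** * Pointwise bounds along an arc *)

Section local_estimates.
Context {R : realType} {n : nat}.
Implicit Types (w : 'rV[R]_n) (c e r : R).
Variables (a b : R) (g g1 g2 : R -> 'rV[R]_n) (h h1 : R -> R) (D X : R).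
Hypothesis gC2 : curve_C2 a b g g1 g2.
Hypothesis hC1 : amplitude_C1 h h1.
Hypothesis D0 : 0 <= D.
Hypothesis g1D : forall t, a <= t <= b -> enorm (g1 t) <= D.
Hypothesis g2D : forall t, a <= t <= b -> enorm (g2 t) <= D.
Hypothesis X0 : 0 <= X.
Hypothesis hX : forall t, a <= t <= b -> `|h t| <= X.
Hypothesis h1X : forall t, a <= t <= b -> `|h1 t| <= X.

Let sub c e : a <= c -> e <= b -> forall t, c <= t <= e -> a <= t <= b.
Proof. by move=> ac eb t /andP[ct te]; rewrite (le_trans ac)// (le_trans te). Qed.

Lemma osc_first_derivative c e r w al kap : a <= c -> c <= e -> e <= b ->
  0 < r -> 0 < kap -> enorm w = 1 ->
  (forall t, c <= t <= e -> kap <= `|dotp w (g1 t)|) ->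
  `|osc h g c e r w al| <=
    (2 * X / kap + X / kap * (e - c) + X * (D * kap^-1 ^+ 2 * (e - c))) / r.
Proof.
move=> ac ce eb r0 kap0 w1 hk; have [dg dg1 cg2] := gC2.
have sb := sub ac eb.
have c2 : cont_on c e (fun t => `|dotp w (g2 t)| * (dotp w (g1 t))^-1 ^+ 2).
  have cq : cont_on c e (fun t => (dotp w (g1 t))^-1).
    apply: cont_on_for => t h'; apply: isder_cont (isder_inv (dg1 t (sb t h') w) _).
    by rewrite -normr_gt0 (lt_le_trans kap0)// hk.
  apply: cont_onM; last by have := cont_onM cq cq; congr cont_on; apply/funext => t; rewrite expr2.
  apply: cont_on_comp; first exact: norm_continuous.
  by apply: cont_on_for => t h'; exact: cg2 (sb t h') w.
apply: (nonstationary_le al ce r0 kap0 (fun t h' => dg t (sb t h') w)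
    (fun t h' => dg1 t (sb t h') w) (fun t h' => cg2 t (sb t h') w)
    (fun t _ => hC1.1 t) (fun t _ => hC1.2 t) (fun t h' => hX (sb t h'))
    (fun t h' => h1X (sb t h')) hk).
apply: le_trans (ler_norm _) _; apply: int_abs_le => // t ht.
have d0 : dotp w (g1 t) != 0 by rewrite -normr_gt0 (lt_le_trans kap0)// hk.
rewrite normrM normr_id; apply: ler_pM => //.
  by apply: le_trans (dotp_le _ _) _; rewrite w1 mul1r; apply: g2D; exact: sb.
rewrite normrX normfV ler_pXn2r ?nnegrE ?invr_ge0 ?(ltW kap0)//.
by rewrite lef_pV2 ?posrE ?normr_gt0// hk.
Qed.

(** The nonpositive case follows from the nonnegative one for [- w] and [- al], the cosine being
    even. *)
Lemma osc_monotone c e w del : a <= c -> c <= e -> e <= b -> 0 < del ->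
  (forall t, c <= t <= e -> 0 <= dotp w (g2 t)) \/
  (forall t, c <= t <= e -> dotp w (g2 t) <= 0) ->
  exists u v, [/\ c <= u, u <= v, v <= e,
    forall t, u < t < v -> `|dotp w (g1 t)| <= del &
    forall r al : R, 0 < r -> `|osc h g c e r w al| <=
      2 * (4 * X + X * (e - c)) / (r * del) + X * (v - u)].
Proof.
move=> ac ce eb del0; have [dg dg1 cg2] := gC2.
have sb := sub ac eb.
have pos w' : (forall t, c <= t <= e -> 0 <= dotp w' (g2 t)) ->
  exists u v, [/\ c <= u, u <= v, v <= e,
    forall t, u < t < v -> `|dotp w' (g1 t)| <= del &
    forall r al : R, 0 < r -> `|osc h g c e r w' al| <=
      2 * (4 * X + X * (e - c)) / (r * del) + X * (v - u)].
  move=> g20.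
  exact: (monotone_phase_le ce del0 (fun t h' => dg t (sb t h') w')
    (fun t h' => dg1 t (sb t h') w') (fun t h' => cg2 t (sb t h') w')
    (fun t _ => hC1.1 t) (fun t _ => hC1.2 t) (fun t h' => hX (sb t h'))
    (fun t h' => h1X (sb t h')) g20).
have dN z : dotp (- w) z = - dotp w z by rewrite -scaleN1r dotpZl mulN1r.
case=> [/pos//|g20]; have [|u [v [cu uv ve small big]]] := pos (- w).
  by move=> t /g20; rewrite dN oppr_ge0.
exists u, v; split => // [t /small|r al r0]; first by rewrite dN normrN.
have := big r (- al) r0; congr (`|_| <= _).
apply: eq_Rintegral => t _; congr (_ * _).
by rewrite dN mulrN -opprD cosN.
Qed.

(** The splitting with [del = (Num.sqrt r)^-1]: the piece where [dotp w (g1 t)] is at most [del] in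
    absolute value has length at most [4 * del / kap], because this function moves there at speed at
    least [kap]. *)
Lemma osc_second_derivative c e r w al kap : a <= c -> c <= e -> e <= b ->
  0 < r -> 0 < kap ->
  (forall t, c <= t <= e -> kap <= dotp w (g2 t)) \/
  (forall t, c <= t <= e -> dotp w (g2 t) <= - kap) ->
  `|osc h g c e r w al| <= (2 * (4 * X + X * (e - c)) + X * (4 / kap)) / Num.sqrt r.
Proof.
move=> ac ce eb r0 kap0 hk; have [dg dg1 cg2] := gC2.
pose del := (Num.sqrt r)^-1.
have s0 : 0 < Num.sqrt r by rewrite sqrtr_gt0.
have del0 : 0 < del by rewrite invr_gt0.
have sgn : (forall t, c <= t <= e -> 0 <= dotp w (g2 t)) \/
  (forall t, c <= t <= e -> dotp w (g2 t) <= 0).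
  by case: hk => hk; [left|right] => t /hk; lra.
have [u [v [cu uv ve small big]]] := osc_monotone ac ce eb del0 sgn.
apply: le_trans (big r al r0) _.
have rdel : r * del = Num.sqrt r.
  by rewrite /del -{1}(sqr_sqrtr (ltW r0)) expr2 mulfK// gt_eqF.
rewrite rdel [leRHS]mulrDl lerD2l -/del -mulrA ler_wpM2l//.
move: uv; rewrite le_eqVlt => /predU1P[->|uv].
  by rewrite subrr mulr_ge0 ?divr_ge0 ?(ltW kap0)// ltW.
(* Smallness is known on the open interval only; passing to its closed middle half costs a factor
   2. *)
pose u' := u + (v - u) / 4; pose v' := v - (v - u) / 4.
have uv' : u' <= v' by rewrite /u' /v'; lra.
have inc t : u' <= t <= v' -> u < t < v /\ c <= t <= e.
  move=> /andP[t1 t2]; split; apply/andP; split;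
  move: t1 t2; rewrite /u' /v'; lra.
have dG t : u' <= t <= v' -> is_derive t (1 : R) (fun s => dotp w (g1 s)) (dotp w (g2 t)).
  by move=> /inc[_ /(sub ac eb) tab]; exact: dg1.
have dF (t : R) : u' <= t <= v' -> is_derive t 1 (fun s => kap * s) kap.
  by move=> _; apply: is_derive_eq (isder_mul (isder_cst t _) (isder_id t)) _; ring.
have su : `|dotp w (g1 u')| <= del.
  by apply: small; have [] := inc u' _ => //; rewrite lexx.
have sv : `|dotp w (g1 v')| <= del.
  by apply: small; have [] := inc v' _ => //; rewrite lexx uv'.
have key : kap * (v' - u') <= 2 * del.
  case: hk => hk.
    have := mvt_le uv' dF dG _; rewrite -mulrBr.
    move=> H; apply: (le_trans (le_trans (ler_norm _) (H _))).
      by move=> x /inc[_ /hk]; rewrite ger0_norm ?(ltW kap0).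
    by move: su sv; rewrite !ler_norml => /andP[? ?] /andP[? ?]; lra.
  have dG' t : u' <= t <= v' ->
      is_derive t (1 : R) (fun s => 0 - dotp w (g1 s)) (0 - dotp w (g2 t)).
    by move=> /dG h'; exact: (isder_sub (isder_cst t 0) h').
  have := mvt_le uv' dF dG' _; rewrite -mulrBr.
  move=> H; apply: (le_trans (le_trans (ler_norm _) (H _))).
    by move=> x /inc[_ /hk]; rewrite ger0_norm ?(ltW kap0)//; lra.
  by move: su sv; rewrite !ler_norml => /andP[? ?] /andP[? ?]; lra.
rewrite mulrAC ler_pdivlMr//; move: key; rewrite /u' /v'; lra.
Qed.

(** Off the cap [dotp w V1] or [dotp w V2] exceeds [c0] in absolute value, and the corresponding
    derivative stays within [c0 / 2] of it, so one of the two derivative tests applies on the whole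
    arc. The first gives the better power [r ^- 2], weakened here to [r^-1]. *)
Lemma osc_sqr_off_cap V1 V2 c0 c e : 0 < c0 -> a <= c -> c <= e -> e <= b ->
  (forall t, c <= t <= e -> enorm (g1 t - V1) <= c0 / 2) ->
  (forall t, c <= t <= e -> enorm (g2 t - V2) <= c0 / 2) ->
  exists2 K, 0 <= K & forall r w, 2 <= r -> sphere w -> ~ cap V1 V2 c0 w ->
    osc_sqr h g c e r w <= K / r.
Proof.
move=> c00 ac ce eb h1' h2'.
pose kap := c0 / 2; have kap0 : 0 < kap by rewrite divr_gt0.
pose K1 := 2 * X / kap + X / kap * (e - c) + X * (D * kap^-1 ^+ 2 * (e - c)).
pose K2 := 2 * (4 * X + X * (e - c)) + X * (4 / kap).
exists (2 * K1 ^+ 2 + 2 * K2 ^+ 2); first by rewrite addr_ge0// mulr_ge0// sqr_ge0.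
move=> r w r2 w1 ncap.
have r0 : 0 < r by lra.
have near V z : enorm (z - V) <= c0 / 2 -> `|dotp w z - dotp w V| <= kap.
  by move=> h'; rewrite -dotpBr; apply: le_trans (dotp_le _ _) _; rewrite w1 mul1r.
have [big1|small1] := ltP c0 `|dotp w V1|.
  have B t : c <= t <= e -> kap <= `|dotp w (g1 t)|.
    move=> /h1' /near; rewrite /kap.
    have := ler_distD (dotp w (g1 t)) 0 (dotp w V1).
    by rewrite !sub0r !normrN; lra.
  apply: (@le_trans _ _ (2 * (K1 / r) ^+ 2)).
    apply: osc_sqr_le_of => al; exact: osc_first_derivative.
  rewrite expr_div_n mulrA; apply: (@le_trans _ _ (2 * K1 ^+ 2 / r)).
    rewrite ler_wpM2l//; first by rewrite mulr_ge0// sqr_ge0.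
    by rewrite lef_pV2 ?posrE ?exprn_gt0// expr2 ler_pMl//; lra.
  by rewrite ler_wpM2r ?invr_ge0 ?(ltW r0)// lerDl mulr_ge0 ?sqr_ge0.
have [big2|small2] := ltP c0 `|dotp w V2|; last by case: ncap.
apply: (@le_trans _ _ (2 * (K2 / Num.sqrt r) ^+ 2)).
  apply: osc_sqr_le_of => al; apply: osc_second_derivative => //.
  have [p|p] := leP 0 (dotp w V2); move: big2; [rewrite ger0_norm// | rewrite ltr0_norm//];
    move=> big2; [left|right] => t /h2' /near; rewrite ler_norml /kap => /andP[? ?]; lra.
rewrite expr_div_n sqr_sqrtr ?(ltW r0)// mulrA.
by rewrite ler_wpM2r ?invr_ge0 ?(ltW r0)// lerDr mulr_ge0 ?sqr_ge0.
Qed.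

Lemma osc_sqr_riemann c e r w M (A : nat -> R) : a <= c -> c <= e -> e <= b -> 0 <= r ->
  (0 < M)%N -> enorm w = 1 ->
  (forall k, (k < M)%N -> A k = h (c + (e - c) * k%:R / M%:R)) ->
  osc_sqr h g c e r w <=
    2 * ((e - c) / M%:R) ^+ 2 *
      trig_sqr (fun k : 'I_M => A k) (fun k => g (c + (e - c) * k%:R / M%:R)) (r *: w) +
    4 * ((X + X * (r * D)) * (e - c) ^+ 2 / M%:R) ^+ 2.
Proof.
move=> ac ce eb r0 M0 w1 hA.
pose E := (X + X * (r * D)) * (e - c) ^+ 2 / M%:R.
have E0 : 0 <= E by rewrite divr_ge0// mulr_ge0 ?sqr_ge0// addr_ge0// !mulr_ge0.
pose S al := (e - c) / M%:R * \sum_(k < M) (h (c + (e - c) * k%:R / M%:R) *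
  cos (r * dotp w (g (c + (e - c) * k%:R / M%:R)) + al)).
have one al : osc h g c e r w al ^+ 2 <= 2 * S al ^+ 2 + 2 * E ^+ 2.
  have := osc_riemann gC2 hC1 w al ac ce eb r0 M0 hX h1X g1D.
  rewrite -/(S al) w1 mul1r -/E => H.
  have /(_ _)/= := ler_pXn2r (ltn0Sn 1) (normr_ge0 _) E0.
  move: H; set x := osc _ _ _ _ _ _ _ => H.
  have : (x - S al) ^+ 2 <= E ^+ 2.
    by rewrite -real_normK ?num_real// ler_pXn2r ?nnegrE.
  have := sqr_ge0 (x - 2 * S al); nra.
rewrite /osc_sqr -/E; apply: le_trans (lerD (one _) (one _)) _.
have -> : trig_sqr (fun k : 'I_M => A k) (fun k => g (c + (e - c) * k%:R / M%:R)) (r *: w) =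
  (\sum_(k < M) (h (c + (e - c) * k%:R / M%:R) *
     cos (r * dotp w (g (c + (e - c) * k%:R / M%:R)) + 0))) ^+ 2 +
  (\sum_(k < M) (h (c + (e - c) * k%:R / M%:R) *
     cos (r * dotp w (g (c + (e - c) * k%:R / M%:R)) + - (pi / 2)))) ^+ 2.
  rewrite /trig_sqr; congr (_ ^+ 2 + _ ^+ 2); apply: eq_bigr => k _;
    rewrite hA ?ltn_ord// dotpZl ?addr0//.
  by rewrite cosB cos_pihalf sin_pihalf mulr0 add0r mulr1.
rewrite /S !exprMn; lra.
Qed.

End local_estimates.

(** * Second and fourth moments over the sphere *)

Section local_moments.
Context {R : realType} {n : nat}.
Local Notation sigma := (@surface_measure R n).
Implicit Types (w : 'rV[R]_n) (c e r : R).

(** Since [osc_sqr] is already a square, these are the L^2 and L^4 bounds for the oscillatory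
    integral. *)
Definition osc_moments (h : R -> R) (g : R -> 'rV[R]_n) c e :=
  exists2 C : R, 0 <= C & forall r, 2 <= r ->
    (\int[sigma]_w (osc_sqr h g c e r w)%:E <= (C / r)%:E)%E /\
    (\int[sigma]_w (osc_sqr h g c e r w ^+ 2)%:E <= (C * ln r / r ^+ 2)%:E)%E.

Lemma curve_increment (p p1 : R -> 'rV[R]_n) c e V eps s t : 0 <= eps ->
  (forall t, c <= t <= e -> forall w,
     is_derive t (1 : R) (fun s => dotp w (p s)) (dotp w (p1 t))) ->
  (forall t, c <= t <= e -> enorm (p1 t - V) <= eps) ->
  c <= s <= e -> c <= t <= e ->
  enorm (p t - p s - (t - s) *: V) <= eps * `|t - s|.
Proof.
move=> eps0 dp hV sc tc.
apply: enorm_le_dual => [|u]; first by rewrite mulr_ge0.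
rewrite !dotpBr dotpZr mulrAC.
apply: (increment_approx (fun x hx => dp x hx u)) => // x hx.
rewrite -dotpBr; apply: le_trans (dotp_le _ _) _; rewrite mulrC ler_wpM2r ?enorm_ge0//.
exact: hV.
Qed.

Variables (a b : R) (g g1 g2 : R -> 'rV[R]_n) (h h1 : R -> R).
Hypothesis gC2 : curve_C2 a b g g1 g2.
Hypothesis hC1 : amplitude_C1 h h1.

Lemma curve_pair_sum c e V1 V2 eps s t s' t' c1 c2 : a <= c -> e <= b -> 0 <= eps ->
  (forall t, c <= t <= e -> enorm (g1 t - V1) <= eps) ->
  (forall t, c <= t <= e -> enorm (g2 t - V2) <= eps) ->
  c <= s -> s <= t -> t <= e -> c <= s' -> s' <= t' -> t' <= e ->
  c1 = (s + t) - (s' + t') -> c2 = ((t - s) ^+ 2 - (t' - s') ^+ 2) / 4 ->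
  enorm (g s + g t - (g s' + g t') - (c1 *: V1 + c2 *: V2)) <= eps * (`|c1| + `|c2|).
Proof.
move=> ac eb eps0 hV1 hV2 cs st te cs' st' te' E1 E2; have [dg dg1 _] := gC2.
have sub x : c <= x <= e -> a <= x <= b.
  by move=> /andP[? ?]; rewrite (le_trans ac)// (le_trans _ eb).
apply: enorm_le_dual => [|u]; first by rewrite mulr_ge0// addr_ge0.
rewrite 2!dotpBr !dotpDr !dotpZr mulrAC.
apply: (pair_sum_approx (fun x hx => dg x (sub x hx) u) (fun x hx => dg1 x (sub x hx) u)) => //.
  move=> x hx; rewrite -dotpBr; apply: le_trans (dotp_le _ _) _.
  by rewrite mulrC ler_wpM2r ?enorm_ge0// hV1.
move=> x hx; rewrite -dotpBr; apply: le_trans (dotp_le _ _) _.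
by rewrite mulrC ler_wpM2r ?enorm_ge0// hV2.
Qed.

(** A number of points of order r^2 makes the Riemann error O(1/r), the integrand having derivative
    O(r), and keeps [ln M%:R] below a multiple of [ln r]. *)
Let sample_size (L r : R) : 0 < L -> 2 <= r ->
  exists M : nat, [/\ (0 < M)%N, 2 * (r * L) <= M%:R, r * L ^+ 2 <= 2 * M%:R,
    r ^+ 2 <= M%:R & M%:R <= 2 * (1 + L + L ^+ 2) * r ^+ 2].
Proof.
move=> L0 r2; pose K0 := 1 + L + L ^+ 2; pose x := K0 * r ^+ 2.
have L20 : 0 < L ^+ 2 by rewrite exprn_gt0.
have r0 : 0 < r by lra.
have rr : 2 * r <= r ^+ 2 by rewrite expr2 ler_wpM2r// ltW.
have x1 : r ^+ 2 <= x by rewrite ler_peMl ?sqr_ge0// /K0; lra.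
have x2 : L * r ^+ 2 <= x by rewrite ler_wpM2r ?sqr_ge0// /K0; lra.
have x3 : L ^+ 2 * r ^+ 2 <= x by rewrite ler_wpM2r ?sqr_ge0// /K0; lra.
have x0 : 0 <= x by apply: le_trans x1; exact: sqr_ge0.
have xM : x <= (Num.truncn x).+1%:R.
  by rewrite ltW// -truncn_lt_nat.
have Mx : (Num.truncn x)%:R <= x by rewrite truncn_le.
have rLL : r * L <= r ^+ 2 * L.
  by rewrite ler_wpM2r ?(ltW L0)//; lra.
have rL2 : r * L ^+ 2 <= r ^+ 2 * L ^+ 2.
  by rewrite ler_wpM2r ?(ltW L20)//; lra.
exists (Num.truncn x).+1; split => //.
- apply: le_trans xM; apply: le_trans x2.
  by rewrite mulrA [2 * r * L]mulrC ler_wpM2l// ltW.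
- apply: (@le_trans _ _ x); lra.
- exact: le_trans x1 xM.
- rewrite -natr1 -mulrA -/K0 -/x.
  suff : 1 <= x by lra.
  apply: le_trans x1; lra.
Qed.

(** As [r >= 2], the constant [1 + ln K] is absorbed into a multiple of [ln r]. *)
Let one_ln_le (K M r : R) : 1 <= K -> 2 <= r -> 0 < M -> M <= K * r ^+ 2 ->
  1 + ln M <= ((1 + ln K) / ln 2 + 2) * ln r.
Proof.
move=> K1 r2 M0 MK.
have r0 : 0 < r by lra.
have K0 : 0 < K by lra.
have l2 : 0 < ln 2 :> R by apply: ln_gt0; lra.
have lK : 0 <= ln K by exact: ln_ge0.
have lr : ln 2 <= ln r by rewrite ler_ln ?posrE.
have : ln M <= ln (K * r ^+ 2).
  by rewrite ler_ln ?posrE// mulr_gt0 ?exprn_gt0.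
rewrite lnM ?posrE ?exprn_gt0// lnXn// mulrDl mulrAC.
have : 1 + ln K <= (1 + ln K) * ln r / ln 2.
  by rewrite ler_pdivlMr// ler_wpM2l//; lra.
by rewrite mulr2n; lra.
Qed.

Lemma osc_moments_self c : osc_moments h g c c.
Proof.
exists 0 => // r _.
have z w : osc_sqr h g c c r w = 0 by rewrite /osc_sqr !osc_self expr0n/= addr0.
split; under eq_integral do rewrite z ?expr0n; by rewrite integral0 !mul0r.
Qed.

(** On a short arc both derivatives are within [ep] of [V1] and [V2]: [ep <= eta] serves the
    comparison of frequencies on the cap, and [ep <= c0 / 2] the derivative tests off the cap. *)
Lemma osc_moments_local t0 : a <= t0 <= b ->
  0 < dotp (g1 t0) (g1 t0) * dotp (g2 t0) (g2 t0) - dotp (g1 t0) (g2 t0) ^+ 2 ->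
  exists2 del : R, 0 < del & forall c e, a <= c -> c <= e -> e <= b ->
    t0 - del <= c -> e <= t0 + del -> osc_moments h g c e.
Proof.
move=> t0ab gram; have [dg dg1 cg2] := gC2.
have ab : a <= b by case/andP: t0ab; exact: le_trans.
set V1 := g1 t0 in gram *; set V2 := g2 t0 in gram *.
have n0 : (0 < n)%N.
  rewrite lt0n; apply: contraTneq gram => nE.
  have z (u v : 'rV[R]_n) : dotp u v = 0.
    by rewrite /dotp big1// => i _; have := ltn_ord i; rewrite [X in (_ < X)%N]nE.
  by rewrite !z mulr0 expr0n/= subrr ltxx.
have [c0 [eta [C1 [c00 eta0 C10 hcap]]]] := cap_discrete_le gram n0.
have [D [D0 g1D g2D]] := curve_C2_bounded gC2 ab.
have [X [X0 hX h1X]] := amplitude_C1_bounded hC1 ab.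
have [S S0 hS] := @surface_finite R n.
pose ep := Num.min eta (c0 / 2).
have ep0 : 0 < ep by rewrite lt_min eta0 divr_gt0.
have epe : ep <= eta by rewrite ge_min lexx.
have epc : ep <= c0 / 2 by rewrite ge_min lexx orbT.
have [del1 del10 near1] := @curve_near _ _ g1 t0 ep ep0 (fun w => isder_cont (dg1 t0 t0ab w)).
have [del2 del20 near2] := @curve_near _ _ g2 t0 ep ep0 (cg2 t0 t0ab).
exists (Num.min del1 del2) => [|c e ac ce eb]; first by rewrite lt_min del10.
rewrite le_eqVlt in ce; case/predU1P: ce => [<- _ _|ce dc de].
  exact: osc_moments_self.
have hV1 t : c <= t <= e -> enorm (g1 t - V1) <= ep.
  move=> /andP[ct te]; apply: near1; have : Num.min del1 del2 <= del1 by rewrite ge_min lexx.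
  by rewrite ler_norml; lra.
have hV2 t : c <= t <= e -> enorm (g2 t - V2) <= ep.
  move=> /andP[ct te]; apply: near2; have : Num.min del1 del2 <= del2 by rewrite ge_min lexx orbT.
  by rewrite ler_norml; lra.
pose L := e - c; have L0 : 0 < L by rewrite subr_gt0.
have [K K0 hoff] := osc_sqr_off_cap gC2 hC1 g2D X0 hX h1X c00 ac (ltW ce) eb
  (fun t ht => le_trans (hV1 t ht) epc) (fun t ht => le_trans (hV2 t ht) epc).
pose KE := X * (1 + D) * L ^+ 2.
have KE0 : 0 <= KE by rewrite mulr_ge0 ?sqr_ge0// mulr_ge0// addr_ge0.
(* The off-cap bound plus the squared Riemann error: the part of [osc_sqr] that is O(1/r)
   pointwise. *)
pose KA := K + 4 * KE ^+ 2.
have KA0 : 0 <= KA by rewrite addr_ge0// mulr_ge0 ?sqr_ge0.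
pose K1 := 2 * (1 + L + L ^+ 2).
have K11 : 1 <= K1.
  by rewrite /K1 mulr_ege1 ?ler1n// -addrA lerDl addr_ge0 ?sqr_ge0// ltW.
have l2 : 0 < ln 2 :> R by apply: ln_gt0; rewrite ltr1n.
pose KL := (1 + ln K1) / ln 2 + 2.
have lK1 : 0 <= ln K1 by exact: ln_ge0.
have KL0 : 0 <= KL by rewrite addr_ge0// divr_ge0 ?(ltW l2)// addr_ge0.
pose CA := KA * S + 2 * L * C1 * X ^+ 2.
pose CB := (2 * KA ^+ 2 + 32 * L ^+ 4 * X ^+ 4) * S / ln 2 + 64 * L * C1 * X ^+ 4 * KL.
have CA0 : 0 <= CA.
  by rewrite addr_ge0 ?mulr_ge0 ?sqr_ge0// ltW.
have CB0 : 0 <= CB.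
  have X40 : 0 <= X ^+ 4 by rewrite exprn_ge0.
  have L40 : 0 <= L ^+ 4 by rewrite exprn_ge0// ltW.
  have KA20 := sqr_ge0 KA.
  rewrite addr_ge0//; last by rewrite !mulr_ge0// ltW.
  have p1 : 0 <= 2 * KA ^+ 2 by exact: mulr_ge0.
  have p2 : 0 <= 32 * L ^+ 4 * X ^+ 4 by do 2 apply: mulr_ge0 => //.
  by rewrite divr_ge0 ?(ltW l2)// mulr_ge0// addr_ge0.
exists (CA + CB) => [|r r2]; first exact: addr_ge0.
have r1 : 1 < r by apply: lt_le_trans r2; rewrite ltr1n.
have r0 : 0 < r := lt_trans ltr01 r1.
have [M [M0 M1 M2 M3 M4]] := sample_size L0 r2.
have MR : 0 < M%:R :> R by rewrite ltr0n.
have rM : r <= M%:R by apply: le_trans M3; rewrite expr2 ler_peMl ?(ltW r0)// ltW.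
pose tt k : R := L * k%:R / M%:R.
pose gg k := g (c + (e - c) * k%:R / M%:R).
(* Cut off at [M] because [cap_discrete_le] asks for a bound at every index, while the sample points
   leave [[c, e]] beyond [M]. *)
pose A k := if (k < M)%N then h (c + (e - c) * k%:R / M%:R) else 0.
have tin k : (k < M)%N -> c <= c + (e - c) * k%:R / M%:R <= e.
  move=> kM; rewrite lerDl divr_ge0 ?mulr_ge0 ?(ltW L0) ?ler0n ?(ltW MR)//=.
  rewrite -lerBrDl ler_pdivrMr// ler_wpM2l ?(ltW L0)// ler_nat ltnW//.
have AX k : `|A k| <= X.
  rewrite /A; case: ifP => [kM|_]; last by rewrite normr0.
  have /andP[t1 t2] := tin k kM.
  by apply: hX; rewrite (le_trans ac t1) (le_trans t2 eb).
have tmono k l : (k < l)%N -> c + (e - c) * k%:R / M%:R <= c + (e - c) * l%:R / M%:R.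
  move=> kl; rewrite lerD2l ler_wpM2r ?invr_ge0 ?(ltW MR)//.
  by rewrite ler_wpM2l ?(ltW L0)// ler_nat ltnW.
have dce t : c <= t <= e -> forall w,
    is_derive t (1 : R) (fun s => dotp w (g s)) (dotp w (g1 t)).
  by move=> /andP[ct te]; apply: dg; rewrite (le_trans ac)// (le_trans te).
have [i1 i2] : (\int[sigma]_w (\1_(cap V1 V2 c0) w *
      trig_sqr (fun k : 'I_M => A k) (fun k => gg k) (r *: w))%:E <=
    (C1 * (X ^+ 2 * M%:R ^+ 2) / (r * L))%:E)%E /\
  (\int[sigma]_w (\1_(cap V1 V2 c0) w *
      trig_sqr (@pair_coef _ M A) (@pair_freq _ _ M gg) (r *: w))%:E <=
    (C1 * (X ^+ 4 * M%:R ^+ 4) * (1 + ln M%:R) / (r ^+ 2 * L ^+ 3))%:E)%E.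
  apply: (hcap M L X r A gg tt) => // [k l kM lM|k l k' l' /andP[kl lM] /andP[kl' lM'] /=].
    have E : tt k - tt l = (c + (e - c) * k%:R / M%:R) - (c + (e - c) * l%:R / M%:R).
      by rewrite /tt /L; ring.
    rewrite E; apply: le_trans (curve_increment (ltW ep0) dce hV1 (tin l lM) (tin k kM)) _.
    by rewrite ler_wpM2r.
  set c1 := (X in X *: V1); set c2 := (X in X *: V2).
  have kM := ltn_trans kl lM; have kM' := ltn_trans kl' lM'.
  have /andP[s1 _] := tin k kM; have /andP[s1' _] := tin k' kM'.
  have /andP[_ t1] := tin l lM; have /andP[_ t1'] := tin l' lM'.
  apply: le_trans (curve_pair_sum ac eb (ltW ep0) hV1 hV2 s1 (tmono k l kl) t1
    s1' (tmono k' l' kl') t1' (_ : c1 = _) (_ : c2 = _)) _.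
  - by rewrite /c1 /tt /L; ring.
  - by rewrite /c2 /tt /L; congr (_ / _); ring.
  - by rewrite ler_wpM2r// addr_ge0.
pose KM := 2 * (L / M%:R) ^+ 2.
have KM0 : 0 <= KM by rewrite mulr_ge0 ?sqr_ge0.
pose Phi w := \1_(cap V1 V2 c0) w * trig_sqr (fun k : 'I_M => A k) (fun k => gg k) (r *: w).
pose Phi2 w := \1_(cap V1 V2 c0) w *
  trig_sqr (@pair_coef _ M A) (@pair_freq _ _ M gg) (r *: w).
have Phi0 w : 0 <= Phi w by rewrite mulr_ge0 ?trig_sqr_ge0.
have Phi20 w : 0 <= Phi2 w by rewrite mulr_ge0 ?trig_sqr_ge0.
have mcap := measurable_indic (measurable_cap V1 V2 c0).
have mPhi : measurable_fun setT Phi.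
  by apply: measurable_funM => //; exact: measurable_trig_sqr.
have mPhi2 : measurable_fun setT Phi2.
  by apply: measurable_funM => //; exact: measurable_trig_sqr.
have PhiPhi2 w : Phi w ^+ 2 <= 8 * Phi2 w + 4 * (M%:R * X ^+ 2) ^+ 2.
  have h4 : 0 <= 4 * (M%:R * X ^+ 2) ^+ 2 by rewrite mulr_ge0 ?sqr_ge0.
  rewrite /Phi /Phi2 indicE; case: (w \in _).
    by rewrite !mul1r; exact: trig_sqr_sqr_le.
  by rewrite !mul0r expr0n/= mulr0 add0r.
have mF := measurable_osc_sqr gC2 hC1 ac (ltW ce) eb (ltW r0).
have F0 w : 0 <= osc_sqr h g c e r w by exact: osc_sqr_ge0.
have r2' : r ^+ 2 != 0 by rewrite gt_eqF// exprn_gt0.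
have Ebd : (X + X * (r * D)) * L ^+ 2 / M%:R <= KE / r.
  rewrite ler_pdivrMr// /KE.
  apply: (@le_trans _ _ (X * (1 + D) * L ^+ 2 / r * r ^+ 2)); last first.
    by rewrite ler_wpM2l// divr_ge0 ?(ltW r0)// mulr_ge0 ?sqr_ge0// mulr_ge0//; lra.
  rewrite (_ : X * (1 + D) * L ^+ 2 / r * r ^+ 2 = (X * (r + r * D)) * L ^+ 2); last first.
    by field; rewrite gt_eqF.
  rewrite ler_wpM2r ?sqr_ge0// -{1}(mulr1 X) -mulrDr ler_wpM2l// lerD2r ltW//.
have point w : sphere w -> osc_sqr h g c e r w <= KA / r + KM * Phi w.
  move=> w1; have [wc|wc] := pselect (cap V1 V2 c0 w); last first.
    apply: le_trans (hoff r w r2 w1 wc) _.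
    rewrite -[leLHS]addr0; apply: lerD; last exact: mulr_ge0.
    by rewrite ler_wpM2r ?invr_ge0 ?(ltW r0)// lerDl mulr_ge0 ?sqr_ge0.
  have := osc_sqr_riemann gC2 hC1 D0 g1D X0 hX h1X (A := A) ac (ltW ce) eb (ltW r0) M0 w1 _.
  move=> H; apply: (le_trans (H _)); first by move=> k kM; rewrite /A kM.
  rewrite /Phi indicE mem_set// mul1r addrC -/L -/KM lerD2r.
  apply: (@le_trans _ _ (4 * (KE / r) ^+ 2)).
    rewrite ler_wpM2l// ler_pXn2r ?nnegrE ?divr_ge0 ?(ltW r0)//.
    rewrite -/L; do ?[rewrite divr_ge0//]; rewrite mulr_ge0 ?sqr_ge0// addr_ge0// !mulr_ge0//; exact: ltW.
  rewrite expr_div_n mulrA; apply: (@le_trans _ _ (4 * KE ^+ 2 / r)).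
    rewrite ler_wpM2l//; first by rewrite mulr_ge0// sqr_ge0.
    by rewrite lef_pV2 ?posrE ?exprn_gt0// expr2 ler_pMl// ltW//.
  by rewrite ler_wpM2r ?invr_ge0 ?(ltW r0)// lerDr.
have KAr0 : 0 <= KA / r by rewrite divr_ge0// ltW.
split.
  apply: le_trans (surface_le mF _ F0 _ point) _.
  - by apply: measurable_funD => //; apply: measurable_funM.
  - by move=> w; rewrite addr_ge0// mulr_ge0.
  apply: le_trans (surface_integral_affine mPhi Phi0 KAr0 KM0 hS i1) _.
  rewrite lee_fin [leLHS](_ : _ = CA / r); last first.
    by rewrite /CA /KM; field; rewrite !gt_eqF.
  by rewrite ler_wpM2r ?invr_ge0 ?(ltW r0)// lerDl.
(* The last term accounts for the diagonal of the squared sum, of size [L ^+ 4 * X ^+ 4 / M%:R ^+ 2]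
   and small enough because [r <= M%:R]. *)
pose B := 2 * (KA / r) ^+ 2 + 32 * L ^+ 4 * X ^+ 4 / r ^+ 2.
have X40 : 0 <= X ^+ 4 by rewrite exprn_ge0.
have L40 : 0 <= L ^+ 4 by rewrite exprn_ge0// ltW.
have B0 : 0 <= B.
  have p1 : 0 <= 2 * (KA / r) ^+ 2 by apply: mulr_ge0 => //; exact: sqr_ge0.
  rewrite addr_ge0// divr_ge0//; last exact: sqr_ge0.
  by do 2 apply: mulr_ge0 => //.
have point2 w : sphere w -> osc_sqr h g c e r w ^+ 2 <= B + 16 * KM ^+ 2 * Phi2 w.
  move=> w1; apply: (@le_trans _ _ ((KA / r + KM * Phi w) ^+ 2)).
    by rewrite ler_pXn2r ?nnegrE ?point// addr_ge0// mulr_ge0.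
  apply: (@le_trans _ _ (2 * (KA / r) ^+ 2 + 2 * KM ^+ 2 * Phi w ^+ 2)).
    rewrite -subr_ge0 (_ : _ - _ = (KA / r - KM * Phi w) ^+ 2) ?sqr_ge0//; ring.
  rewrite /B -addrA lerD2l.
  apply: (@le_trans _ _ (2 * KM ^+ 2 * (8 * Phi2 w + 4 * (M%:R * X ^+ 2) ^+ 2))).
    by rewrite ler_wpM2l// mulr_ge0// sqr_ge0.
  rewrite [leLHS](_ : _ = 32 * L ^+ 4 * X ^+ 4 / M%:R ^+ 2 + 16 * KM ^+ 2 * Phi2 w); last first.
    by rewrite /KM; field; rewrite gt_eqF.
  rewrite lerD2r.
  rewrite ler_wpM2l//; first by rewrite mulr_ge0// mulr_ge0.
  by rewrite lef_pV2 ?posrE ?exprn_gt0// ler_pXn2r ?nnegrE ?(ltW r0) ?(ltW MR).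
have mF2 : measurable_fun setT (fun w => osc_sqr h g c e r w ^+ 2) by exact: measurable_funX.
have KM20 : 0 <= 16 * KM ^+ 2 by rewrite mulr_ge0// sqr_ge0.
apply: le_trans (surface_le mF2 _ (fun w => sqr_ge0 _) _ point2) _.
- by apply: measurable_funD => //; apply: measurable_funM.
- by move=> w; rewrite addr_ge0// mulr_ge0.
apply: le_trans (surface_integral_affine mPhi2 Phi20 B0 KM20 hS i2) _.
rewrite lee_fin.
have lr : ln 2 <= ln r by rewrite ler_ln ?posrE.
have lr0 : 0 <= ln r := le_trans (ltW l2) lr.
have lM : 1 + ln M%:R <= KL * ln r by exact: one_ln_le.
rewrite [leLHS](_ : _ = (2 * KA ^+ 2 + 32 * L ^+ 4 * X ^+ 4) * S / r ^+ 2 +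
   64 * L * C1 * X ^+ 4 * (1 + ln M%:R) / r ^+ 2); last first.
  by rewrite /B /KM; field; rewrite !gt_eqF.
rewrite -mulrDl ler_wpM2r ?invr_ge0 ?sqr_ge0//.
rewrite [leRHS]mulrDl -[leLHS]add0r; apply: lerD; first exact: mulr_ge0.

rewrite /CB [leRHS]mulrDl; apply: lerD.
  rewrite [leRHS]mulrAC ler_pdivlMr// ler_wpM2l//.
  have q1 : 0 <= 2 * KA ^+ 2 by apply: mulr_ge0 => //; exact: sqr_ge0.
  have q2 : 0 <= 32 * L ^+ 4 * X ^+ 4 by do 2 apply: mulr_ge0 => //.
  by apply: mulr_ge0 => //; exact: addr_ge0.
by rewrite -[leRHS]mulrA ler_wpM2l// mulr_ge0// mulr_ge0// mulr_ge0// ltW.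
Qed.

Lemma osc_moments_add c m e : a <= c -> c <= m -> m <= e -> e <= b ->
  osc_moments h g c m -> osc_moments h g m e -> osc_moments h g c e.
Proof.
move=> ac cm me eb [C1 C10 H1] [C2 C20 H2].
exists (8 * C1 + 8 * C2) => [|r r2]; first by rewrite addr_ge0// mulr_ge0.
have [i1 i2] := H1 r r2; have [j1 j2] := H2 r r2.
have r0 : 0 <= r by lra.
have mb := le_trans me eb; have am := le_trans ac cm.
have mf := measurable_osc_sqr gC2 hC1 ac cm mb r0.
have mk := measurable_osc_sqr gC2 hC1 am me eb r0.
have mF := measurable_osc_sqr gC2 hC1 ac (le_trans cm me) eb r0.
have l0 : 0 <= ln r by apply: ln_ge0; lra.
have p w : osc_sqr h g c e r w <= 2 * osc_sqr h g c m r w + 2 * osc_sqr h g m e r w.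
  exact: (osc_sqr_split gC2 hC1).
have lin := @surface_integral_lin R n.
split.
  apply: le_trans (surface_le mF _ (osc_sqr_ge0 _ _ _ _ _) _ (fun w _ => p w)) _.
  - by apply: measurable_funD; apply: measurable_funM.
  - by move=> w; rewrite addr_ge0// mulr_ge0// osc_sqr_ge0.
  apply: le_trans (lin _ _ 2 _ _ mf mk (osc_sqr_ge0 _ _ _ _ _) (osc_sqr_ge0 _ _ _ _ _) _ i1 j1) _ => //.
  rewrite lee_fin !mulrA -mulrDl ler_wpM2r ?invr_ge0//; lra.
have p2 w : osc_sqr h g c e r w ^+ 2 <=
    8 * osc_sqr h g c m r w ^+ 2 + 8 * osc_sqr h g m e r w ^+ 2.
  have q := osc_sqr_ge0 g h c e r w; move: (p w) q.
  have := osc_sqr_ge0 g h c m r w; have := osc_sqr_ge0 g h m e r w.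
  move: (osc_sqr h g c e r w) (osc_sqr h g c m r w) (osc_sqr h g m e r w) => x y z z0 y0 le x0.
  apply: (@le_trans _ _ ((2 * y + 2 * z) ^+ 2)).
    by rewrite ler_pXn2r ?nnegrE// addr_ge0// mulr_ge0.
  by rewrite -subr_ge0 (_ : _ - _ = 4 * (y - z) ^+ 2); [rewrite mulr_ge0//; exact: sqr_ge0|ring].
apply: le_trans (surface_le (measurable_funX 2 mF) _ (fun w => sqr_ge0 _) _ (fun w _ => p2 w)) _.
- by apply: measurable_funD; apply: measurable_funM => //; exact: measurable_funX.
- by move=> w; rewrite addr_ge0// mulr_ge0// sqr_ge0.
apply: le_trans (lin _ _ 8 _ _ (measurable_funX 2 mf) (measurable_funX 2 mk)
  (fun w => sqr_ge0 _) (fun w => sqr_ge0 _) _ i2 j2) _ => //.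
by rewrite lee_fin le_eqVlt; apply/orP; left; apply/eqP; ring.
Qed.

Lemma osc_moments_le : a <= b ->
  (forall t, a <= t <= b ->
    0 < dotp (g1 t) (g1 t) * dotp (g2 t) (g2 t) - dotp (g1 t) (g2 t) ^+ 2) ->
  osc_moments h g a b.
Proof.
move=> ab gram; apply: (interval_induction ab) => [c m e ac cm me eb|t tab].
  exact: osc_moments_add.
exact: osc_moments_local (gram t tab).
Qed.

End local_moments.

(** * Sign changes and the weak-type estimate *)

Section sign_partition.
Context {R : realType}.
Implicit Types (f : R -> R) (c e x y z : R).

Lemma cont_pos_near f x : {for x, continuous f} -> 0 < f x ->
  exists2 del : R, 0 < del & forall t, `|t - x| < del -> 0 < f t.
Proof.
move=> /cvgrPdist_lt cf fx.
have [del /= del0 h] := (nbhs_ballP _ _).1 (cf _ fx).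
exists del => // t tx; have := h t; rewrite /ball/= distrC => /(_ tx).
by rewrite ltr_norml; lra.
Qed.

(** [P k x y] stands for a bound obtained from [k] pieces of constant sign. The first piece ends at
    the infimum of the points of the wrong sign; beyond it the search continues with the opposite
    sign, one alternation having been used up. At most [N] changes mean alternating chains of at
    most [N.+1] points; the count [N.+2] has one more piece because the initial sign is guessed. *)
Lemma sign_partition c e f (P : nat -> R -> R -> Prop) N : c <= e ->
  (forall t, c <= t <= e -> {for t, continuous f}) ->
  (forall x y, c <= x -> x <= y -> y <= e ->
     (forall t, x <= t <= y -> 0 <= f t) \/ (forall t, x <= t <= y -> f t <= 0) -> P 1%N x y) ->
  (forall k l x y z, c <= x -> x <= y -> y <= z -> z <= e ->
     P k x y -> P l y z -> P (k + l)%N x z) ->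
  sign_changes_le `[c, e] f N -> P N.+2 c e.
Proof.
move=> ce cf mono add sc.
pose alt := fun t u => (t < u) && (f t * f u < 0).
have point y : c <= y -> y <= e -> P 1%N y y.
  move=> cy ye; apply: mono => //; have [f0|f0] := leP 0 (f y); [left|right] => t;
  by rewrite -eq_le => /eqP <- //; exact: ltW.
have points k : P k.+1 e e.
  elim: k => [|k IH]; first exact: point.
  by rewrite -add1n; apply: (add _ _ e e e) => //; exact: point.
have const sg x y : sg * sg = 1 -> c <= x -> x <= y -> y <= e ->
    (forall t, x <= t <= y -> 0 <= sg * f t) -> P 1%N x y.
  move=> sg1 cx xy ye f0; apply: mono => //.
  have [sgE|sgE] : sg = 1 \/ sg = -1.
  - by move/eqP: sg1; rewrite -expr2 sqrf_eq1 => /orP[] /eqP; [left|right].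
  - by left => t /f0; rewrite sgE mul1r.
  - by right => t /f0; rewrite sgE mulN1r oppr_ge0.
(* [k] bounds the length of the alternating chains in [[x, e]] that start with the sign opposite to
   [sg]. *)
suff key k sg x : sg * sg = 1 -> c <= x -> x <= e ->
    (forall y s, {in y :: s, forall t, x <= t <= e} -> sorted alt (y :: s) ->
       sg * f y < 0 -> (size (y :: s) <= k)%N) -> P k.+1 x e.
  apply: (key N.+1 1 c) => //; first by rewrite mulr1.
  by move=> y s hs so _; apply: sc => // t /hs; rewrite /= in_itv.
elim: k sg x => [|k IH] sg x sg1 cx xe hk.
  apply: (const sg) => // t ht; rewrite leNgt; apply/negP => ft.
  have := hk t [::]; rewrite /= ltnn => H; suff : false by []; apply: H => //.
  by move=> u; rewrite inE => /eqP ->.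
have cfs t : c <= t <= e -> {for t, continuous (fun u => sg * f u)}.
  by move=> ht; apply: cvgM; [exact: cvg_cst|exact: cf].
pose A := [set y | x <= y <= e /\ sg * f y < 0].
have [[y0 Ay0]|A0] := pselect (exists y, A y).
  have lbA : has_lbound A by exists x => y [/andP[]].
  have infA : has_inf A by split => //; exists y0.
  pose s := inf A.
  have xs : x <= s by apply: lb_le_inf; [exists y0|move=> y [/andP[]]].
  have se : s <= e.
    by apply: le_trans (ge_inf lbA Ay0) _; case: Ay0 => /andP[].
  have below t : x <= t -> t < s -> 0 <= sg * f t.
    move=> xt ts; rewrite leNgt; apply/negP => ft.
    have : s <= t by apply: (ge_inf lbA); split => //; rewrite xt (le_trans (ltW ts)).
    by rewrite leNgt ts.
  have fs0 : x < s -> 0 <= sg * f s.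
    move=> xs'; rewrite leNgt; apply/negP => fs.
    have cN : {for s, continuous (fun u => - (sg * f u))}.
      by apply: cvgN; apply: cfs; rewrite (le_trans cx xs).
    have [|del del0 hdel] := cont_pos_near cN; first by rewrite oppr_gt0.
    pose t := Num.max x (s - del / 2).
    have xt : x <= t by rewrite le_max lexx.
    have st : s - del / 2 <= t by rewrite le_max lexx orbT.
    have ts : t < s by rewrite gt_max xs'; lra.
    have := hdel t; rewrite ltr0_norm ?subr_lt0// => /(_ _)-/(_ _).
    have := below t xt ts; have h' : - (t - s) < del by lra.
    by move=> b /(_ h'); lra.
  have P1 : P 1%N x s.
    move: xs; rewrite le_eqVlt => /predU1P[<-|xs]; first exact: point.
    apply: (const sg) => //; first exact: ltW.
    move=> t /andP[xt]; rewrite le_eqVlt => /predU1P[->|ts]; [exact: fs0|exact: below].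
  have P2 : P k.+1 s e.
    apply: (IH (- sg)) => //; first by rewrite mulrNN.
      exact: le_trans cx xs.
    move=> y l hl sl fy.
    have fy' : 0 < sg * f y by move: fy; rewrite mulNr oppr_lt0.
    have /andP[sy ye] : s <= y <= e by apply: hl; rewrite inE eqxx.
    (* The chain starting at [y] is prolonged to the left by a point of [A] found near the infimum.
       The case [y = s] is impossible: [sg * f] would be positive near [s], where [A] has points. *)
    have [z Az zy] : exists2 z, A z & z < y.
      move: sy; rewrite le_eqVlt => /predU1P[sE|sy]; last first.
        by have [|z Az hz] := inf_adherent (_ : 0 < y - s) infA; [rewrite subr_gt0|exists z => //; move: hz; rewrite /s; lra].
      have [|del del0 hdel] := @cont_pos_near (fun u => sg * f u) y _ fy'.
        by apply: cfs; rewrite -sE (le_trans cx xs).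
      have [z [zx fz] hz] := inf_adherent del0 infA.
      have sz : s <= z by apply: (ge_inf lbA); split.
      have := hdel z; rewrite -sE ger0_norm ?subr_ge0// => H.
      have : 0 < sg * f z by apply: H; move: hz; rewrite -/s; lra.
      by rewrite ltNge (ltW fz).
    have [/andP[xz ze] fz] := Az.
    suff : (size (z :: y :: l) <= k.+1)%N by [].
    apply: hk => // [t|].
      rewrite inE => /predU1P[->|/hl /andP[st te]]; first by rewrite xz.
      by rewrite (le_trans xs st).
    rewrite /= [path _ _ _]sl andbT /alt zy/=.
    have -> : f z * f y = (sg * f z) * (sg * f y) by rewrite mulrACA sg1 mul1r.
    by rewrite pmulr_llt0.
  by rewrite -add1n; exact: (add _ _ x s e).
(* Without a wrong sign there is one genuine piece, padded with degenerate pieces at [e]. *)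
rewrite -add1n; apply: (add _ _ x e e) => //.
apply: (const sg) => // t ht; rewrite leNgt; apply/negP => ft.
by apply: A0; exists t; split.
Qed.

End sign_partition.

Section dual_vectors.
Context {R : realType} {n : nat}.
Implicit Types (u w V : 'rV[R]_n).

(** [U0] and [W0] form the dual basis of [V1], [V2] given by the inverse Gram matrix. For [u], [w]
    nearby, their pairings with [U0], [W0] form a matrix within 1/4 of the identity entrywise;
    Cramer's rule corrects the basis, with determinant at least 9/16 - 1/16 = 1/2. *)
Lemma dual_vectors V1 V2 :
  0 < dotp V1 V1 * dotp V2 V2 - dotp V1 V2 ^+ 2 ->
  exists eta D : R, [/\ 0 < eta, 0 <= D & forall u w,
    enorm (u - V1) <= eta -> enorm (w - V2) <= eta ->
    exists U W, [/\ dotp U u = 1, dotp U w = 0, dotp W u = 0, dotp W w = 1 &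
      enorm U <= D /\ enorm W <= D]].
Proof.
set gr := (X in 0 < X) => gr0; have gn : gr != 0 by rewrite gt_eqF.
pose U0 := gr^-1 *: (dotp V2 V2 *: V1 - dotp V1 V2 *: V2).
pose W0 := gr^-1 *: (dotp V1 V1 *: V2 - dotp V1 V2 *: V1).
have E11 : dotp U0 V1 = 1.
  by rewrite /U0 dotpZl dotpBl !dotpZl (dotpC V2 V1); rewrite /gr in gn *; field.
have E12 : dotp U0 V2 = 0.
  by rewrite /U0 dotpZl dotpBl !dotpZl; ring.
have E21 : dotp W0 V1 = 0.
  by rewrite /W0 dotpZl dotpBl !dotpZl (dotpC V2 V1); ring.
have E22 : dotp W0 V2 = 1.
  by rewrite /W0 dotpZl dotpBl !dotpZl; rewrite /gr in gn *; field.
clearbody U0 W0.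
pose D0 := enorm U0 + enorm W0 + 1.
have U00 := enorm_ge0 U0; have W00 := enorm_ge0 W0.
have D00 : 0 < D0 by rewrite ltr_wpDl// addr_ge0.
exists (1 / (4 * D0)), (3 * D0); split.
- by rewrite divr_gt0// mulr_gt0.
- by rewrite mulr_ge0// ltW.
move=> u w hu hw.
have near Z V z : enorm Z <= D0 -> enorm (z - V) <= 1 / (4 * D0) ->
    `|dotp Z z - dotp Z V| <= 1 / 4.
  move=> hZ hz; rewrite -dotpBr; apply: le_trans (dotp_le _ _) _.
  rewrite (_ : 1 / 4 = D0 * (1 / (4 * D0))); last by field; rewrite gt_eqF.
  by apply: ler_pM; rewrite ?enorm_ge0.
have hU : enorm U0 <= D0 by rewrite /D0; lra.
have hW : enorm W0 <= D0 by rewrite /D0; lra.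
have := near _ _ _ hU hu; have := near _ _ _ hU hw; have := near _ _ _ hW hu; have := near _ _ _ hW hw.
rewrite E11 E12 E21 E22 !subr0.
set al := dotp U0 u; set be := dotp U0 w; set ga := dotp W0 u; set de := dotp W0 w.
rewrite !ler_norml => /andP[d1 d2] /andP[c1 c2] /andP[b1 b2] /andP[a1 a2].
pose Dt := al * de - be * ga.
have Dt2 : 1 / 2 <= Dt by rewrite /Dt; nra.
have Dt0 : al * de - be * ga != 0 by rewrite -/Dt gt_eqF//; lra.
exists (Dt^-1 *: (de *: U0 - be *: W0)), (Dt^-1 *: (al *: W0 - ga *: U0)).
rewrite !dotpZl !dotpBl !dotpZl -/al -/be -/ga -/de; split.
- by rewrite /Dt; field.
- by ring.
- by ring.
- by rewrite /Dt; field.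
have Di : `|Dt^-1| <= 2.
  rewrite ger0_norm ?invr_ge0; last by lra.
  by rewrite -[leRHS]invrK lef_pV2 ?posrE; lra.
have comb x y : `|x| <= 5 / 4 -> `|y| <= 1 / 4 -> forall U W, enorm U <= D0 -> enorm W <= D0 ->
    enorm (Dt^-1 *: (x *: U - y *: W)) <= 3 * D0.
  move=> hx hy U W hU' hW'; rewrite enormZ.
  apply: (@le_trans _ _ (2 * (5 / 4 * D0 + 1 / 4 * D0))); last by lra.
  apply: ler_pM => //; first exact: enorm_ge0.
  apply: le_trans (enormB _ _) _; rewrite !enormZ.
  by apply: lerD; apply: ler_pM; rewrite ?enorm_ge0.
have hde : `|de| <= 5 / 4 by rewrite ler_norml; move: d1 d2; clear; lra.
have hal : `|al| <= 5 / 4 by rewrite ler_norml; move: a1 a2; clear; lra.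
by split; apply: comb => //; rewrite ler_norml ?b1 ?b2 ?c1 ?c2.
Qed.

End dual_vectors.

(** * Measure of the directions with a large transform *)

Section weak_type.
Context {R : realType} {n : nat}.
Local Notation sigma := (@surface_measure R n).
Implicit Types (w : 'rV[R]_n) (c e r : R).

(** The interval from [u] to [v] is longer than two meshes, so it contains the first grid point to
    the right of [u] and the next one. *)
Lemma grid_mem (c e u v kap : R) (m : nat) : c < e -> (0 < m)%N -> c <= u -> v <= e ->
  kap <= v - u -> (e - c) / m%:R < kap / 2 ->
  exists2 k : nat, (k < m)%N &
    u < c + (e - c) / m%:R * k%:R /\ c + (e - c) / m%:R * k.+1%:R < v.
Proof.
move=> ce m0 cu ve kv; set d := (_ / _) => dk.
have mR : 0 < m%:R :> R by rewrite ltr0n.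
have d0 : 0 < d by rewrite divr_gt0// subr_gt0.
pose x := (u - c) / d; have x0 : 0 <= x by rewrite divr_ge0 ?(ltW d0)// subr_ge0.
have x1 : (Num.truncn x)%:R <= x by rewrite truncn_le.
have x2 : x < (Num.truncn x).+1%:R by rewrite -truncn_lt_nat.
have e1 : d * (Num.truncn x)%:R <= u - c by rewrite mulrC -ler_pdivlMr.
have e2 : u - c < d * (Num.truncn x).+1%:R by rewrite mulrC -ltr_pdivrMr.
have e3 : c + d * (Num.truncn x).+2%:R < v by move: e1; rewrite -!natr1; lra.
exists (Num.truncn x).+1; last by split => //; lra.
rewrite ltnW// -(ltr_nat R) -(ltr_pM2l d0).
have -> : d * m%:R = e - c by rewrite /d; field; rewrite gt_eqF.
lra.
Qed.

Lemma measurable_slab (u v : 'rV[R]_n) (e1 e2 : R) :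
  measurable [set x : 'rV[R]_n | `|dotp x u| <= e1 /\ `|dotp x v| <= e2].
Proof.
have h (V : 'rV[R]_n) c0 : measurable [set w : 'rV[R]_n | `|dotp w V| <= c0].
  rewrite (_ : [set w | _] = (fun x => dotp x V) @^-1` `[(- c0), c0]).
    by rewrite -[X in measurable X]setTI; apply: measurable_dotpl.
  by apply/seteqP; split => x /=; rewrite in_itv /= ler_norml.
exact: (measurableI _ _ (h u e1) (h v e2)).
Qed.

Let half (z : R) : 0 <= z -> z / (2 * (z + 1)) <= 1 / 2.
Proof. by move=> z0; rewrite ler_pdivrMr; lra. Qed.

Let count_le (y z : R) : 1 <= y -> z <= 2 * y -> z + 1 <= 3 * y.
Proof. lra. Qed.

Let level_lt (lam q : R) : 0 < lam -> lam < q -> q <= 2 * (lam / 2 ^+ 2) -> False.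
Proof. lra. Qed.

(** [lam] is a level of the squared modulus, so this is the weak L^4 bound at level
    [Num.sqrt lam]. *)
Definition osc_weak (h : R -> R) (g : R -> 'rV[R]_n) c e :=
  exists2 C : R, 0 <= C & forall r lam : R, 2 <= r -> 0 < lam ->
    (sigma [set w : 'rV[R]_n | sphere w /\ (lam < osc_sqr h g c e r w)%R] <=
       (C / (r * lam) ^+ 2)%:E)%E.

Variables (a b : R) (g g1 g2 : R -> 'rV[R]_n) (h h1 : R -> R) (N : nat).
Hypothesis gC2 : curve_C2 a b g g1 g2.
Hypothesis hC1 : amplitude_C1 h h1.
Hypothesis sgn : forall w, sphere w -> sign_changes_le `[a, b] (fun s => dotp w (g2 s)) N.

(** If on every piece of constant sign of [dotp w (g2 s)] the slow part were shorter than [kap],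
    each piece would contribute at most [rho], and [N.+2] of them could not exceed [N.+2%:R * rho].
    The property [P] carries this alternative, which is additive over pieces. *)
Lemma osc_large_interval c e w r (del kap rho X : R) : a <= c -> c <= e -> e <= b ->
  sphere w -> 0 < r -> 0 < del -> 0 <= X ->
  (forall t, a <= t <= b -> `|h t| <= X) -> (forall t, a <= t <= b -> `|h1 t| <= X) ->
  2 * (4 * X + X * (e - c)) / (r * del) + X * kap <= rho ->
  (exists al, N.+2%:R * rho < `|osc h g c e r w al|) ->
  exists u v, [/\ c <= u, v <= e, kap <= v - u &
    forall t, u < t < v -> `|dotp w (g1 t)| <= del].
Proof.
move=> ac ce eb w1 r0 del0 X0 hX h1X hrho [al big].
pose P k x y := `|osc h g x y r w al| <= k%:R * rho \/
  exists u v, [/\ x <= u, v <= y, kap <= v - u &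
    forall t, u < t < v -> `|dotp w (g1 t)| <= del].
have [dg dg1 cg2] := gC2.
suff : P N.+2 c e by case=> // /(lt_le_trans big); rewrite ltxx.
apply: (@sign_partition _ c e (fun s => dotp w (g2 s)) P N ce).
- by move=> t /andP[ct te]; apply: cg2; rewrite (le_trans ac)// (le_trans te).
- move=> x y cx xy ye sg.
  have [u [v [xu uv vy small hb]]] := osc_monotone gC2 hC1 hX h1X
    (le_trans ac cx) xy (le_trans ye eb) del0 sg.
  have [kv|vk] := leP kap (v - u); first by right; exists u, v.
  left; rewrite mul1r; apply: le_trans (hb r al r0) _; apply: le_trans hrho.
  apply: lerD; last by rewrite ler_wpM2l// ltW.
  rewrite ler_wpM2r ?invr_ge0 ?mulr_ge0 ?(ltW r0) ?(ltW del0)// ler_wpM2l//.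
  by rewrite lerD2l ler_wpM2l// lerB.
- move=> k l x y z cx xy yz ze [Pk|[u [v [xu vy kv small]]]]; last first.
    by move=> _; right; exists u, v; split => //; exact: le_trans vy yz.
  case=> [Pl|[u [v [yu vz kv small]]]]; last first.
    by right; exists u, v; split => //; exact: le_trans xy yu.
  left; rewrite (osc_split gC2 hC1 r w al (le_trans ac cx) xy yz (le_trans ze eb)).
  by rewrite natrD mulrDl; apply: le_trans (ler_normD _ _) (lerD _ _).
- move=> s hs so; apply: (sgn w1) => // t /hs; rewrite /= !in_itv/= => /andP[ct te].
  by rewrite (le_trans ac)// (le_trans te).
Qed.

Lemma osc_weak_self c : osc_weak h g c c.
Proof.
exists 0 => // r lam _ lam0.
have z w : osc_sqr h g c c r w = 0 by rewrite /osc_sqr !osc_self expr0n/= addr0.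
rewrite (_ : [set w | _] = set0) ?measure0 ?mul0r//.
by apply/seteqP; split => w //= [_]; rewrite z ltNge (ltW lam0).
Qed.

Lemma measurable_osc_level c e r (lam : R) : a <= c -> c <= e -> e <= b -> 0 <= r ->
  measurable [set w | sphere w /\ lam < osc_sqr h g c e r w].
Proof.
move=> ac ce eb r0.
suff H : measurable [set w : 'rV[R]_n | lam < osc_sqr h g c e r w].
  exact: (measurableI _ _ measurable_sphere H).
rewrite (_ : [set w | _] = (osc_sqr h g c e r) @^-1` `]lam, +oo[).
  rewrite -[X in measurable X]setTI.
  exact: (measurable_osc_sqr gC2 hC1).
by apply/seteqP; split => w /=; rewrite in_itv/= andbT.
Qed.

Lemma osc_weak_add c m e : a <= c -> c <= m -> m <= e -> e <= b ->
  osc_weak h g c m -> osc_weak h g m e -> osc_weak h g c e.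
Proof.
move=> ac cm me eb [C1 C10 H1] [C2 C20 H2].
exists (16 * C1 + 16 * C2) => [|r lam r2 lam0]; first by rewrite addr_ge0// mulr_ge0.
have r0 : 0 <= r by lra.
have l0 : 0 < lam / 4 by rewrite divr_gt0.
have mb := le_trans me eb; have am := le_trans ac cm.
pose A x y l := [set w : 'rV[R]_n | sphere w /\ l < osc_sqr h g x y r w].
have mA x y l : a <= x -> x <= y -> y <= b -> measurable (A x y l).
  by move=> ax xy yb; exact: measurable_osc_level.
apply: (@le_trans _ _ (sigma (A c m (lam / 4) `|` A m e (lam / 4)))).
  apply: le_measure; rewrite ?inE.
  - exact: (mA _ _ _ ac (le_trans cm me) eb).
  - by apply: measurableU; [exact: (mA _ _ _ ac cm mb)|exact: (mA _ _ _ am me eb)].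
  move=> w [w1 hw]; have := osc_sqr_split gC2 hC1 r w ac cm me eb => hs.
  have [h'|h'] := ltP (lam / 4) (osc_sqr h g c m r w); [left|right]; split => //.
  by move: hw hs h'; lra.
apply: le_trans (measureU2 _ _ _) _; [exact: (mA _ _ _ ac cm mb)|exact: (mA _ _ _ am me eb)|].
apply: le_trans (leeD (H1 r _ r2 l0) (H2 r _ r2 l0)) _.
rewrite -EFinD lee_fin le_eqVlt; apply/orP; left; apply/eqP.
by field; apply/andP; split; rewrite gt_eqF//; lra.
Qed.

(** With [tau = Num.sqrt lam], the tolerance [del] is of size 1/(r tau), while [kap] and the mesh
    [d] are of size tau. A slab has measure O(del^2 / d), that is O(r^-2 tau^-3), and O(1/tau) slabs
    suffice: in total O(r^-2 tau^-4), which is O((r lam)^-2). *)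
Lemma osc_weak_local t0 : a <= t0 <= b ->
  0 < dotp (g1 t0) (g1 t0) * dotp (g2 t0) (g2 t0) - dotp (g1 t0) (g2 t0) ^+ 2 ->
  exists2 del : R, 0 < del & forall c e, a <= c -> c <= e -> e <= b ->
    t0 - del <= c -> e <= t0 + del -> osc_weak h g c e.
Proof.
move=> t0ab gram; have [dg dg1 cg2] := gC2.
have ab : a <= b by case/andP: t0ab; exact: le_trans.
set V1 := g1 t0 in gram *; set V2 := g2 t0 in gram *.
have [eta [D [eta0 D0 hdual]]] := dual_vectors gram.
have [C C0 hslab] := @surface_slab_le R n D D0.
have [X [X0 hX h1X]] := amplitude_C1_bounded hC1 ab.
have [del1 del10 near1] := @curve_near _ _ g1 t0 eta eta0 (fun w => isder_cont (dg1 t0 t0ab w)).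
have [del2 del20 near2] := @curve_near _ _ g2 t0 eta eta0 (cg2 t0 t0ab).
exists (Num.min del1 del2) => [|c e ac ce eb]; first by rewrite lt_min del10.
rewrite le_eqVlt in ce; case/predU1P: ce => [<- _ _|ce dc de].
  exact: osc_weak_self.
have hV1 t : c <= t <= e -> enorm (g1 t - V1) <= eta.
  move=> /andP[ct te]; apply: near1; have : Num.min del1 del2 <= del1 by rewrite ge_min lexx.
  by rewrite ler_norml; lra.
have hV2 t : c <= t <= e -> enorm (g2 t - V2) <= eta.
  move=> /andP[ct te]; apply: near2; have : Num.min del1 del2 <= del2 by rewrite ge_min lexx orbT.
  by rewrite ler_norml; lra.
pose L := e - c; have L0 : 0 < L by rewrite subr_gt0.
pose Nn : R := N.+2%:R; have Nn0 : 0 < Nn by rewrite ltr0n.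
pose Y := 4 * X + X * L; have Y0 : 0 <= Y by rewrite addr_ge0// mulr_ge0// ltW.
(* [K1] and [K2] make the nonstationary part and the slow part each at most half of [rho]; the [+ 1]
   keeps them meaningful when [X = 0]. *)
pose K1 := 4 * (Y + 1) * (2 * Nn); have K10 : 0 < K1.
  by rewrite !mulr_gt0//; lra.
pose K2 := (2 * Nn * (2 * (X + 1)))^-1.
have K20 : 0 < K2 by rewrite invr_gt0 !mulr_gt0//; lra.
exists (18 * C * L * K1 ^+ 2 / K2 ^+ 2) => [|r lam r2 lam0].
  by rewrite divr_ge0 ?sqr_ge0// mulr_ge0 ?sqr_ge0// mulr_ge0 ?(ltW L0)// mulr_ge0.
have r0 : 0 < r by apply: lt_le_trans r2.
pose tau := Num.sqrt lam; have tau0 : 0 < tau by rewrite sqrtr_gt0.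
have tau2 : tau ^+ 2 = lam by rewrite sqr_sqrtr// ltW.
pose rho := tau / (2 * Nn); have rho0 : 0 < rho by rewrite divr_gt0// mulr_gt0.
pose del := K1 / (r * tau); have del0 : 0 < del by rewrite divr_gt0// mulr_gt0.
pose kap := K2 * tau; have kap0 : 0 < kap by rewrite mulr_gt0.
pose A := [set w : 'rV[R]_n | sphere w /\ lam < osc_sqr h g c e r w].
have long w : A w -> exists u v, [/\ c <= u, v <= e, kap <= v - u &
    forall t, u < t < v -> `|dotp w (g1 t)| <= del].
  move=> [w1 hw].
  apply: (@osc_large_interval c e w r del kap rho X) => //; first exact: ltW.
    rewrite -/L -/Y.
    have -> : 2 * Y / (r * del) = rho * (Y / (2 * (Y + 1))).
      rewrite /del /K1 /rho; field; rewrite !gt_eqF// ltr_wpDl//.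
    have -> : X * kap = rho * (X / (2 * (X + 1))).
      by rewrite /kap /K2 /rho; field; rewrite !gt_eqF// ltr_wpDl//.
    rewrite -mulrDr -[leRHS]mulr1 ler_wpM2l ?(ltW rho0)//.
    by apply: le_trans (lerD (half Y0) (half X0)) _; rewrite -splitr.
  apply/not_existsP => hn.
  (* If no phase shift gave a large value, [osc_sqr] would be at most [lam / 2], below the level. *)
  have : osc_sqr h g c e r w <= 2 * (tau / 2) ^+ 2.
    apply: osc_sqr_le_of => al; have := hn al => /negP; rewrite -leNgt => /le_trans; apply.
    rewrite /rho -/Nn le_eqVlt; apply/orP; left; apply/eqP; field; by rewrite gt_eqF.
  by rewrite expr_div_n tau2; exact: level_lt.
have mA : measurable A by apply: measurable_osc_level => //; exact: ltW.
(* An arc shorter than [kap] contains no interval of length [kap], so the level set is then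
   empty. *)
rewrite -/A; have [kL|Lk] := leP kap L; last first.
  rewrite (_ : A = set0) ?measure0 ?lee_fin.
    by rewrite divr_ge0 ?sqr_ge0// divr_ge0 ?sqr_ge0// mulr_ge0 ?sqr_ge0// mulr_ge0 ?(ltW L0)// mulr_ge0.
  apply/seteqP; split => w // /long[u [v [cu ve kv _]]].
  by have := le_trans kv (lerB ve cu); rewrite leNgt Lk.
pose x := 2 * L / kap; have x0 : 0 <= x by rewrite divr_ge0 ?(ltW kap0)// mulr_ge0// ltW.
pose m := (Num.truncn x).+1.
have xm : x < m%:R by rewrite -truncn_lt_nat.
have mx : m%:R <= 3 * L / kap.
  rewrite /m -[X in X <= _]natr1; have : (Num.truncn x)%:R <= x by rewrite truncn_le.
  have : 1 <= L / kap by rewrite ler_pdivlMr// mul1r.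
  by rewrite /x -!mulrA; exact: count_le.
have mR : 0 < m%:R :> R by rewrite ltr0n.
pose d := L / m%:R; have d0 : 0 < d by rewrite divr_gt0.
have dk : d < kap / 2.
  rewrite /d ltr_pdivrMr//; move: xm; rewrite /x ltr_pdivrMr//.
  by rewrite mulrAC ltr_pdivlMr// mulrC [kap * _]mulrC.
pose t (k : nat) := c + d * k%:R.
have tS k : t k.+1 = t k + d by rewrite /t -natr1; ring.
have tin k : (k <= m)%N -> c <= t k <= e.
  move=> km; rewrite lerDl mulr_ge0 ?(ltW d0)//= -lerBrDl.
  have -> : e - c = d * m%:R by rewrite /d -/L; field; rewrite gt_eqF.
  by rewrite ler_wpM2l ?(ltW d0)// ler_nat.
(* The difference quotient of [g1] over one mesh stands in for [g2]: it is close to [V2], and its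
   pairing with a direction is controlled by the values at two consecutive grid points. *)
pose B k := [set y : 'rV[R]_n | `|dotp y (g1 (t k))| <= del /\
  `|dotp y (d^-1 *: (g1 (t k.+1) - g1 (t k)))| <= 2 * del / d].
have AB : A `<=` \big[setU/set0]_(k < m) B k.
  move=> w Aw; have [u [v [cu ve kv small]]] := long w Aw.
  have [k km [tk1 tk2]] := grid_mem ce (ltn0Sn _) cu ve kv dk.
  rewrite -/(t k) -/(t k.+1) in tk1 tk2.
  rewrite -bigcup_mkord; exists k => //; split.
    by apply: small; rewrite tk1 (lt_trans _ tk2)// tS ltrDl.
  rewrite dotpZr dotpBr normrM ger0_norm ?invr_ge0 ?(ltW d0)// mulrC ler_wpM2r ?invr_ge0 ?(ltW d0)//.
  apply: le_trans (ler_normB _ _) _; rewrite mulr_natl mulr2n; apply: lerD; apply: small.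
    by rewrite tk2 (lt_trans tk1)// tS ltrDl.
  by rewrite tk1 (lt_trans _ tk2)// tS ltrDl.
have mB k : measurable (B k) by exact: measurable_slab.
have sB k : (k < m)%N -> (sigma (B k) <= (C * (del * (2 * del / d)))%:E)%E.
  move=> km.
  have hu : enorm (g1 (t k) - V1) <= eta by apply: hV1; exact: tin (ltnW km).
  have hw : enorm (d^-1 *: (g1 (t k.+1) - g1 (t k)) - V2) <= eta.
    have hS := tin k.+1 km; have hk := tin k (ltnW km).
    have dp t' : c <= t' <= e -> forall w,
        is_derive t' (1 : R) (fun s => dotp w (g1 s)) (dotp w (g2 t')).
      by move=> /andP[ct te]; apply: dg1; rewrite (le_trans ac)// (le_trans te).
    have := curve_increment (ltW eta0) dp hV2 hk hS.
    have -> : t k.+1 - t k = d by rewrite tS; ring.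
    rewrite (ger0_norm (ltW d0)) => H.
    have -> : d^-1 *: (g1 (t k.+1) - g1 (t k)) - V2 =
        d^-1 *: (g1 (t k.+1) - g1 (t k) - d *: V2).
      by rewrite [RHS]scalerBr scalerA mulVf ?scale1r// gt_eqF.
    by rewrite enormZ ger0_norm ?invr_ge0 ?(ltW d0)// mulrC ler_pdivrMr.
  have [U [W [U1 U2 W1 W2 [U3 W3]]]] := hdual _ _ hu hw.
  apply: (hslab _ _ U W) => //; first exact: ltW.
  by rewrite divr_ge0 ?(ltW d0)// mulr_ge0// ltW.
apply: (@le_trans _ _ (sigma (\big[setU/set0]_(k < m) B k))).
  by apply: le_measure; rewrite ?inE//; apply: bigsetU_measurable.
have boole := @Boole_inequality _ _ _ sigma B m (fun k _ => mB k).
apply: (le_trans boole).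
apply: (@le_trans _ _ (\sum_(k < m) (C * (del * (2 * del / d)))%:E)%E).
  by apply: lee_sum => k _; exact: sB.
rewrite sumEFin lee_fin sumr_const card_ord -[X in X <= _]mulr_natl.
have -> : 18 * C * L * K1 ^+ 2 / K2 ^+ 2 / (r * lam) ^+ 2 =
    (2 * C * del ^+ 2 / L) * (3 * L / kap) ^+ 2.
  by rewrite /del /kap -tau2; field; rewrite !gt_eqF.
have -> : m%:R * (C * (del * (2 * del / d))) = (2 * C * del ^+ 2 / L) * m%:R ^+ 2.
  by rewrite /d; field; rewrite !gt_eqF.
rewrite ler_wpM2l//.
  by rewrite divr_ge0 ?(ltW L0)// mulr_ge0 ?sqr_ge0// mulr_ge0.
rewrite ler_pXn2r ?nnegrE//.
by rewrite divr_ge0 ?(ltW kap0)// mulr_ge0// ltW.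
Qed.

Lemma osc_weak_le : a <= b ->
  (forall t, a <= t <= b ->
    0 < dotp (g1 t) (g1 t) * dotp (g2 t) (g2 t) - dotp (g1 t) (g2 t) ^+ 2) ->
  osc_weak h g a b.
Proof.
move=> ab gram; apply: (interval_induction ab) => [c m e ac cm me eb|t tab].
  exact: osc_weak_add.
exact: osc_weak_local (gram t tab).
Qed.

End weak_type.

(** * From moment and weak-type bounds to L^q norms *)

Section power_bounds.
Context {R : realType}.
Implicit Types (x q tau : R).

(** The first term dominates where [x <= tau] and the second where [x > tau]; [tau] remains free, to
    be balanced once the moments are known. *)
Lemma powR_interpolation x tau q : 0 <= x -> 0 < tau -> 2 <= q -> q <= 4 ->
  x `^ q <= tau `^ (q - 2) * x ^+ 2 + tau `^ (q - 4) * x ^+ 4.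
Proof.
move=> x0 tau0 q2 q4.
have h2 : 0 <= tau `^ (q - 2) * x ^+ 2 by rewrite mulr_ge0 ?powR_ge0 ?sqr_ge0.
have h4 : 0 <= tau `^ (q - 4) * x ^+ 4 by rewrite mulr_ge0 ?powR_ge0 ?exprn_ge0.
have [->|xn0] := eqVneq x 0.
  by rewrite powR0 ?addr_ge0 ?mulr_ge0 ?powR_ge0 ?exprn_ge0//; lra.
have xp : 0 < x by rewrite lt_def xn0.
have split y : x `^ q = x `^ (q - y) * x `^ y.
  by rewrite -powRD ?subrK// xn0 implybT.
have [xt|tx] := leP x tau.
  rewrite (split 2) (powR_mulrn 2 x0) -[leLHS]addr0; apply: lerD => //.
  by rewrite ler_wpM2r ?sqr_ge0// ge0_ler_powR ?nnegrE ?(ltW tau0)//; lra.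
rewrite (split 4) (powR_mulrn 4 x0) -[leLHS]add0r; apply: lerD => //.
rewrite ler_wpM2r ?exprn_ge0// -(opprB 4 q) !powRN lef_pV2 ?posrE ?powR_gt0//.
by rewrite ge0_ler_powR ?nnegrE ?(ltW tau0) ?(ltW tx)//; lra.
Qed.

(** A discrete layer-cake bound: above [tau], the largest dyadic height below [x] gives [x] up to a
    factor 2, and values below [tau] are absorbed in the first term. *)
Lemma powR_dyadic x tau q J : 0 <= x -> 0 < tau -> 0 <= q -> x <= tau * 2 ^+ J ->
  x `^ q <= tau `^ q +
    \sum_(j < J) (tau * 2 ^+ j.+1) `^ q * (if tau * 2 ^+ j < x then 1 else 0).
Proof.
move=> x0 tau0 q0; elim: J => [|J IH] xJ.
  rewrite big_ord0 addr0 ge0_ler_powR ?nnegrE ?(ltW tau0)//.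
  by move: xJ; rewrite expr0 mulr1.
rewrite big_ord_recr/= addrA.
have [h|h] := ltP (tau * 2 ^+ J) x; last by rewrite mulr0 addr0; exact: IH.
rewrite mulr1 -[leLHS]add0r; apply: lerD; last first.
  by rewrite ge0_ler_powR ?nnegrE// mulr_ge0 ?(ltW tau0)// exprn_ge0.
rewrite addr_ge0 ?powR_ge0// sumr_ge0// => j _.
by rewrite mulr_ge0 ?powR_ge0//; case: ifP.
Qed.

Lemma exists_exp2_ge x : exists J, x <= 2 ^+ J.
Proof.
exists (Num.truncn x).+1; have [x0|/ltW x0] := leP 0 x; last first.
  by apply: le_trans x0 _; rewrite exprn_ge0.
have : x < (Num.truncn x).+1%:R by rewrite -truncn_lt_nat.
move=> /ltW/le_trans; apply.
by rewrite -natrX ler_nat ltnW// ltn_expl.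
Qed.

Lemma one_lt_powR2 (p : R) : 0 < p -> 1 < 2 `^ p.
Proof.
move=> p0; have := @gt0_ltr_powR R p p0 1 2; rewrite powR1; apply; rewrite ?nnegrE//.
by rewrite ltr1n.
Qed.

End power_bounds.

Section integral_bounds.
Context {d : measure_display} {T : measurableType d} {R : realType}.
Variables (mu : {measure set T -> \bar R}) (F : T -> R) (S B : R).
Hypothesis muS : (mu setT <= S%:E)%E.
Hypothesis S0 : 0 <= S.
Hypothesis mF : measurable_fun setT F.
Hypothesis F0 : forall x, 0 <= F x.
Hypothesis FB : forall x, F x <= B.
Hypothesis B0 : 0 < B.

Let mFq (q : R) : measurable_fun setT (fun x => (F x `^ q)%:E).
Proof. by apply/measurable_EFinP; exact: (measurableT_comp (measurable_powR q)). Qed.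

Lemma int_powR_interpolation (tau q I2 I4 : R) : 0 < tau -> 2 <= q -> q <= 4 ->
  (\int[mu]_x (F x ^+ 2)%:E <= I2%:E)%E -> (\int[mu]_x (F x ^+ 4)%:E <= I4%:E)%E ->
  (\int[mu]_x (F x `^ q)%:E <= (tau `^ (q - 2) * I2 + tau `^ (q - 4) * I4)%:E)%E.
Proof.
move=> tau0 q2 q4 h2 h4.
have m k : measurable_fun setT (fun x => (F x ^+ k)%:E).
  by apply/measurable_EFinP; exact: measurable_funX.
have p k x : (0 <= (F x ^+ k)%:E)%E by rewrite lee_fin exprn_ge0.
apply: (@le_trans _ _ (\int[mu]_x ((tau `^ (q - 2))%:E * (F x ^+ 2)%:E +
    (tau `^ (q - 4))%:E * (F x ^+ 4)%:E))%E).
  apply: ge0_le_integral => //.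
  - by move=> x _; rewrite lee_fin powR_ge0.
  - by apply: emeasurable_funD; apply: measurable_funeM.
  - move=> x _; rewrite -!EFinM -EFinD lee_fin; exact: powR_interpolation.
rewrite ge0_integralD//=.
- rewrite !ge0_integralZl_EFin ?powR_ge0//; try by move=> x _.
  by rewrite EFinD !EFinM; apply: leeD; apply: lee_wpmul2l => //; rewrite lee_fin powR_ge0.
- by move=> x _; rewrite -EFinM lee_fin mulr_ge0 ?powR_ge0 ?sqr_ge0.
- by apply: measurable_funeM.
- by move=> x _; rewrite -EFinM lee_fin mulr_ge0 ?powR_ge0 ?exprn_ge0.
- by apply: measurable_funeM.
Qed.

Lemma int_powR_bounded (q I4 : R) : 4 <= q ->
  (\int[mu]_x (F x ^+ 4)%:E <= I4%:E)%E ->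
  (\int[mu]_x (F x `^ q)%:E <= (B `^ (q - 4) * I4)%:E)%E.
Proof.
move=> q4 h4.
have m : measurable_fun setT (fun x => (F x ^+ 4)%:E).
  by apply/measurable_EFinP; exact: measurable_funX.
apply: (@le_trans _ _ (\int[mu]_x ((B `^ (q - 4))%:E * (F x ^+ 4)%:E))%E).
  apply: ge0_le_integral => //.
  - by move=> x _; rewrite lee_fin powR_ge0.
  - exact: measurable_funeM.
  - move=> x _; rewrite -EFinM lee_fin -(powR_mulrn 4 (F0 x)).
    have [->|xn0] := eqVneq (F x) 0.
      by rewrite !powR0 ?mulr0//; lra.
    have -> : F x `^ q = F x `^ (q - 4) * F x `^ 4.
      by rewrite -powRD ?subrK// xn0 implybT.
    rewrite ler_wpM2r ?powR_ge0//.
    by rewrite ge0_ler_powR ?nnegrE ?(ltW B0) ?F0 ?FB//; lra.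
rewrite ge0_integralZl_EFin ?powR_ge0//; last by move=> x _; rewrite lee_fin exprn_ge0.
by rewrite EFinM; apply: lee_wpmul2l => //; rewrite lee_fin powR_ge0.
Qed.

Variable K : R.
Hypothesis K0 : 0 <= K.
Hypothesis weak : forall lam : R, 0 < lam ->
  (mu [set x | (lam < F x)%R] <= (K / lam ^+ 4)%:E)%E.

Lemma int_powR_dyadic (tau q : R) J : 0 < tau -> 0 <= q -> B <= tau * 2 ^+ J ->
  (\int[mu]_x (F x `^ q)%:E <=
    (tau `^ q * S + K * 2 `^ q * tau `^ (q - 4) * \sum_(j < J) (2 `^ (q - 4)) ^+ j)%:E)%E.
Proof.
move=> tau0 q0 BJ.
pose A (j : nat) := [set x | tau * 2 ^+ j < F x].
have mA j : measurable (A j).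
  rewrite (_ : A j = F @^-1` `]tau * 2 ^+ j, +oo[).
    by rewrite -[X in measurable X]setTI; exact: mF.
  by apply/seteqP; split => w /=; rewrite in_itv/= andbT.
pose G x := ((tau `^ q)%:E + \sum_(j < J) ((tau * 2 ^+ j.+1) `^ q)%:E * (\1_(A j) x)%:E)%E.
have mterm (j : 'I_J) : measurable_fun setT
    (fun x => ((tau * 2 ^+ j.+1) `^ q)%:E * (\1_(A j) x)%:E)%E.
  by apply: measurable_funeM; apply/measurable_EFinP; exact: measurable_indic.
have term0 (j : 'I_J) x : (0 <= ((tau * 2 ^+ j.+1) `^ q)%:E * (\1_(A j) x)%:E)%E.
  by rewrite mule_ge0// lee_fin ?powR_ge0.
have mS : measurable_fun setT
    (fun x => \sum_(j < J) ((tau * 2 ^+ j.+1) `^ q)%:E * (\1_(A j) x)%:E)%E.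
  by apply: emeasurable_sum.
apply: (@le_trans _ _ (\int[mu]_x G x)%E).
  apply: ge0_le_integral => //.
  - by move=> x _; rewrite lee_fin powR_ge0.
  - by apply: emeasurable_funD => //; exact: mS.
  - move=> x _; rewrite /G; under eq_bigr do rewrite -EFinM.
    rewrite sumEFin -EFinD lee_fin.
    apply: le_trans (powR_dyadic (F0 x) tau0 q0 (le_trans (FB x) BJ)) _.
    rewrite lerD2l; apply: ler_sum => j _; rewrite indicE.
    have [h|h] := ltP; first by rewrite mem_set.
    by rewrite memNset// /A/= ltNge h.
rewrite /G ge0_integralD//=; last 2 first.
- by move=> x _; rewrite lee_fin powR_ge0.
- by move=> x _; apply: sume_ge0 => j _.
rewrite integral_cst//= ge0_integral_sum//.
rewrite EFinD; apply: leeD; first by rewrite EFinM lee_wpmul2l// lee_fin powR_ge0.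
rewrite mulr_sumr -sumEFin; apply: lee_sum => j _.
rewrite ge0_integralZl_EFin ?powR_ge0//; last first.
  by apply/measurable_EFinP; exact: measurable_indic.
rewrite integral_indic// setIT.
have tj : 0 < tau * 2 ^+ j by rewrite mulr_gt0// exprn_gt0.
apply: le_trans (lee_wpmul2l _ (weak tj)) _; first by rewrite lee_fin powR_ge0.
rewrite -EFinM lee_fin le_eqVlt; apply/orP; left; apply/eqP.
have -> : tau * 2 ^+ j.+1 = 2 * (tau * 2 ^+ j) by rewrite exprS mulrCA.
rewrite powRM ?(ltW tj)//.
have dec (y : R) : 0 < y -> y `^ q = y `^ (q - 4) * y ^+ 4.
  by move=> y0; rewrite -(powR_mulrn 4 (ltW y0)) -powRD ?subrK// (gt_eqF y0) implybT.
rewrite (dec _ tj) powRM ?exprn_ge0//; last exact: ltW.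
have -> : (2 ^+ j) `^ (q - 4) = (2 `^ (q - 4)) ^+ j :> R.
  by elim: (j : nat) => [|i IH]; rewrite ?expr0 ?powR1// !exprS powRM ?exprn_ge0// IH.
have z0 : (tau * 2 ^+ j) ^+ 4 != 0 by rewrite expf_neq0// gt_eqF.
by move: z0; move: (_ ^+ 4) ((_ `^ _) ^+ j) => z y z0; field.
Qed.

(** [tau = r ^ (-1/2)] is the size predicted by the rate; since [q < 4], the layers above it form a
    convergent geometric series. *)
Lemma int_powR_weak_lt4 (r C q : R) : 2 <= r -> K = C / r ^+ 2 -> 0 <= q -> q < 4 ->
  (\int[mu]_x (F x `^ q)%:E <=
    ((S + C * 2 `^ q / (1 - 2 `^ (q - 4))) * r `^ (- (q / 2)))%:E)%E.
Proof.
move=> r2 KE q0 q4; have r0 : 0 < r by lra.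
have C0 : 0 <= C.
  by have := K0; rewrite KE pmulr_lge0// invr_gt0 exprn_gt0.
pose tau := r `^ (- 2^-1); have tau0 : 0 < tau by exact: powR_gt0.
have [J hJ] := exists_exp2_ge (B / tau).
have BJ : B <= tau * 2 ^+ J by rewrite mulrC -ler_pdivrMr.
apply: le_trans (int_powR_dyadic tau0 q0 BJ) _; rewrite lee_fin.
have Et s : tau `^ s = r `^ (- (s / 2)).
  by rewrite /tau -powRrM mulNr [_^-1 * s]mulrC.
have E2 : r `^ (- (q / 2)) = tau `^ (q - 4) / r ^+ 2.
  rewrite Et -(powR_mulrn 2 (ltW r0)) -powRN -powRD ?(gt_eqF r0) ?implybT//.
  by congr (_ `^ _); field.
pose y : R := 2 `^ (q - 4).
have y0 : 0 <= y by exact: powR_ge0.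
have y1 : y < 1.
  by rewrite /y -(opprB 4 q) powRN invf_lt1 ?powR_gt0// one_lt_powR2//; lra.
have geo : \sum_(j < J) y ^+ j <= (1 - y)^-1.
  have := subrX1 y J; set s := \sum_(_ < _) _ => E.
  rewrite -[leRHS]mul1r ler_pdivlMr; last by lra.
  have : 0 <= y ^+ J by exact: exprn_ge0.
  by move: E; set z := y ^+ J; lra.
rewrite mulrDl (Et q) -/y mulrC lerD2l KE E2.
have -> : C / r ^+ 2 * 2 `^ q * tau `^ (q - 4) * \sum_(j < J) y ^+ j =
  C * 2 `^ q * (\sum_(j < J) y ^+ j) * (tau `^ (q - 4) / r ^+ 2) by ring.
rewrite ler_wpM2r//; first by rewrite divr_ge0 ?powR_ge0 ?sqr_ge0.
by rewrite ler_wpM2l// mulr_ge0// powR_ge0.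
Qed.

(** For [q > 4] the sum over layers is dominated by the top one, at the height of the uniform bound
    [B]. The number of layers is such that [tau <= B / r], and then [tau ^ q] is at most a constant
    times [r ^- 2]. *)
Lemma int_powR_weak_gt4 (r C q : R) : 2 <= r -> K = C / r ^+ 2 -> 4 < q ->
  (\int[mu]_x (F x `^ q)%:E <=
    ((B `^ q * S + C * 2 `^ q * B `^ (q - 4) / (2 `^ (q - 4) - 1)) * r `^ (- 2))%:E)%E.
Proof.
move=> r2 KE q4; have r0 : 0 < r by lra.
have C0 : 0 <= C.
  by have := K0; rewrite KE pmulr_lge0// invr_gt0 exprn_gt0.
have [J hJ] := exists_exp2_ge r.
have p0 : 0 < 2 ^+ J :> R by exact: exprn_gt0.
pose tau := B / 2 ^+ J; have tau0 : 0 < tau by exact: divr_gt0.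
have BJ : B <= tau * 2 ^+ J by rewrite /tau divfK// gt_eqF.
have q0 : 0 <= q by lra.
apply: le_trans (int_powR_dyadic tau0 q0 BJ) _; rewrite lee_fin.
have E2 : r `^ (- 2) = (r ^+ 2)^-1 by rewrite powRN powR_mulrn// ltW.
pose y : R := 2 `^ (q - 4).
have y1 : 1 < y by rewrite one_lt_powR2//; lra.
have geo : \sum_(j < J) y ^+ j <= y ^+ J / (y - 1).
  have := subrX1 y J; set s := \sum_(_ < _) _ => E.
  by rewrite ler_pdivlMr; move: E; set z := y ^+ J; lra.
have Et s : tau `^ s = B `^ s / (2 `^ s) ^+ J.
  rewrite /tau powRM ?(ltW B0) ?invr_ge0 ?(ltW p0)//; congr (_ * _).
  rewrite -powR_inv1 ?(ltW p0)// -powRrM mulrC powRrM powR_inv1 ?powR_ge0//; congr (_^-1).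
  by elim: (J) => [|i IH]; rewrite ?expr0 ?powR1// !exprS powRM ?exprn_ge0// IH.
have yJ : 0 < y ^+ J by rewrite exprn_gt0//; lra.
rewrite E2 mulrDl; apply: lerD.
  rewrite mulrAC ler_wpM2r// Et ler_wpM2l ?powR_ge0//.
  rewrite lef_pV2 ?posrE ?exprn_gt0 ?powR_gt0//.
  apply: (@le_trans _ _ ((2 ^+ J) ^+ 2)).
    by rewrite ler_pXn2r ?nnegrE ?(ltW r0) ?(ltW p0).
  rewrite -exprM mulnC exprM lerXn2r ?nnegrE ?powR_ge0 ?exprn_ge0//.
  by rewrite -powR_mulrn// ler_powR//; lra.
rewrite KE Et -/y.
have -> : C / r ^+ 2 * 2 `^ q * (B `^ (q - 4) / y ^+ J) * \sum_(j < J) y ^+ j =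
  C * 2 `^ q * B `^ (q - 4) * ((\sum_(j < J) y ^+ j) / y ^+ J) / r ^+ 2 by ring.
rewrite ler_wpM2r ?invr_ge0 ?sqr_ge0// ler_wpM2l ?mulr_ge0 ?powR_ge0//.
by rewrite ler_pdivrMr// mulrC.
Qed.

End integral_bounds.

Section norm_bounds.
Context {d : measure_display} {T : measurableType d} {R : realType}.
Variables (mu : {measure set T -> \bar R}).

Lemma Lnorm_le (F : T -> R) (q K V : R) : 0 < q -> 0 <= K -> 0 <= V ->
  (forall x, 0 <= F x) -> (\int[mu]_x (F x `^ q)%:E <= (K * V `^ q)%:E)%E ->
  (Lnorm mu q%:E (fun x => (F x)%:E) <= (K `^ q^-1 * V)%:E)%E.
Proof.
move=> q0 K0 V0 F0 h; rewrite unlock.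
have -> : (\int[mu]_x (`|(F x)%:E| `^ q))%E = (\int[mu]_x (F x `^ q)%:E)%E.
  by apply: eq_integral => x _; rewrite /= ger0_norm// poweR_EFin.
have i0 : (0 <= \int[mu]_x (F x `^ q)%:E)%E.
  by apply: integral_ge0 => x _; rewrite lee_fin powR_ge0.
have KV0 : 0 <= K * V `^ q by rewrite mulr_ge0 ?powR_ge0.
apply: le_trans (gt0_ler_poweR (_ : 0 <= q^-1) _ _ h) _.
- by rewrite invr_ge0 ltW.
- by rewrite in_itv/= i0 leey.
- by rewrite in_itv/= lee_fin KV0 leey.
rewrite poweR_EFin powRM ?powR_ge0// -powRrM mulfV ?gt_eqF// powRr1//.
Qed.

End norm_bounds.

(** * Smooth curves and the Fourier transform of the measure *)

Section smooth_curves.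
Context {R : realType} {n : nat}.
Implicit Types (f : R -> 'rV[R]_n) (w : 'rV[R]_n) (a b t : R).

Lemma isder_of_quotient (phi : R -> R) t l :
  (s - t)^-1 * (phi s - phi t) @[s --> t^'] --> l -> is_derive t (1 : R) phi l.
Proof.
move=> cv.
have cv' : h^-1 *: ((phi \o shift t) (h *: (1 : R)) - phi t) @[h --> (0 : R)^'] --> l.
  apply/cvgrPdist_le => eps eps0.
  move/cvgrPdist_le : cv => /(_ eps eps0) /nbhs_ballP[del /= del0 hdel].
  apply/nbhs_ballP; exists del => //= h hd h0.
  have := hdel (h + t); rewrite /ball/= addrK.
  have -> : (h *: (1 : R) + t : R) = h + t by rewrite /GRing.scale/= mulr1.
  apply.
    by move: hd; rewrite /ball/= sub0r opprD addrCA subrr addr0.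
  by apply: contra h0 => /eqP E; apply/eqP; apply: (addIr t); rewrite E add0r.
apply: DeriveDef; first by apply/cvg_ex; exists l.
exact: cvg_lim cv'.
Qed.

Lemma diff_quotient_on_cvg a b f t : a < t < b -> cvg (diff_quotient_on `[a, b] f t) ->
  (s - t)^-1 *: (f s - f t) @[s --> t^'] --> derive1_on `[a, b] f t.
Proof.
move=> /andP[at_ tb] cv; apply: cvg_trans cv.
move=> P; rewrite /diff_quotient_on /= => hP.
have near_ab : \forall s \near t, `[a, b]%classic s.
  have : nbhs t `]a, b[%classic by apply: near_in_itvoo; rewrite in_itv/= at_ tb.
  apply: filterS => s /=; rewrite !in_itv/= => /andP[h1 h2]; by rewrite !ltW.
rewrite /dnbhs /within /= in hP *.
apply: filterS2 near_ab hP => s sab h st; apply: h; split => //.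
by move=> /= E; move: st; rewrite E eqxx.
Qed.

Lemma cvg_dotp {T : Type} (F : set_system T) {FF : Filter F} (v : T -> 'rV[R]_n) l w :
  v x @[x --> F] --> l -> dotp w (v x) @[x --> F] --> dotp w l.
Proof.
move=> vl; apply: cvg_sum_ord => i; apply: cvgM; first exact: cvg_cst.
exact: (@cvg_comp _ _ _ v (fun M : 'rV[R]_n => M ord0 i) F (nbhs l) _ vl (@coord_continuous R 1 n ord0 i l)).
Qed.

Lemma smooth_on_derive a b f k t w : smooth_on `[a, b] f -> a < t < b ->
  is_derive t (1 : R) (fun s => dotp w (derive1n_on `[a, b] k f s))
    (dotp w (derive1n_on `[a, b] k.+1 f t)).
Proof.
move=> sf tab; have /andP[at_ tb] := tab.
have tI : `[a, b]%classic t by rewrite /= in_itv/= !ltW.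
have := cvg_dotp (w := w) (diff_quotient_on_cvg tab (sf k t tI)).
under eq_fun do rewrite dotpZr dotpBr.
by move=> H; exact: (isder_of_quotient (H _)).
Qed.

Lemma smooth_on_C2 a b a' b' f : a < a' -> b' < b -> smooth_on `[a, b] f ->
  curve_C2 a' b' f (derive1n_on `[a, b] 1 f) (derive1n_on `[a, b] 2 f).
Proof.
move=> aa bb sf.
have sub t : a' <= t <= b' -> a < t < b.
  by move=> /andP[h1 h2]; rewrite (lt_le_trans aa)// (le_lt_trans h2).
split => t /sub tab w.
- exact: (smooth_on_derive 0 w sf tab).
- exact: (smooth_on_derive 1 w sf tab).
- exact: isder_cont (smooth_on_derive 2 w sf tab).
Qed.

End smooth_curves.

Section amplitudes.
Context {R : realType}.
Implicit Types (a b : R) (chi : R -> R[i]).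

Lemma csmooth_C1 chi : csmooth chi ->
  amplitude_C1 (fun t => complex.Re (chi t)) (derive1 (fun t => complex.Re (chi t))) /\
  amplitude_C1 (fun t => complex.Im (chi t)) (derive1 (fun t => complex.Im (chi t))).
Proof.
move=> hchi.
have C1 (h : R -> R) : (forall k t, derivable (derive1n k h) t 1) -> amplitude_C1 h (derive1 h).
  move=> dh; split => [t|t]; first by rewrite derive1E; apply: derivableP; exact: (dh 0%N t).
  have := dh 1%N t; rewrite derive1n1 => /derivableP /isder_cont; exact.
split; apply: C1 => k t; first exact: (hchi k t).1.
exact: (hchi k t).2.
Qed.

(** Both endpoints lie outside the closed support and have neighbourhoods where [chi] vanishes; half
    of these, shrunk so as not to overlap, are removed. On the remaining interval the derivatives of
    the curve are two-sided. *)
Lemma support_compact a b chi : a < b ->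
  closure [set t | chi t != 0] `<=` interior `[a, b] ->
  exists a' b', [/\ a < a', a' <= b', b' < b &
    forall t, a <= t <= b -> ~ (a' <= t <= b') -> chi t = 0].
Proof.
move=> ab; rewrite interior_itv_bnd => supp.
have van x : ~ `]a, b[%classic x ->
    exists2 eps : R, 0 < eps & forall t, `|t - x| < eps -> chi t = 0.
  move=> xab; have := contra_not (supp x) xab.
  move=> /existsNP[A /not_implyP[nA /set0P/negP]]; rewrite negbK => /eqP A0.
  have [eps /= eps0 heps] := (nbhs_ballP _ _).1 nA.
  exists eps => // t tx; apply: contrapT => /eqP ct.
  suff : set0 t by []; rewrite -A0; split => //; apply: heps.
  by rewrite /ball/= distrC.
have [|ea ea0 ha] := van a; first by rewrite /= in_itv/= ltxx.
have [|eb eb0 hb] := van b; first by rewrite /= in_itv/= ltxx andbF.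
pose ea' := Num.min ea ((b - a) / 2); pose eb' := Num.min eb ((b - a) / 2).
have a1 : ea' <= ea by rewrite ge_min lexx.
have a2 : ea' <= (b - a) / 2 by rewrite ge_min lexx orbT.
have b1 : eb' <= eb by rewrite ge_min lexx.
have b2 : eb' <= (b - a) / 2 by rewrite ge_min lexx orbT.
have ea'0 : 0 < ea' by rewrite lt_min ea0 divr_gt0// subr_gt0.
have eb'0 : 0 < eb' by rewrite lt_min eb0 divr_gt0// subr_gt0.
exists (a + ea' / 2), (b - eb' / 2); split; [lra|lra|lra|].
move=> t /andP[at_ tb] /negP; rewrite negb_and -!ltNge => /orP[h|h].
  by apply: ha; rewrite ger0_norm ?subr_ge0//; lra.
by apply: hb; rewrite ler0_norm ?subr_le0//; lra.
Qed.

End amplitudes.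

Section fourier_transform.
Context {R : realType} {n : nat}.
Implicit Types (a b r : R) (w : 'rV[R]_n).

(** With p = r<w,g(t)>, the integrand e^{-ip}(h1 + i h2) has real part h1 cos p + h2 sin p and
    imaginary part h2 cos p - h1 sin p; the sines are written as shifted cosines to match [osc]. *)
Lemma normc_mu_hat a b a' b' (g : R -> 'rV[R]_n) (chi : R -> R[i]) r w :
  a < a' -> b' < b ->
  (forall t, a <= t <= b -> ~ (a' <= t <= b') -> chi t = 0) ->
  let h1 t := complex.Re (chi t) in let h2 t := complex.Im (chi t) in
  Normc.normc (mu_hat `[a, b] g chi (r *: w)) =
  Num.sqrt ((\int[lebesgue_measure]_(t in `[a', b']) (h1 t * cos (r * dotp w (g t) + 0) +
     h2 t * cos (r * dotp w (g t) + - (pi / 2)))) ^+ 2 +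
   (\int[lebesgue_measure]_(t in `[a', b']) (h2 t * cos (r * dotp w (g t) + 0) +
     - 1 * (h1 t * cos (r * dotp w (g t) + - (pi / 2))))) ^+ 2)%R.
Proof.
move=> aa bb van h1 h2.
have restrict (f k : R -> R) : (forall t, a' <= t <= b' -> f t = k t) ->
    (forall t, a <= t <= b -> ~ (a' <= t <= b') -> f t = 0) ->
    (\int[lebesgue_measure]_(t in `[a, b]) f t = \int[lebesgue_measure]_(t in `[a', b']) k t)%R.
  move=> fk f0; rewrite Rintegral_mkcond [RHS]Rintegral_mkcond; congr Rintegral.
  apply/funext => t; rewrite !patchE.
  have [tab|tab] := pselect (a' <= t <= b').
    rewrite !mem_set ?fk//= in_itv//=; case/andP: tab => h h'.
    by rewrite (le_trans (ltW aa) h) (le_trans h' (ltW bb)).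
  rewrite [X in _ = if X then _ else _]memNset/=; last by rewrite in_itv.
  by case: ifPn => // /set_mem; rewrite /= in_itv/= => tab'; exact: f0.
have cosm x : cos (x - pi / 2) = sin x :> R.
  by rewrite cosB cos_pihalf sin_pihalf mulr0 add0r mulr1.
rewrite /mu_hat /cintegral /Normc.normc; congr (Num.sqrt (_ ^+ 2 + _ ^+ 2));
  apply: restrict => t ht.
- rewrite /expi dotpZl /h1 /h2; case: (chi t) => x y /=.
  by rewrite cosN sinN addr0 cosm; ring.
- by move=> /(van t ht) ->; rewrite mulr0.
- rewrite /expi dotpZl /h1 /h2; case: (chi t) => x y /=.
  by rewrite cosN sinN addr0 cosm; ring.
- by move=> /(van t ht) ->; rewrite mulr0.
Qed.

End fourier_transform.

(** * Bounds for complex amplitudes *)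

Section decay.
Context {R : realType} {n : nat}.
Local Notation sigma := (@surface_measure R n).
Local Notation int a b f := (\int[lebesgue_measure]_(x in `[a, b]) f x)%R.
Implicit Types (r : R) (w : 'rV[R]_n).
Variables (a b : R) (g g1 g2 : R -> 'rV[R]_n) (h k h1 k1 : R -> R).
Hypothesis ab : a <= b.
Hypothesis gC2 : curve_C2 a b g g1 g2.
Hypothesis hC1 : amplitude_C1 h h1.
Hypothesis kC1 : amplitude_C1 k k1.
Hypothesis gram : forall t, a <= t <= b ->
  0 < dotp (g1 t) (g1 t) * dotp (g2 t) (g2 t) - dotp (g1 t) (g2 t) ^+ 2.

(** The modulus in the form given by [normc_mu_hat]; [osc_normE] splits it into four real integrals
    [osc], to which the bounds for real amplitudes apply. *)
Definition osc_norm r w : R :=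
  Num.sqrt ((int a b (fun t => h t * cos (r * dotp w (g t) + 0) +
      k t * cos (r * dotp w (g t) + - (pi / 2)))) ^+ 2 +
    (int a b (fun t => k t * cos (r * dotp w (g t) + 0) +
      - 1 * (h t * cos (r * dotp w (g t) + - (pi / 2))))) ^+ 2).

Lemma osc_normE r w : osc_norm r w =
  Num.sqrt ((osc h g a b r w 0 + osc k g a b r w (- (pi / 2))) ^+ 2 +
            (osc k g a b r w 0 - osc h g a b r w (- (pi / 2))) ^+ 2).
Proof.
have ch al := osc_cont gC2 hC1 (lexx a) (lexx b) (r := r) (w := w) (al := al).
have ck al := osc_cont gC2 kC1 (lexx a) (lexx b) (r := r) (w := w) (al := al).
rewrite /osc_norm (intD (ch 0) (ck _)) (intD (ck 0)) ?intZ ?mulN1r//.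
by apply: cont_onM => //; exact: cont_on_cst.
Qed.

Lemma osc_norm_ge0 r w : 0 <= osc_norm r w.
Proof. exact: sqrtr_ge0. Qed.

Lemma osc_norm_sqr r w :
  osc_norm r w ^+ 2 <= 2 * osc_sqr h g a b r w + 2 * osc_sqr k g a b r w.
Proof.
rewrite osc_normE sqr_sqrtr ?addr_ge0 ?sqr_ge0// /osc_sqr.
move: (osc h g a b r w 0) (osc k g a b r w 0) => x z.
move: (osc h g a b r w _) (osc k g a b r w _) => t y.
rewrite -subr_ge0 (_ : _ - _ = (x - y) ^+ 2 + (z + t) ^+ 2) ?addr_ge0 ?sqr_ge0//; ring.
Qed.

Lemma measurable_osc_norm r : 0 <= r -> measurable_fun setT (osc_norm r).
Proof.
move=> r0.
rewrite (_ : osc_norm r = fun w =>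
    ((osc h g a b r w 0 + osc k g a b r w (- (pi / 2))) ^+ 2 +
     (osc k g a b r w 0 - osc h g a b r w (- (pi / 2))) ^+ 2) `^ 2^-1); last first.
  by apply/funext => w; rewrite osc_normE powR12_sqrt ?addr_ge0 ?sqr_ge0.
apply: (measurableT_comp (measurable_powR 2^-1)).
have mh al := measurable_osc gC2 hC1 al (lexx a) ab (lexx b) r0.
have mk al := measurable_osc gC2 kC1 al (lexx a) ab (lexx b) r0.
apply: measurable_funD; apply: measurable_funX.
  by apply: measurable_funD.
by apply: measurable_funB.
Qed.

Lemma osc_norm_bounded : exists2 B : R, 0 < B & forall r w, osc_norm r w <= B.
Proof.
have [X [X0 hX _]] := amplitude_C1_bounded hC1 ab.
have [Y [Y0 kY _]] := amplitude_C1_bounded kC1 ab.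
pose Z := (X + Y) * (b - a); have Z0 : 0 <= Z by rewrite mulr_ge0 ?subr_ge0// addr_ge0.
exists (4 * Z + 1) => [|r w]; first by rewrite ltr_wpDl// mulr_ge0.
have b0 : 0 <= b - a by rewrite subr_ge0.
have oh al : `|osc h g a b r w al| <= Z.
  apply: le_trans (osc_le gC2 hC1 r w al (lexx a) ab (lexx b) hX) _.
  by rewrite ler_wpM2r// lerDl.
have ok al : `|osc k g a b r w al| <= Z.
  apply: le_trans (osc_le gC2 kC1 r w al (lexx a) ab (lexx b) kY) _.
  by rewrite ler_wpM2r// lerDr.
have := osc_norm_sqr r w; have := osc_sqr_le_of oh; have := osc_sqr_le_of ok.
move=> h2 h3 h4.
rewrite -(ler_pXn2r (ltn0Sn 1)) ?nnegrE ?osc_norm_ge0//; last by rewrite addr_ge0// mulr_ge0.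
by have := sqr_ge0 Z; nra.
Qed.

Lemma osc_norm_moments : exists2 C : R, 0 <= C & forall r, 2 <= r ->
  (\int[sigma]_w (osc_norm r w ^+ 2)%:E <= (C / r)%:E)%E /\
  (\int[sigma]_w (osc_norm r w ^+ 4)%:E <= (C * ln r / r ^+ 2)%:E)%E.
Proof.
have [C1 C10 H1] := osc_moments_le gC2 hC1 ab gram.
have [C2 C20 H2] := osc_moments_le gC2 kC1 ab gram.
exists (8 * C1 + 8 * C2) => [|r r2]; first by rewrite addr_ge0// mulr_ge0.
have r0 : 0 <= r by lra.
have [i1 i2] := H1 r r2; have [j1 j2] := H2 r r2.
have mh := measurable_osc_sqr gC2 hC1 (lexx a) ab (lexx b) r0.
have mk := measurable_osc_sqr gC2 kC1 (lexx a) ab (lexx b) r0.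
have mF := measurable_osc_norm r0.
have h0 w := osc_sqr_ge0 g h a b r w; have k0 w := osc_sqr_ge0 g k a b r w.
split.
  apply: le_trans (surface_le (measurable_funX 2 mF) _ (fun w => sqr_ge0 _) _
    (fun w _ => osc_norm_sqr r w)) _.
  - by apply: measurable_funD; apply: measurable_funM.
  - by move=> w; rewrite addr_ge0// mulr_ge0.
  apply: le_trans (surface_integral_lin mh mk h0 k0 _ i1 j1) _ => //.
  by rewrite lee_fin !mulrA -mulrDl ler_wpM2r ?invr_ge0//; lra.
have p4 w : osc_norm r w ^+ 4 <= 8 * osc_sqr h g a b r w ^+ 2 + 8 * osc_sqr k g a b r w ^+ 2.
  rewrite (exprM _ 2 2); have := osc_norm_sqr r w; have := h0 w; have := k0 w.
  have := sqr_ge0 (osc_norm r w).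
  move: (osc_norm r w ^+ 2) (osc_sqr h g a b r w) (osc_sqr k g a b r w) => x y z x0 z0 y0 le.
  apply: (@le_trans _ _ ((2 * y + 2 * z) ^+ 2)).
    by rewrite ler_pXn2r ?nnegrE// addr_ge0// mulr_ge0.
  rewrite -subr_ge0 (_ : _ - _ = 4 * (y - z) ^+ 2); [rewrite mulr_ge0//; exact: sqr_ge0|ring].
apply: le_trans (surface_le (measurable_funX 4 mF) _ _ _ (fun w _ => p4 w)) _.
- by apply: measurable_funD; apply: measurable_funM => //; exact: measurable_funX.
- by move=> w; rewrite exprn_ge0// osc_norm_ge0.
- by move=> w; rewrite addr_ge0// mulr_ge0// sqr_ge0.
apply: le_trans (surface_integral_lin (measurable_funX 2 mh) (measurable_funX 2 mk)
  (fun w => sqr_ge0 _) (fun w => sqr_ge0 _) _ i2 j2) _ => //.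
by rewrite lee_fin le_eqVlt; apply/orP; left; apply/eqP; ring.
Qed.

Lemma osc_norm_weak N :
  (forall w, sphere w -> sign_changes_le `[a, b] (fun s => dotp w (g2 s)) N) ->
  exists2 C : R, 0 <= C & forall r (lam : R), 2 <= r -> 0 < lam ->
    (sigma [set w : 'rV[R]_n | (lam < osc_norm r w)%R] <= (C / r ^+ 2 / lam ^+ 4)%:E)%E.
Proof.
move=> sgn.
have [C1 C10 H1] := osc_weak_le gC2 hC1 sgn ab gram.
have [C2 C20 H2] := osc_weak_le gC2 kC1 sgn ab gram.
exists (16 * C1 + 16 * C2) => [|r lam r2 lam0]; first by rewrite addr_ge0// mulr_ge0.
have r0 : 0 <= r by lra.
(* If the modulus exceeds [lam], one of the two [osc_sqr] exceeds [lam ^+ 2 / 4], by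
   [osc_norm_sqr]. *)
have l0 : 0 < lam ^+ 2 / 4 by rewrite divr_gt0// exprn_gt0.
pose A (f : R -> R) := [set w : 'rV[R]_n | sphere w /\ lam ^+ 2 / 4 < osc_sqr f g a b r w].
have mA : measurable (A h) by exact: (measurable_osc_level gC2 hC1 _ (lexx a) ab (lexx b)).
have mA' : measurable (A k) by exact: (measurable_osc_level gC2 kC1 _ (lexx a) ab (lexx b)).
have mS : measurable (~` sphere : set 'rV[R]_n).
  by apply: measurableC; exact: measurable_sphere.
(* The level set is not confined to the sphere, so the null set off the sphere is added to the
   cover. *)
apply: (@le_trans _ _ (sigma (A h `|` A k `|` ~` sphere))).
  apply: le_measure; rewrite ?inE.
  - rewrite (_ : [set w | _] = osc_norm r @^-1` `]lam, +oo[).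
      rewrite -[X in measurable X]setTI; exact: measurable_osc_norm.
    by apply/seteqP; split => w /=; rewrite in_itv/= andbT.
  - by apply: measurableU => //; exact: measurableU.
  move=> w /= hw; have [w1|] := pselect (sphere w); last by right.
  left; have := osc_norm_sqr r w.
  have : lam ^+ 2 < osc_norm r w ^+ 2.
    by rewrite ltr_pXn2r ?nnegrE ?osc_norm_ge0// ltW.
  have [h'|h'] := ltP (lam ^+ 2 / 4) (osc_sqr h g a b r w); first by left.
  by move=> h2 h3; right; split => //; lra.
apply: le_trans (measureU2 _ (measurableU _ _ mA mA') mS) _.
have z : (sigma (~` sphere) <= 0)%E by rewrite surface_measure_sphereC.
apply: le_trans (leeD (lexx _) z) _; rewrite adde0.
apply: le_trans (measureU2 _ mA mA') _.
apply: le_trans (leeD (H1 r _ r2 l0) (H2 r _ r2 l0)) _.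
rewrite -EFinD lee_fin le_eqVlt; apply/orP; left; apply/eqP.
by field; apply/andP; split; rewrite gt_eqF//; lra.
Qed.

End decay.

(** * Rates of decay for each exponent *)

Section rates.
Context {d : measure_display} {T : measurableType d} {R : realType}.
Variables (mu : {measure set T -> \bar R}) (F : T -> R) (S B : R).
Hypothesis muS : (mu setT <= S%:E)%E.
Hypothesis S0 : 0 <= S.
Hypothesis mF : measurable_fun setT F.
Hypothesis F0 : forall x, 0 <= F x.
Hypothesis FB : forall x, F x <= B.
Hypothesis B0 : 0 < B.
Variables (r C q : R).
Hypothesis r2 : 2 <= r.
Hypothesis C0 : 0 <= C.

Let r0 : 0 < r. Proof. by move: r2; lra. Qed.

Let powRrD x y : r `^ (x + y) = r `^ x * r `^ y.
Proof. by rewrite powRD// (gt_eqF r0) implybT. Qed.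

Let ln0 : 0 < ln r.
Proof. by apply: ln_gt0; move: r2; lra. Qed.

Let powRlD x y : ln r `^ (x + y) = ln r `^ x * ln r `^ y.
Proof. by rewrite powRD// (gt_eqF ln0) implybT. Qed.

Lemma Lnorm_log_low : 2 <= q -> q <= 4 ->
  (\int[mu]_x (F x ^+ 2)%:E <= (C / r)%:E)%E ->
  (\int[mu]_x (F x ^+ 4)%:E <= (C * ln r / r ^+ 2)%:E)%E ->
  (Lnorm mu q%:E (fun x => (F x)%:E) <=
    ((2 * C) `^ q^-1 * (r `^ (- 2^-1) * ln r `^ (2^-1 - q^-1)))%:E)%E.
Proof.
move=> q2 q4 h2 h4.
have q0 : 0 < q by move: q2; lra.
apply: Lnorm_le => //; rewrite ?mulr_ge0 ?powR_ge0//.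
(* The choice [tau ^+ 2 = ln r / r] makes the contributions of the two moments equal, whence the
   factor 2 in the constant. *)
pose tau := ln r `^ 2^-1 * r `^ (- 2^-1).
have tau0 : 0 < tau by rewrite mulr_gt0 ?powR_gt0.
apply: le_trans (int_powR_interpolation mF F0 tau0 q2 q4 h2 h4) _.
have Et s : tau `^ s = ln r `^ (s / 2) * r `^ (- (s / 2)).
  rewrite /tau powRM ?powR_ge0// -!powRrM; congr (_ `^ _ * _ `^ _); ring.
rewrite !Et powRM ?powR_ge0// -!powRrM.
have -> : (2^-1 - q^-1) * q = (q - 4) / 2 + 1 by field; rewrite gt_eqF.
have -> : (q - 2) / 2 = (q - 4) / 2 + 1 by field.
have -> : - 2^-1 * q = - ((q - 4) / 2) - 2 by field.
have -> : - ((q - 4) / 2 + 1) = - ((q - 4) / 2) - 2 + 1 by field.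
rewrite !powRlD !powRrD powRr1 ?(ltW ln0)// powRr1 ?(ltW r0)//.
have -> : r `^ (- 2) = (r ^+ 2)^-1 by rewrite powRN powR_mulrn// ltW.
rewrite lee_fin le_eqVlt; apply/orP; left; apply/eqP.
by field; rewrite gt_eqF.
Qed.

(** Interpolation of the fourth moment with the uniform bound [B]. *)
Lemma Lnorm_log_high : 4 <= q ->
  (\int[mu]_x (F x ^+ 4)%:E <= (C * ln r / r ^+ 2)%:E)%E ->
  (Lnorm mu q%:E (fun x => (F x)%:E) <=
    ((B `^ (q - 4) * C) `^ q^-1 * (r `^ (- (2 * q^-1)) * ln r `^ q^-1))%:E)%E.
Proof.
move=> q4 h4; have q0 : 0 < q by move: q4; lra.
apply: Lnorm_le => //; rewrite ?mulr_ge0 ?powR_ge0//.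
apply: le_trans (int_powR_bounded mF F0 FB B0 q4 h4) _.
rewrite powRM ?powR_ge0// -!powRrM mulVf ?gt_eqF// powRr1 ?(ltW ln0)//.
have -> : - (2 * q^-1) * q = - 2 by field; rewrite gt_eqF.
have -> : r `^ (- 2) = (r ^+ 2)^-1 by rewrite powRN powR_mulrn// ltW.
by rewrite lee_fin le_eqVlt; apply/orP; left; apply/eqP; ring.
Qed.

Hypothesis weak : forall lam : R, 0 < lam ->
  (mu [set x | (lam < F x)%R] <= (C / r ^+ 2 / lam ^+ 4)%:E)%E.

Let K0 : 0 <= C / r ^+ 2. Proof. by rewrite divr_ge0 ?sqr_ge0. Qed.

Lemma Lnorm_low : 2 <= q -> q < 4 ->
  (Lnorm mu q%:E (fun x => (F x)%:E) <=
    ((S + C * 2 `^ q / (1 - 2 `^ (q - 4))) `^ q^-1 * r `^ (- 2^-1))%:E)%E.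
Proof.
move=> q2 q4; have q0 : 0 < q by move: q2; lra.
have y1 : 0 <= 1 - 2 `^ (q - 4).
  rewrite subr_ge0 -(opprB 4 q) powRN invf_le1 ?powR_gt0// ltW// one_lt_powR2//.
  by rewrite subr_gt0.
apply: Lnorm_le => //; rewrite ?powR_ge0//.
  by rewrite addr_ge0// divr_ge0// mulr_ge0// powR_ge0.
apply: le_trans (int_powR_weak_lt4 muS mF F0 FB K0 weak r2 erefl (ltW q0) q4) _.
by rewrite -powRrM; have -> : - 2^-1 * q = - (q / 2) by field.
Qed.

Lemma Lnorm_high : 4 < q ->
  (Lnorm mu q%:E (fun x => (F x)%:E) <=
    ((B `^ q * S + C * 2 `^ q * B `^ (q - 4) / (2 `^ (q - 4) - 1)) `^ q^-1 *
      r `^ (- (2 * q^-1)))%:E)%E.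
Proof.
move=> q4; have q0 : 0 < q by move: q4; lra.
have y1 : 0 <= 2 `^ (q - 4) - 1 by rewrite subr_ge0 ltW// one_lt_powR2// subr_gt0.
apply: Lnorm_le => //; rewrite ?powR_ge0//.
  by rewrite addr_ge0 ?mulr_ge0 ?powR_ge0 ?invr_ge0.
apply: le_trans (int_powR_weak_gt4 muS S0 mF F0 FB B0 K0 weak r2 erefl q4) _.
by rewrite -powRrM; have -> : - (2 * q^-1) * q = - 2 by field; rewrite gt_eqF.
Qed.

End rates.

Theorem theorem1p1 (R : realType) (d : nat) (hd : (3 <= d)%N)
    (a b : R) (hab : a < b)
    (gamma : R -> 'rV[R]_d) (hgamma : smooth_on `[a, b] gamma)
    (chi : R -> R[i]) (hchi : csmooth chi)
    (hsupp : closure [set t | chi t != 0] `<=` interior `[a, b])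
    (hindep : forall t, t \in `[a, b] ->
       free [:: derive1n_on `[a, b] 1 gamma t; derive1n_on `[a, b] 2 gamma t]) :
  (forall q : \bar R,
     ((2 <= q)%E -> (q <= 4)%E ->
        lesssim (G `[a, b] gamma chi q)
          (fun r => r `^ (- 2^-1) * ln r `^ (2^-1 - fine q^-1%E))) /\
     ((4 <= q)%E ->
        lesssim (G `[a, b] gamma chi q)
          (fun r => r `^ (- (2 * fine q^-1%E)) * ln r `^ fine q^-1%E))) /\
  (forall N : nat,
     (forall w, sphere w ->
        sign_changes_le `[a, b]
          (fun s => dotp w (derive1n_on `[a, b] 2 gamma s)) N) ->
     forall q : \bar R,
       ((2 <= q)%E -> (q < 4)%E ->
          lesssim (G `[a, b] gamma chi q) (fun r => r `^ (- 2^-1))) /\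
       ((4 < q)%E ->
          lesssim (G `[a, b] gamma chi q)
            (fun r => r `^ (- (2 * fine q^-1%E))))).
Proof.
(* Everything takes place on [[a', b']], strictly inside [[a, b]]: [chi] vanishes on the rest of
   [[a, b]]. *)
have [a' [b' [aa ab' bb van]]] := support_compact hab hsupp.
have gC2 := smooth_on_C2 aa bb hgamma.
have [hC1 kC1] := csmooth_C1 hchi.
have sub t : a' <= t <= b' -> t \in `[a, b].
  move=> /andP[h1 h2]; rewrite in_itv/=.
  by rewrite (le_trans (ltW aa) h1) (le_trans h2 (ltW bb)).
have gram t : a' <= t <= b' ->
    0 < dotp (derive1n_on `[a, b] 1 gamma t) (derive1n_on `[a, b] 1 gamma t) *
        dotp (derive1n_on `[a, b] 2 gamma t) (derive1n_on `[a, b] 2 gamma t) -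
        dotp (derive1n_on `[a, b] 1 gamma t) (derive1n_on `[a, b] 2 gamma t) ^+ 2.
  by move=> /sub /hindep; exact: gram_gt0_free.
pose F := osc_norm a' b' gamma (fun t => complex.Re (chi t)) (fun t => complex.Im (chi t)).
have FE r w : Normc.normc (mu_hat `[a, b] gamma chi (r *: w)) = F r w.
  exact: normc_mu_hat.
have [S S0 hS] := @surface_finite R d.
have [B B0 FB] := osc_norm_bounded ab' gC2 hC1 kC1.
have F0 r w : 0 <= F r w by exact: osc_norm_ge0.
have mF r : 2 <= r -> measurable_fun setT (F r).
  by move=> r2; apply: (measurable_osc_norm ab' gC2 hC1 kC1); move: r2; lra.
have Gfin (p r : R) : G `[a, b] gamma chi p%:E r =
    Lnorm surface_measure p%:E (fun w => (F r w)%:E).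
  rewrite (_ : (fun w => _) =
    fun w => (Normc.normc (mu_hat `[a, b] gamma chi (r *: w)))%:E)//.
  by apply/funext => w; rewrite FE.
have Goo r : (G `[a, b] gamma chi +oo%E r <= B%:E)%E.
  rewrite /G eqxx; apply: ge_ereal_sup => _ [w _ <-].
  by rewrite FE lee_fin; exact: FB.
split.
  have [C C0 hC] := osc_norm_moments ab' gC2 hC1 kC1 gram.
  move=> q; split.
    case: q => [p| |]//; rewrite !lee_fin => p2 p4.
    exists ((2 * C) `^ p^-1) => [|r r2]; first exact: powR_ge0.
    have [h2 h4] := hC r r2.
    by rewrite Gfin fine_invr; exact: (Lnorm_log_low (mF r r2) (F0 r) r2 C0 p2 p4 h2 h4).
  case: q => [p| |]//; rewrite ?lee_fin => p4.
    exists ((B `^ (p - 4) * C) `^ p^-1) => [|r r2]; first exact: powR_ge0.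
    have [h2 h4] := hC r r2.
    by rewrite Gfin fine_invr; exact: (Lnorm_log_high (mF r r2) (F0 r) (FB r) B0 r2 C0 p4 h4).
  (* At [q = +oo] the inverse exponent is 0, so the claimed rate is the constant 1 and the uniform
     bound suffices. *)
  exists B => [|r r2]; first exact: ltW.
  by rewrite invey /= mulr0 oppr0 !powRr0 !mulr1.
move=> N sgn.
have sgn' w : sphere w ->
    sign_changes_le `[a', b'] (fun s => dotp w (derive1n_on `[a, b] 2 gamma s)) N.
  move=> w1 s hs; apply: (sgn w w1) => t /hs; rewrite /= in_itv/= => /sub.
  by rewrite in_itv.
have [C C0 hC] := osc_norm_weak ab' gC2 hC1 kC1 gram sgn'.
move=> q; split.
  case: q => [p| |]//; rewrite lee_fin lte_fin => p2 p4.
  exists ((S + C * 2 `^ p / (1 - 2 `^ (p - 4))) `^ p^-1) => [|r r2]; first exact: powR_ge0.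
  rewrite Gfin.
  exact: (Lnorm_low hS S0 (mF r r2) (F0 r) (FB r) r2 C0 (hC r ^~ r2) p2 p4).
case: q => [p| |]//; rewrite ?lte_fin => p4.
  exists ((B `^ p * S + C * 2 `^ p * B `^ (p - 4) / (2 `^ (p - 4) - 1)) `^ p^-1) => [|r r2].
    exact: powR_ge0.
  rewrite Gfin fine_invr.
  exact: (Lnorm_high hS S0 (mF r r2) (F0 r) (FB r) B0 r2 C0 (hC r ^~ r2) p4).
exists B => [|r r2]; first exact: ltW.
by rewrite invey /= mulr0 oppr0 powRr0 mulr1.
Qed.
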